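(* Let $\alpha>0$, $w<0$, and let $P(t)=\sum_{k=0}^{\infty}a_k e^{2\pi i b_k t}$ with $\sum_k|a_k|<\infty$ and $b_k\geq 0$ for each $k$. Let $g(t)=\dfrac{P(t)}{t-iw}$. Then the Gabor system $\mathcal{G}(g;\alpha,1)=\{e^{2\pi i m t}g(t-\alpha n)\}_{m,n\in\mathbb{Z}}$ is a frame in $L^2(\mathbb{R})$ if and only if there exist constants $c,C>0$ such that for every $G\in L^2(\mathbb{R})$, $$c\|G\|_2^2\leq \sum_{m\in\mathbb{Z}}\int_0^{1/\alpha}\Big|\sum_{k=0}^{\infty}a_k A_k\big[G(\cdot+m+b_k)\big](t)\Big|^2dt\leq C\|G\|_2^2,$$ where for each $m,k$ the function $t\mapsto G(t+m+b_k)$ is regarded as an element of $L^2(0,\alpha^{-1})$ (i.e. restricted to $t\in[0,\alpha^{-1}]$).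
   Context: A system $\{g_j\}$ in $L^2(\mathbb{R})$ is a frame if there are $A,B>0$ with $A\|f\|^2\leq\sum_j|(f,g_j)|^2\leq B\|f\|^2$ for all $f\in L^2(\mathbb{R})$. For each $k$ let $b_k^{*}\in[0,\alpha^{-1})$ denote $b_k \bmod \alpha^{-1}$. The operator $A_k:L^2(0,\alpha^{-1})\to L^2(0,\alpha^{-1})$ is defined by $$A_k f(t)=\begin{cases} e^{-2\pi w b_k^{*}}f(t-b_k^{*}), & b_k^{*}<t\leq \alpha^{-1},\\ e^{-2\pi w (b_k^{*}-\alpha^{-1})}f(t-b_k^{*}+\alpha^{-1}), & 0\leq t\leq b_k^{*},\end{cases}$$ i.e. $A_k=M_{e^{-2\pi w t}}L_{b_k^*}M_{e^{2\pi w t}}$ where $M_\varphi$ is multiplication by $\varphi$ and $L_{b}$ is the circular shift by $b$ on $L^2(0,\alpha^{-1})$. *)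

(* Defs.v *)
(* MathComp + MathComp-Analysis (R : realType), complex numbers R[i]
   from mathcomp-real-closed. *)
From HB Require Import structures.
From mathcomp Require Import all_boot all_order all_algebra.
From mathcomp Require Import all_classical all_reals all_analysis.
From mathcomp Require Import complex.

Set Implicit Arguments.
Unset Strict Implicit.
Unset Printing Implicit Defensive.

Import Order.TTheory GRing.Theory Num.Theory.

Import numFieldNormedType.Exports.
Local Open Scope ring_scope.
Local Open Scope classical_set_scope.
Local Open Scope complex_scope.

Section Defs.
Variable R : realType.

(* |z|^2 and |z| for z : R[i] *)
Definition csq (z : R[i]) : R := complex.Re z ^+ 2 + complex.Im z ^+ 2.
Definition cabs (z : R[i]) : R := Num.sqrt (csq z).

(* e^{i x} *)
Definition cexpi (x : R) : R[i] := cos x +i* sin x.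

(* Sum of a (real, resp. complex) series: limit of the partial sums *)
Definition rsum (u : nat -> R) : R := limn (series u).
Definition csum (u : nat -> R[i]) : R[i] :=
  rsum (fun k => complex.Re (u k)) +i* rsum (fun k => complex.Im (u k)).

(* Lebesgue measurability of a complex-valued function on R *)
Definition cmeasurable (f : R -> R[i]) : Prop :=
  measurable_fun [set: R] (fun x => complex.Re (f x)) /\
  measurable_fun [set: R] (fun x => complex.Im (f x)).

(* ||f||_2^2 (extended real) *)
Definition normsq (f : R -> R[i]) : \bar R :=
  (\int[lebesgue_measure]_(x in [set: R]) (csq (f x))%:E)%E.

(* f ∈ L^2(R) *)
Definition L2 (f : R -> R[i]) : Prop :=
  cmeasurable f /\ (normsq f < +oo)%E.

(* Lebesgue integral of a complex-valued function over R *)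
Definition cintegral (f : R -> R[i]) : R[i] :=
  (\int[lebesgue_measure]_(x in [set: R]) complex.Re (f x))%R
  +i* (\int[lebesgue_measure]_(x in [set: R]) complex.Im (f x))%R.

(* inner product (f, g) = ∫ f conj(g) *)
Definition inner (f g : R -> R[i]) : R[i] :=
  cintegral (fun t => f t * (g t)^*).

(* {g_j}_{j in I} is a frame in L^2(R) *)
Definition is_frame (I : choiceType) (gs : I -> R -> R[i]) : Prop :=
  (forall j, L2 (gs j)) /\
  exists A B : R, 0 < A /\ 0 < B /\
    forall f, L2 f ->
      (A%:E * normsq f <= \esum_(j in [set: I]) (csq (inner f (gs j)))%:E)%E /\
      (\esum_(j in [set: I]) (csq (inner f (gs j)))%:E <= B%:E * normsq f)%E.

(* Gabor system G(g; alpha, 1): (m, n) |-> e^{2 pi i m t} g(t - alpha n) *)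
Definition gabor (g : R -> R[i]) (alpha : R) (mn : int * int) : R -> R[i] :=
  fun t => cexpi (2 * pi * (mn.1)%:~R * t) * g (t - alpha * (mn.2)%:~R).

(* P(t) = sum_k a_k e^{2 pi i b_k t} *)
Definition Pfun (a : nat -> R[i]) (b : nat -> R) (t : R) : R[i] :=
  csum (fun k => a k * cexpi (2 * pi * b k * t)).

(* g(t) = P(t) / (t - i w) *)
Definition gfun (a : nat -> R[i]) (b : nat -> R) (w : R) (t : R) : R[i] :=
  Pfun a b t / (t%:C - 'i * w%:C).

(* b mod p, in [0, p) for p > 0 *)
Definition rmod (b p : R) : R := b - p * (Num.floor (b / p))%:~R.

(* The operator A_k on L^2(0, alpha^-1), with bs = b_k^* *)
Definition Aop (alpha w bs : R) (f : R -> R[i]) (t : R) : R[i] :=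
  if bs < t then (expR (- (2 * pi * w * bs)))%:C * f (t - bs)
  else (expR (- (2 * pi * w * (bs - alpha^-1))))%:C * f (t - bs + alpha^-1).

(* the interval [0, alpha^-1] *)
Definition I0 (alpha : R) : set R := `[0, alpha^-1].

(* sum_m int_0^{1/alpha} | sum_k a_k A_k[G(. + m + b_k)](t) |^2 dt *)
Definition Aquad (alpha w : R) (a : nat -> R[i]) (b : nat -> R)
    (G : R -> R[i]) : \bar R :=
  (\esum_(m in [set: int])
     \int[lebesgue_measure]_(t in I0 alpha)
       (csq (csum (fun k => a k *
          Aop alpha w (rmod (b k) alpha^-1)
              (fun s => G (s + m%:~R + b k)) t)))%:E)%E.

End Defs.

(* Main.v *)
(* With p = 1/alpha, the kernel 1/(t - iw) is, up to the constant -2 pi i, the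
   Fourier transform of the one-sided exponential u(x) = 1_{x > 0} e^{2 pi w x}.
   Hence, by Plancherel, pairing f with the Gabor atom (m, n) amounts to pairing
   F = hat f with sum_k a_k u(x - m - b_k) e^{-2 pi i alpha n (x - m)}.  Write F as
   a twisted difference F = G - q G(. + p), where q = e^{2 pi w p} < 1; this is a
   bounded operation in G, bounded below and with dense range.  The integral
   against each term then telescopes to the single period ]b_k, b_k + p], and
   folding this period onto [0, p] produces e^{2 pi w x} A_k[G(. + m + b_k)](x).
   So for fixed m the pairings are the Fourier coefficients on [0, p] of
   e^{2 pi w x} sum_k a_k A_k[G(. + m + b_k)](x), and Parseval turns their sum over
   n into the integral of the theorem, up to the weight e^{4 pi w x}, which is
   bounded between q^2 and 1 on [0, p].  All the frame inequalities involved extend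
   from dense subspaces. *)
Require Import Defs.
From HB Require Import structures.
From mathcomp Require Import all_boot all_order all_algebra.
From mathcomp Require Import all_classical all_reals all_analysis.
From mathcomp Require Import complex ring lra.

Import Order.TTheory GRing.Theory Num.Theory.
Import numFieldNormedType.Exports.
Local Open Scope ring_scope.
Local Open Scope classical_set_scope.
Set Implicit Arguments.
Unset Strict Implicit.
Unset Printing Implicit Defensive.
From mathcomp Require Import measurable_realfun.

(** * Complex-valued integration *)

Section ComplexAlgebra.
Variable R : realType.
Implicit Types (x y z : R[i]) (r s : R).

(** The Fourier transform occurs only as the integral [hat], never as its extension to L^2.
    Plancherel is therefore proved for square-integrable functions of bounded support, and the
    identity between [fgabor] and [fatom] is available only for them. Hence each direction of that
    equivalence ends with a density argument, over a different dense class on each side; likewise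
    the range of the twisted difference is only shown to be dense. Density is enough because every
    single pairing is a bounded functional. Parseval's identity is obtained from Fejér means: their
    defect is a nonnegative quadratic form, so it is controlled first on continuous functions and
    then, by density, on all of L^2 of a period. Since G is merely square integrable, the series of
    the a_k A_k[G(. + m + b_k)] converges only almost everywhere, and [csum] takes a default value
    elsewhere. Cauchy-Schwarz with weights |a_k| supplies both the convergence and the domination.
    Only the existence of bounds matters, so |x + y|^2 <= 2|x|^2 + 2|y|^2 replaces sharper
    inequalities throughout. *)

Lemma csq_ge0 z : 0 <= csq z.
Proof. by rewrite /csq addr_ge0 ?sqr_ge0. Qed.

Lemma csqM x y : csq (x * y) = csq x * csq y.
Proof. by case: x y => [a b] [c d]; rewrite /csq /=; ring. Qed.

Lemma csqJ z : csq (conjc z) = csq z.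
Proof. by case: z => a b; rewrite /csq /= sqrrN. Qed.

Lemma csqN z : csq (- z) = csq z.
Proof. by case: z => a b; rewrite /csq /= !sqrrN. Qed.

Lemma csq_real r : csq r%:C%C = r ^+ 2.
Proof. by rewrite /csq /= expr0n addr0. Qed.

Lemma csqD_le x y : csq (x + y) <= 2 * csq x + 2 * csq y.
Proof.
case: x y => [a b] [c d]; rewrite /csq /=.
have := sqr_ge0 (a - c); have := sqr_ge0 (b - d).
nra.
Qed.

Lemma csqB_le x y : csq (x - y) <= 2 * csq x + 2 * csq y.
Proof. by rewrite -(csqN y); exact: csqD_le. Qed.

Lemma csq0 : csq (0 : R[i]) = 0.
Proof. by rewrite /csq /= expr0n addr0. Qed.

Lemma csq_cexpi r : csq (cexpi r) = 1.
Proof. by rewrite /csq /cexpi /= cos2Dsin2. Qed.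

Lemma cexpiD r s : cexpi (r + s) = cexpi r * cexpi s.
Proof.
rewrite /cexpi cosD sinD; apply/eqP; rewrite eq_complex /=.
by rewrite eqxx /= addrC.
Qed.

Lemma cexpi0 : cexpi (0 : R) = 1.
Proof. by rewrite /cexpi cos0 sin0. Qed.

Lemma cexpiN r : cexpi (- r) = conjc (cexpi r).
Proof. by rewrite /cexpi cosN sinN. Qed.

Lemma cabs_ge0 z : 0 <= cabs z.
Proof. exact: sqrtr_ge0. Qed.

Lemma sqr_cabs z : cabs z ^+ 2 = csq z.
Proof. by rewrite sqr_sqrtr // csq_ge0. Qed.

Lemma cabsM x y : cabs (x * y) = cabs x * cabs y.
Proof. by rewrite /cabs csqM sqrtrM // csq_ge0. Qed.

Lemma cabs_cexpi r : cabs (cexpi r) = 1.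
Proof. by rewrite /cabs csq_cexpi sqrtr1. Qed.

Lemma cabs_real r : cabs r%:C%C = `|r|.
Proof. by rewrite /cabs csq_real sqrtr_sqr. Qed.

Lemma normr_Re_cabs z : `|complex.Re z| <= cabs z.
Proof.
rewrite -sqrtr_sqr /cabs; apply: ler_wsqrtr.
by rewrite /csq lerDl sqr_ge0.
Qed.

Lemma normr_Im_cabs z : `|complex.Im z| <= cabs z.
Proof.
rewrite -sqrtr_sqr /cabs; apply: ler_wsqrtr.
by rewrite /csq lerDr sqr_ge0.
Qed.

Lemma cabs_le_ReIm z : cabs z <= `|complex.Re z| + `|complex.Im z|.
Proof.
rewrite -(@ler_sqr _ (cabs z)) ?nnegrE ?addr_ge0 ?cabs_ge0//.
rewrite sqr_cabs /csq sqrrD !real_normK ?num_real//.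
by rewrite lerD2r lerDl mulrn_wge0// mulr_ge0.
Qed.

Lemma cabs_AMGM x y : cabs (x * y) <= csq x + csq y.
Proof.
rewrite cabsM -!sqr_cabs.
have := sqr_ge0 (cabs x - cabs y).
have := cabs_ge0 x; have := cabs_ge0 y; nra.
Qed.

Lemma ReM_complex x y :
  complex.Re (x * y) = complex.Re x * complex.Re y - complex.Im x * complex.Im y.
Proof. by case: x y => [a b] [c d]. Qed.

Lemma ImM_complex x y :
  complex.Im (x * y) = complex.Re x * complex.Im y + complex.Im x * complex.Re y.
Proof. by case: x y => [a b] [c d]. Qed.

Lemma ReD_complex x y : complex.Re (x + y) = complex.Re x + complex.Re y.
Proof. by case: x y => [a b] [c d]. Qed.

Lemma ImD_complex x y : complex.Im (x + y) = complex.Im x + complex.Im y.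
Proof. by case: x y => [a b] [c d]. Qed.

Lemma ReB_complex x y : complex.Re (x - y) = complex.Re x - complex.Re y.
Proof. by case: x y => [a b] [c d]. Qed.

Lemma ImB_complex x y : complex.Im (x - y) = complex.Im x - complex.Im y.
Proof. by case: x y => [a b] [c d]. Qed.

Lemma ReJ_complex x : complex.Re (conjc x) = complex.Re x.
Proof. by case: x. Qed.

Lemma ImJ_complex x : complex.Im (conjc x) = - complex.Im x.
Proof. by case: x. Qed.

Lemma complex_eq x y :
  complex.Re x = complex.Re y -> complex.Im x = complex.Im y -> x = y.
Proof. by case: x y => [a b] [c d] /= -> ->. Qed.

End ComplexAlgebra.

Section ComplexIntegral.
Variable R : realType.
Notation mu := (@lebesgue_measure R).
Implicit Types (D E : set (measurableTypeR R)) (f g : R -> R[i]) (z : R[i]).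

(** Localised forms of the notions in the statement: at [D := setT], [cmeas], [cint] and [sqint] are
    convertible to [cmeasurable], [cintegral] and [normsq], and the final lemmas pass between them
    by conversion. *)
Definition cmeas D f : Prop :=
  measurable_fun D (fun x => complex.Re (f x)) /\
  measurable_fun D (fun x => complex.Im (f x)).

Definition cintegrable D f : Prop :=
  mu.-integrable D (fun x => (complex.Re (f x))%:E) /\
  mu.-integrable D (fun x => (complex.Im (f x))%:E).

Definition cint D f : R[i] :=
  ((\int[mu]_(x in D) complex.Re (f x))%R
   +i* (\int[mu]_(x in D) complex.Im (f x))%R)%C.

Definition sqint D f : \bar R := (\int[mu]_(x in D) (csq (f x))%:E)%E.

Lemma cmeas_cst D z : cmeas D (fun=> z).
Proof. by split; exact: measurable_cst. Qed.

Lemma cmeas_real D (u : R -> R) : measurable_fun D u -> cmeas D (fun x => (u x)%:C%C).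
Proof. by move=> mu_; split => //=; exact: measurable_cst. Qed.

Lemma cmeasS D E f : measurable E -> D `<=` E -> cmeas E f -> cmeas D f.
Proof. by move=> mE DE [fr fi]; split; apply: measurable_funS DE _. Qed.

Lemma cmeasTS D f : cmeas setT f -> cmeas D f.
Proof. by move=> h; apply: cmeasS h. Qed.

Lemma cmeasD D f g : cmeas D f -> cmeas D g -> cmeas D (fun x => f x + g x).
Proof.
move=> [fr fi] [gr gi]; split.
  by under eq_fun do rewrite ReD_complex; exact: measurable_funD.
by under eq_fun do rewrite ImD_complex; exact: measurable_funD.
Qed.

Lemma cmeasB D f g : cmeas D f -> cmeas D g -> cmeas D (fun x => f x - g x).
Proof.
move=> [fr fi] [gr gi]; split.
  by under eq_fun do rewrite ReB_complex; exact: measurable_funB.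
by under eq_fun do rewrite ImB_complex; exact: measurable_funB.
Qed.

Lemma cmeasM D f g : cmeas D f -> cmeas D g -> cmeas D (fun x => f x * g x).
Proof.
move=> [fr fi] [gr gi]; split.
  under eq_fun do rewrite ReM_complex.
  by apply: measurable_funB; exact: measurable_funM.
under eq_fun do rewrite ImM_complex.
by apply: measurable_funD; exact: measurable_funM.
Qed.

Lemma cmeasJ D f : cmeas D f -> cmeas D (fun x => conjc (f x)).
Proof.
move=> [fr fi]; split.
  by under eq_fun do rewrite ReJ_complex.
under eq_fun do rewrite ImJ_complex.
exact: measurableT_comp.
Qed.

Lemma cmeas_cexpi D (u : R -> R) : measurable_fun D u -> cmeas D (fun x => cexpi (u x)).
Proof.
move=> h; split => /=; apply: measurableT_comp h.
  exact: continuous_measurable_fun (@continuous_cos R).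
exact: continuous_measurable_fun (@continuous_sin R).
Qed.

Lemma cmeas_csq D f : cmeas D f -> measurable_fun D (fun x => csq (f x)).
Proof.
move=> [fr fi]; rewrite /csq; apply: measurable_funD;
  exact: (@measurableT_comp _ _ _ _ _ _ (fun x : R => x ^+ 2)).
Qed.

Lemma cmeas_cabs D f : cmeas D f -> measurable_fun D (fun x => cabs (f x)).
Proof.
move=> mf; rewrite /cabs; apply: measurableT_comp (cmeas_csq mf).
exact: continuous_measurable_fun (@sqrt_continuous R).
Qed.

Lemma cintegrable_cmeas D f : cintegrable D f -> cmeas D f.
Proof.
by move=> [/measurable_int/measurable_EFinP ? /measurable_int/measurable_EFinP ?].
Qed.

Lemma cintegrable_cabs D f : measurable D -> cintegrable D f ->
  mu.-integrable D (fun x => (cabs (f x))%:E).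
Proof.
move=> mD fi; have mf := cintegrable_cmeas fi; case: fi => fr fi.
apply: (@le_integrable _ _ _ mu D mD _
  (fun x => (`|complex.Re (f x)|)%:E + (`|complex.Im (f x)|)%:E)%E) => //.
- by apply/measurable_EFinP; exact: cmeas_cabs.
- move=> x _; rewrite /= ger0_norm ?cabs_ge0// ger0_norm ?addr_ge0// lee_fin.
  exact: cabs_le_ReIm.
- by apply: integrableD => //; exact: integrable_norm.
Qed.

Lemma cintegrable_le D f (u : R -> R) : measurable D -> cmeas D f ->
  (forall x, D x -> cabs (f x) <= u x) -> mu.-integrable D (fun x => (u x)%:E) ->
  cintegrable D f.
Proof.
move=> mD [fr fi] fu ui; split.
- apply: le_integrable ui => //; first exact/measurable_EFinP.
  move=> x Dx; rewrite /= lee_fin; apply: le_trans (normr_Re_cabs _) _.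
  exact: le_trans (fu _ Dx) (ler_norm _).
- apply: le_integrable ui => //; first exact/measurable_EFinP.
  move=> x Dx; rewrite /= lee_fin; apply: le_trans (normr_Im_cabs _) _.
  exact: le_trans (fu _ Dx) (ler_norm _).
Qed.

Lemma cintegrable_lty D f : measurable D -> cintegrable D f ->
  (\int[mu]_(x in D) (cabs (f x))%:E < +oo)%E.
Proof. by move=> mD fi; exact: integrable_lty (cintegrable_cabs mD fi). Qed.

Lemma cintegrableS D E f : measurable E -> measurable D -> D `<=` E ->
  cintegrable E f -> cintegrable D f.
Proof. by move=> mE mD DE [fr fi]; split;
  [exact: (integrableS mE mD DE fr)|exact: (integrableS mE mD DE fi)]. Qed.

Lemma cintegrableM_bounded D f g (M : R) : measurable D ->
  cmeas D f -> (forall x, D x -> csq (f x) <= M ^+ 2) -> cintegrable D g ->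
  cintegrable D (fun x => f x * g x).
Proof.
move=> mD mf fM gi; have mg := cintegrable_cmeas gi.
apply: (@cintegrable_le _ _ (fun x => `|M| * cabs (g x))) => //.
- exact: cmeasM.
- move=> x Dx; rewrite cabsM ler_wpM2r ?cabs_ge0//.
  by rewrite /cabs -sqrtr_sqr ler_wsqrtr// fM.
- under eq_fun do rewrite EFinM.
  by apply: integrableZl => //; exact: cintegrable_cabs.
Qed.

Lemma cintegrableZ D f z : measurable D -> cintegrable D f ->
  cintegrable D (fun x => z * f x).
Proof.
move=> mD fi; apply: (@cintegrableM_bounded D (fun=> z) f (cabs z)) => //.
by move=> x _; rewrite sqr_cabs.
Qed.

Lemma eq_cint D f g : (forall x, D x -> f x = g x) -> cint D f = cint D g.
Proof.
by move=> fg; rewrite /cint; congr Complex; apply: eq_Rintegral => x;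
  rewrite inE => /fg ->.
Qed.

Lemma cintD D f g : measurable D -> cintegrable D f -> cintegrable D g ->
  cint D (fun x => f x + g x) = cint D f + cint D g.
Proof.
move=> mD [fr fi] [gr gi]; rewrite /cint; apply: complex_eq => /=.
  rewrite -RintegralD//; apply: eq_Rintegral => x _; exact: ReD_complex.
rewrite -RintegralD//; apply: eq_Rintegral => x _; exact: ImD_complex.
Qed.

Lemma cintZ D f z : measurable D -> cintegrable D f ->
  cint D (fun x => z * f x) = z * cint D f.
Proof.
move=> mD [fr fi]; rewrite /cint; apply: complex_eq.
  rewrite ReM_complex/= -!RintegralZl// -RintegralB//.
  - by apply: eq_Rintegral => x _; exact: ReM_complex.
  - under [X in _.-integrable _ X]eq_fun do rewrite /= EFinM.
    exact: integrableZl.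
  - under [X in _.-integrable _ X]eq_fun do rewrite /= EFinM.
    exact: integrableZl.
rewrite ImM_complex/= -!RintegralZl// -RintegralD//.
- by apply: eq_Rintegral => x _; exact: ImM_complex.
- under [X in _.-integrable _ X]eq_fun do rewrite /= EFinM.
  exact: integrableZl.
- under [X in _.-integrable _ X]eq_fun do rewrite /= EFinM.
  exact: integrableZl.
Qed.

Lemma cintB D f g : measurable D -> cintegrable D f -> cintegrable D g ->
  cint D (fun x => f x - g x) = cint D f - cint D g.
Proof.
move=> mD fi gi; rewrite -[RHS]/(_ + - _) -mulN1r -cintZ// -cintD//.
  by apply: eq_cint => x _; rewrite mulN1r.
exact: cintegrableZ.
Qed.

Lemma cintJ D f : measurable D -> cintegrable D f ->
  cint D (fun x => conjc (f x)) = conjc (cint D f).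
Proof.
move=> mD [fr fi]; rewrite /cint; apply: complex_eq => /=.
  by apply: eq_Rintegral => x _; rewrite ReJ_complex.
rewrite -mulN1r -RintegralZl//; apply: eq_Rintegral => x _.
by rewrite ImJ_complex mulN1r.
Qed.

Lemma cint_mkcond D f : cint D f = cint setT (fun x => if x \in D then f x else 0).
Proof.
rewrite /cint; congr Complex; rewrite Rintegral_mkcond; apply: eq_Rintegral => x _;
 by rewrite patchE; case: ifP.
Qed.

(** The real and imaginary parts are each bounded by the integral of [cabs f], whence the factor 2.
    The sharp constant 1 would require a rotation by the phase of the integral. *)
Lemma csq_cint_le D f : measurable D -> cintegrable D f ->
  ((csq (cint D f))%:E <= 2%:E * (\int[mu]_(x in D) (cabs (f x))%:E) ^+ 2)%E.
Proof.
move=> mD fi; have fa := cintegrable_cabs mD fi.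
have le1 (u : R -> R) : mu.-integrable D (EFin \o u) -> (forall x, `|u x| <= cabs (f x)) ->
   (\int[mu]_(x in D) u x) ^+ 2 <= (\int[mu]_(x in D) cabs (f x)) ^+ 2.
  move=> ui uf; rewrite -[leLHS]real_normK ?num_real// ler_sqr ?nnegrE//; last first.
    by apply: Rintegral_ge0 => x _; exact: cabs_ge0.
  apply: le_trans (le_normr_Rintegral mD ui) _.
  apply: le_Rintegral => //; exact: integrable_norm.
have -> : (\int[mu]_(x in D) (cabs (f x))%:E)%E = (\int[mu]_(x in D) cabs (f x))%:E.
  by rewrite fineK//; exact: integrable_fin_num.
rewrite -EFin_expe -EFinM lee_fin /csq /cint/=.
rewrite mulr2n mulrDl mul1r lerD//; case: fi => fr fi; apply: le1 => // x.
  exact: normr_Re_cabs.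
exact: normr_Im_cabs.
Qed.

End ComplexIntegral.

(** * Translation invariance and the decomposition of the line into periods *)

Section Translation.
Variable R : realType.
Notation mu := (@lebesgue_measure R).
Implicit Types (D : set (measurableTypeR R)) (c p : R).

Definition preshift c D : set (measurableTypeR R) := [set x | D (x + c)].

Lemma measurable_addr c : measurable_fun setT (fun x : measurableTypeR R => x + c : measurableTypeR R).
Proof. exact: measurable_funD. Qed.

Lemma preshift_itv c (x y : R) (b0 b1 : bool) :
  preshift c [set` Interval (BSide b0 x) (BSide b1 y)] =
  [set` Interval (BSide b0 (x - c)) (BSide b1 (y - c))].
Proof.
by apply/seteqP; split => z; rewrite /preshift/= !in_itv/=;
   case: b0 b1 => [] [] /=; rewrite ?lerBlDr ?lerBrDr ?ltrBlDr ?ltrBrDr.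
Qed.

(** The pushforward of Lebesgue measure under a translation is a measure with the same value on
    half-open intervals, and Lebesgue measure is unique with these values. *)
Lemma lebesgue_measure_shift c D : measurable D -> mu (preshift c D) = mu D.
Proof.
move=> mD.
pose mixin := isMeasurableFun.Build _ _ _ _ _ (measurable_addr c).
pose phi : {mfun measurableTypeR R >-> measurableTypeR R} :=
  HB.pack (fun x : measurableTypeR R => x + c : measurableTypeR R) mixin.
rewrite -[LHS]/(pushforward mu phi D).
apply/esym/lebesgue_measure_unique => //= _ [[a b]] _ <-.
rewrite /pushforward.
rewrite (_ : _ @^-1` _ = `](a - c), (b - c)]%classic); last first.
  by apply/seteqP; split => z; rewrite /= !in_itv/= ?lerBrDr ?ltrBlDr.
by rewrite !lebesgue_measure_itv/= !lte_fin ltrD2r -!EFinB opprB addrA subrK.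
Qed.

Lemma ge0_integral_shift c D (f : R -> \bar R) : measurable D ->
  measurable_fun D f -> (forall x, D x -> (0 <= f x)%E) ->
  (\int[mu]_(x in D) f x = \int[mu]_(x in preshift c D) f (x + c)%R)%E.
Proof.
move=> mD mf f0.
rewrite -(@ge0_integral_pushforward _ _ _ _ _ _ (measurable_addr c) mu D f)//.
  apply: eq_measure_integral => [|? A mA AD]; first exact: measurable_addr.
  exact: (esym (lebesgue_measure_shift c mA)).
by move=> x; rewrite inE => /f0.
Qed.

Lemma measurable_fun_shift c D d' (T' : measurableType d') (f : R -> T') : measurable D ->
  measurable_fun D f -> measurable_fun (preshift c D) (fun x => f (x + c)).
Proof.
move=> mD mf; apply: (@measurable_comp _ _ _ _ _ _ D f) => //.
  by move=> _ [x Dx <-].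
by apply: measurable_funS (measurable_addr c).
Qed.

Lemma integral_shift c D (f : R -> \bar R) : measurable D ->
  measurable_fun D f ->
  (\int[mu]_(x in D) f x = \int[mu]_(x in preshift c D) f (x + c)%R)%E.
Proof.
move=> mD mf; rewrite integralE [RHS]integralE; congr (_ - _)%E.
  rewrite (@ge0_integral_shift c D (f^\+)%E)//; last exact: measurable_funepos.
  by apply: eq_integral => x _; rewrite !funeposE.
rewrite (@ge0_integral_shift c D (f^\-)%E)//; last exact: measurable_funeneg.
by apply: eq_integral => x _; rewrite !funenegE.
Qed.

Lemma integrable_shift c D (f : R -> \bar R) : measurable D ->
  mu.-integrable D f -> mu.-integrable (preshift c D) (fun x => f (x + c)%R).
Proof.
move=> mD /integrableP[mf fi]; apply/integrableP; split.
  exact: measurable_fun_shift.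
rewrite -(@ge0_integral_shift c D (fun x => `|f x|)%E)//.
exact: measurableT_comp.
Qed.

Lemma cmeas_shift c D (f : R -> R[i]) : measurable D ->
  cmeas D f -> cmeas (preshift c D) (fun x => f (x + c)).
Proof.
move=> mD [fr fi]; split.
  exact: (@measurable_fun_shift c D _ R (fun x => complex.Re (f x)) mD fr).
exact: (@measurable_fun_shift c D _ R (fun x => complex.Im (f x)) mD fi).
Qed.

Lemma cintegrable_shift c D (f : R -> R[i]) : measurable D ->
  cintegrable D f -> cintegrable (preshift c D) (fun x => f (x + c)).
Proof.
move=> mD [fr fi]; split.
  exact: (@integrable_shift c D (fun x => (complex.Re (f x))%:E) mD fr).
exact: (@integrable_shift c D (fun x => (complex.Im (f x))%:E) mD fi).
Qed.

Lemma cint_shift c D (f : R -> R[i]) : measurable D -> cmeas D f ->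
  cint D f = cint (preshift c D) (fun x => f (x + c)).
Proof.
move=> mD [fr fi]; rewrite /cint /Rintegral.
rewrite (integral_shift c mD); last exact/measurable_EFinP.
rewrite [X in (_ +i* fine X)%C](integral_shift c mD)//.
exact/measurable_EFinP.
Qed.

Lemma sqint_shift c D (f : R -> R[i]) : measurable D -> cmeas D f ->
  sqint D f = sqint (preshift c D) (fun x => f (x + c)).
Proof.
move=> mD mf; rewrite /sqint (ge0_integral_shift c mD)//.
- by apply/measurable_EFinP; exact: cmeas_csq.
- by move=> x _; rewrite lee_fin csq_ge0.
Qed.

Lemma preshiftT c : preshift c setT = setT.
Proof. by apply/seteqP; split. Qed.

(** Enumerates the integers, nonnegative ones at even indices and negative ones at odd indices, so
    that sums over [int] become series to which monotone convergence applies. *)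
Definition int_of_idx (n : nat) : int := if odd n then Negz n./2 else Posz n./2.

Lemma int_of_idx_bij : set_bij [set: nat] [set: int] int_of_idx.
Proof.
split => //.
- move=> m n _ _; rewrite /int_of_idx => h.
  rewrite -(odd_double_half m) -(odd_double_half n); move: h.
  by case: (odd m); case: (odd n) => // -[->].
- move=> [n|n] _.
    by exists n.*2 => //; rewrite /int_of_idx odd_double doubleK.
  by exists n.*2.+1 => //; rewrite /int_of_idx /= odd_double /= uphalf_double.
Qed.

Lemma esum_int (f : int -> \bar R) : (forall z, (0 <= f z)%E) ->
  (\esum_(z in [set: int]) f z = \sum_(n <oo) f (int_of_idx n))%E.
Proof.
move=> f0; rewrite (reindex_esum _ _ _ _ int_of_idx_bij) nneseries_esumT//.
Qed.

Lemma ge0_integral_periodize p (f : R -> \bar R) : 0 < p ->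
  measurable_fun [set: measurableTypeR R] f -> (forall x, (0 <= f x)%E) ->
  (\int[mu]_x f x =
   \esum_(z in [set: int]) \int[mu]_(x in `[0%R, p]) f (x + z%:~R * p)%R)%E.
Proof.
move=> p0 mf f0.
(* The cells are half-open so that they tile the line, the cell of [x] being given by the floor of
   [x / p]; closing the right end afterwards adds only a null set. *)
pose F (n : nat) : set (measurableTypeR R) :=
  [set x | ((int_of_idx n)%:~R * p <= x < (int_of_idx n + 1)%:~R * p)].
have FE n : F n = `[((int_of_idx n)%:~R * p), ((int_of_idx n + 1)%:~R * p)[%classic.
  by apply/seteqP; split => x; rewrite /F /= in_itv.
have mF n : measurable (F n) by rewrite FE; exact: measurable_itv.
have FT : \bigcup_n F n = setT.
  apply/seteqP; split => // x _.
  have [n _ en] : (int_of_idx @` [set: nat]) (Num.floor (x / p)).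
    by case: int_of_idx_bij => _ _ /(_ (Num.floor (x / p)) I).
  exists n => //; rewrite /F/= en.
  rewrite -ler_pdivlMr// -ltr_pdivrMr// ge_floor/=.
  exact: lt_succ_floor.
have tF : trivIset [set: nat] F.
  apply/trivIsetP => m n _ _ mn; apply/seteqP; split => // x [].
  rewrite /F /= => /andP[m1 m2] /andP[n1 n2]; case/eqP: mn.
  case: int_of_idx_bij => _ inj _; apply: inj; rewrite ?inE//.
  have := le_lt_trans m1 n2; have := le_lt_trans n1 m2.
  rewrite !ltr_pM2r// !ltr_int !ltzD1 => h1 h2.
  by apply/eqP; rewrite eq_le h1 h2.
rewrite -FT ge0_integral_bigcup//; last first.
  by rewrite FT.
rewrite esum_int; last by move=> z; exact: integral_ge0.
apply: eq_eseriesr => n _.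
rewrite FE [LHS](integral_shift ((int_of_idx n)%:~R * p))//; last first.
  exact: measurable_funTS.
rewrite preshift_itv// subrr intrD mulrDl addrAC subrr add0r mul1r.
rewrite integral_itv_bndo_bndc//.
apply: measurableT_comp => //.
by apply: measurable_funTS; exact: measurable_addr.
Qed.

End Translation.

(** * Square-integrable functions on a set and the Cauchy-Schwarz inequality *)

Section SquareIntegrable.
Variable R : realType.
Notation mu := (@lebesgue_measure R).
Implicit Types (D E : set (measurableTypeR R)) (f g : R -> R[i]) (z : R[i]).

Definition L2on D f : Prop := cmeas D f /\ (sqint D f < +oo)%E.

Lemma sqint_ge0 D f : (0 <= sqint D f)%E.
Proof. by apply: integral_ge0 => x _; rewrite lee_fin csq_ge0. Qed.

Lemma eq_sqint D f g : (forall x, D x -> csq (f x) = csq (g x)) -> sqint D f = sqint D g.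
Proof. by move=> fg; apply: eq_integral => x; rewrite inE => /fg ->. Qed.

Lemma cmeas_csqE D f : cmeas D f -> measurable_fun D (fun x => (csq (f x))%:E).
Proof. by move=> mf; apply/measurable_EFinP; exact: cmeas_csq. Qed.

Lemma sqintD_le D f g : measurable D -> cmeas D f -> cmeas D g ->
  (sqint D (fun x => f x + g x)%R <= 2%:E * sqint D f + 2%:E * sqint D g)%E.
Proof.
move=> mD mf mg; rewrite /sqint -!ge0_integralZl//; last 4 first.
- exact: cmeas_csqE.
- by move=> x _; rewrite lee_fin csq_ge0.
- exact: cmeas_csqE.
- by move=> x _; rewrite lee_fin csq_ge0.
rewrite -ge0_integralD//; last 4 first.
- by move=> x _; rewrite mule_ge0 ?lee_fin ?csq_ge0.
- by apply: measurable_funeM; exact: cmeas_csqE.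
- by move=> x _; rewrite mule_ge0 ?lee_fin ?csq_ge0.
- by apply: measurable_funeM; exact: cmeas_csqE.
apply: ge0_le_integral => //.
- by move=> x _; rewrite lee_fin csq_ge0.
- by apply: cmeas_csqE; exact: cmeasD.
- by apply: emeasurable_funD; apply: measurable_funeM; exact: cmeas_csqE.
- by move=> x _; rewrite -!EFinM -EFinD lee_fin; exact: csqD_le.
Qed.

Lemma sqintZ D f z : measurable D -> cmeas D f ->
  (sqint D (fun x => z * f x)%R = (csq z)%:E * sqint D f)%E.
Proof.
move=> mD mf; rewrite /sqint -ge0_integralZl ?lee_fin ?csq_ge0//.
- by apply: eq_integral => x _; rewrite csqM.
- exact: cmeas_csqE.
- by move=> x _; rewrite lee_fin csq_ge0.
Qed.

Lemma sqintN D f : sqint D (fun x => - f x) = sqint D f.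
Proof. by apply: eq_sqint => x _; rewrite csqN. Qed.

Lemma cmeasZ D f z : cmeas D f -> cmeas D (fun x => z * f x).
Proof. by move=> mf; apply: cmeasM => //; exact: cmeas_cst. Qed.

Lemma cmeasN D f : cmeas D f -> cmeas D (fun x => - f x).
Proof.
move=> mf; have := cmeasZ (- 1) mf.
by under eq_fun do rewrite mulN1r.
Qed.

Lemma sqintB_le D f g : measurable D -> cmeas D f -> cmeas D g ->
  (sqint D (fun x => f x - g x)%R <= 2%:E * sqint D f + 2%:E * sqint D g)%E.
Proof.
by move=> mD mf mg; rewrite -(sqintN D g); apply: sqintD_le => //; exact: cmeasN.
Qed.

Lemma L2onD D f g : measurable D -> L2on D f -> L2on D g -> L2on D (fun x => f x + g x).
Proof.
move=> mD [mf f2] [mg g2]; split; first exact: cmeasD.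
apply: le_lt_trans (sqintD_le mD mf mg) _.
by rewrite lte_add_pinfty// lte_mul_pinfty.
Qed.

Lemma L2onZ D f z : measurable D -> L2on D f -> L2on D (fun x => z * f x).
Proof.
move=> mD [mf f2]; split; first exact: cmeasZ.
by rewrite sqintZ// lte_mul_pinfty// lee_fin csq_ge0.
Qed.

Lemma L2onB D f g : measurable D -> L2on D f -> L2on D g -> L2on D (fun x => f x - g x).
Proof.
move=> mD f2 g2; have := L2onD mD f2 (L2onZ (- 1) mD g2).
by under eq_fun do rewrite mulN1r.
Qed.

Lemma L2onJ D f : L2on D f -> L2on D (fun x => conjc (f x)).
Proof.
move=> [mf f2]; split; first exact: cmeasJ.
by rewrite (eq_sqint (g := f))// => x _; rewrite csqJ.
Qed.

Lemma sqintS D E f : measurable D -> measurable E -> cmeas E f -> D `<=` E ->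
  (sqint D f <= sqint E f)%E.
Proof.
move=> mD mE mf DE; apply: ge0_subset_integral => //.
  exact: cmeas_csqE.
by move=> x _; rewrite lee_fin csq_ge0.
Qed.

Lemma L2onS D E f : measurable D -> measurable E -> D `<=` E -> L2on E f -> L2on D f.
Proof.
move=> mD mE DE [mf f2]; split; first exact: cmeasS mf.
exact: le_lt_trans (sqintS mD mE mf DE) f2.
Qed.

Lemma L2onM_bounded D f g (M : R) : measurable D ->
  cmeas D f -> (forall x, D x -> csq (f x) <= M) -> L2on D g ->
  L2on D (fun x => f x * g x).
Proof.
move=> mD mf fM [mg g2]; split; first exact: cmeasM.
apply: (@le_lt_trans _ _ (`|M|%:E * sqint D g)%E); last first.
  by rewrite lte_mul_pinfty.
rewrite /sqint -ge0_integralZl//; last 2 first.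
- exact: cmeas_csqE.
- by move=> x _; rewrite lee_fin csq_ge0.
apply: ge0_le_integral => //.
- by move=> x _; rewrite lee_fin csq_ge0.
- by apply: cmeas_csqE; exact: cmeasM.
- by apply: measurable_funeM; exact: cmeas_csqE.
move=> x Dx; rewrite -EFinM lee_fin csqM ler_wpM2r ?csq_ge0//.
exact: le_trans (fM _ Dx) (ler_norm _).
Qed.

Lemma cintegrable_mulL2 D f g : measurable D -> L2on D f -> L2on D g ->
  cintegrable D (fun x => f x * g x).
Proof.
move=> mD [mf f2] [mg g2].
apply: (@cintegrable_le _ _ _ (fun x => csq (f x) + csq (g x))) => //.
- exact: cmeasM.
- by move=> x _; exact: cabs_AMGM.
- have i h : cmeas D h -> (sqint D h < +oo)%E ->
    mu.-integrable D (fun x => (csq (h x))%:E).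
    move=> mh h2; apply/integrableP; split; first exact: cmeas_csqE.
    by under eq_integral do rewrite /= ger0_norm ?csq_ge0//.
  under eq_fun do rewrite EFinD.
  by apply: integrableD => //; apply: i.
Qed.

(** Integrating 2s|fg| <= s^2|f|^2 + |g|^2 gives [key] for every s >= 0, and a suitable s gives the
    inequality for the integral of |fg|. The factor 2 is inherited from [csq_cint_le]. *)
Lemma CauchySchwarz_cint D f g : measurable D -> L2on D f -> L2on D g ->
  ((csq (cint D (fun x => f x * g x)%R))%:E <= 2%:E * (sqint D f * sqint D g))%E.
Proof.
move=> mD f2 g2; have fgi := cintegrable_mulL2 mD f2 g2.
apply: (le_trans (csq_cint_le mD fgi)).
rewrite lee_pmul2l// ?fin_num_abs//.
have := cintegrable_lty mD fgi.
case: f2 g2 => [mf f2] [mg g2].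
have fin h : (sqint D h < +oo)%E -> sqint D h = (fine (sqint D h))%:E.
  by move=> h2; rewrite fineK// ge0_fin_numE// sqint_ge0.
rewrite (fin _ f2) (fin _ g2) -EFinM => Ify.
set I := (X in (X ^+ 2)%E); have I0 : (0 <= I)%E.
  by apply: integral_ge0 => x _; rewrite lee_fin cabs_ge0.
have EI : I = (fine I)%:E by rewrite fineK// ge0_fin_numE.
rewrite EI -EFin_expe lee_fin.
set A := fine (sqint D f); set B := fine (sqint D g).
have A0 : 0 <= A by rewrite fine_ge0// sqint_ge0.
have B0 : 0 <= B by rewrite fine_ge0// sqint_ge0.
have key (s : R) : 0 <= s -> 2 * s * fine I <= s ^+ 2 * A + B.
  move=> s0; rewrite -lee_fin EFinD !EFinM -EI -(fin _ f2) -(fin _ g2).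
  rewrite /I /sqint -!ge0_integralZl ?lee_fin ?mulr_ge0//; last 4 first.
  - exact: cmeas_csqE.
  - by move=> x _; rewrite lee_fin csq_ge0.
  - by apply/measurable_EFinP; apply: cmeas_cabs; exact: cmeasM.
  - by move=> x _; rewrite lee_fin cabs_ge0.
  rewrite -ge0_integralD//; last 4 first.
  - by move=> x _; rewrite -EFinM lee_fin mulr_ge0 ?csq_ge0 ?sqr_ge0.
  - by apply: measurable_funeM; exact: cmeas_csqE.
  - by move=> x _; rewrite lee_fin csq_ge0.
  - exact: cmeas_csqE.
  apply: ge0_le_integral => //.
  - by move=> x _; rewrite -!EFinM lee_fin !mulr_ge0// cabs_ge0.
  - apply: measurable_funeM; apply/measurable_EFinP.
    by apply: cmeas_cabs; exact: cmeasM.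
  - apply: emeasurable_funD; last exact: cmeas_csqE.
    by apply: measurable_funeM; exact: cmeas_csqE.
  - move=> x _; rewrite -!EFinM -EFinD lee_fin cabsM -!sqr_cabs.
    by have := sqr_ge0 (s * cabs (f x) - cabs (g x)); nra.
have I0' : 0 <= fine I by rewrite fine_ge0.
have [A1|A1] := eqVneq A 0.
  rewrite A1 mul0r; have [->|Ine0] := eqVneq (fine I) 0; first by rewrite expr0n.
  have Ip : 0 < fine I by rewrite lt_neqAle eq_sym Ine0.
  (* With [A = 0], [key] bounds 2s times [fine I] by [B] for every s; this value of s turns it into
     2(B + 1) <= B, which is absurd. *)
  have := key ((B + 1) / (fine I)); rewrite A1 mulr0 add0r.
  have -> : 2 * ((B + 1) / fine I) * fine I = 2 * (B + 1) by field.
  rewrite divr_ge0 ?addr_ge0// => /(_ isT); lra.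
have Ap : 0 < A by rewrite lt_neqAle eq_sym A1.
(* The minimiser in s of the quadratic polynomial s^2 A - 2 s I + B. *)
have := key (fine I / A); rewrite divr_ge0// => /(_ isT).
have -> : 2 * (fine I / A) * fine I = 2 * fine I ^+ 2 / A by field.
have -> : (fine I / A) ^+ 2 * A = fine I ^+ 2 / A by field.
move=> h; have : fine I ^+ 2 / A <= B by lra.
by rewrite ler_pdivrMr// mulrC.
Qed.

End SquareIntegrable.

(** * Exchanging series and integrals *)

Section SeriesIntegral.
Variable R : realType.
Notation mu := (@lebesgue_measure R).
Implicit Types (D : set (measurableTypeR R)).

Lemma cvg_EFin_seq (u : nat -> R) (l : R) :
  u @ \oo --> l -> (fun n => (u n)%:E) @ \oo --> l%:E.
Proof. by move=> ul; apply: cvg_EFin => //; exact: nearW. Qed.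

Lemma nneseries_term_le (u : nat -> \bar R) (k : nat) : (forall j, (0 <= u j)%E) ->
  (u k <= \sum_(j <oo) u j)%E.
Proof.
move=> u0; apply: (le_trans _ (nneseries_lim_ge k.+1 (fun j _ _ => u0 j))).
by rewrite big_nat_recr//= leeDr// sume_ge0.
Qed.

Lemma abs_summable_cvg (v : nat -> R) : (\sum_(k <oo) `|v k|%:E < +oo)%E ->
  cvgn [normed series v].
Proof.
move=> vS; apply: nondecreasing_is_cvgn.
  by apply: nondecreasing_series => k _ _; exact: normr_ge0.
exists (fine (\sum_(k <oo) `|v k|%:E)%E) => _ [n _ <-].
rewrite -lee_fin fineK; last first.
  by rewrite ge0_fin_numE// nneseries_ge0// => k _ _; rewrite lee_fin.
rewrite /series/= -sumEFin; exact: nneseries_lim_ge.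
Qed.

Lemma normr_rsum_le (v : nat -> R) : (\sum_(k <oo) `|v k|%:E < +oo)%E ->
  (`|rsum v|%:E <= \sum_(k <oo) `|v k|%:E)%E.
Proof.
move=> vS; have cv := abs_summable_cvg vS.
apply: (@le_trans _ _ (limn [normed series v])%:E).
  by rewrite lee_fin; exact: lim_series_norm.
rewrite -EFin_lim//.
rewrite (_ : EFin \o _ = (fun n => \sum_(0 <= k < n) `|v k|%:E)%E)//.
by apply/funext => n; rewrite /= /series/= sumEFin.
Qed.

(* [limn] is the junk value 0 where the sequence diverges, so it agrees with the
   limsup on the measurable set where limsup = liminf is finite, and vanishes off it. *)
Lemma measurable_fun_limn D (s : nat -> R -> R) : measurable D ->
  (forall n, measurable_fun D (s n)) -> measurable_fun D (fun x => limn (s ^~ x)).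
Proof.
move=> mD ms; have ms' n : measurable_fun D (fun x => (s n x)%:E).
  exact/measurable_EFinP.
pose L x := limn_esup (fun n => (s n x)%:E).
pose l x := limn_einf (fun n => (s n x)%:E).
have mL : measurable_fun D L by exact: measurable_fun_limn_esup.
have ml : measurable_fun D l.
  have -> : l = (fun x => - limn_esup (-%E \o (fun n => (s n x)%:E)))%E.
    by apply/funext => x; rewrite limn_esupN oppeK.
  apply: measurableT_comp => //; apply: measurable_fun_limn_esup => n.
  exact: measurableT_comp.
have mfL : measurable_fun D (fun x => fine (L x)).
  exact: (@measurableT_comp _ _ _ _ _ _ fine).
suff -> : (fun x => limn (s ^~ x)) =
   (fun x => if (L x == l x) && (L x == (fine (L x))%:E) then fine (L x) else 0).
  apply: measurable_fun_if => //.
  - apply: measurable_and; apply: measurable_fun_eqe => //.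
    exact/measurable_EFinP.
  - by apply: measurable_funS mfL.
apply/funext => x; case: ifPn.
  move=> /andP[/eqP Ll /eqP fL]; apply/cvg_lim => //.
  apply: (@fine_cvg _ _ _ _ (fun n => (s n x)%:E)); rewrite -fL.
  apply: (@squeeze_cvge _ _ _ _ (einfs (fun n => (s n x)%:E)) _ (esups (fun n => (s n x)%:E))).
  - apply: nearW => n; apply/andP; split.
      by apply: ereal_inf_lbound; exists n => /=.
    by apply: ereal_sup_ubound; exists n => /=.
  - rewrite Ll /l limn_einf_lim; exact: is_cvg_einfs.
  - rewrite /L limn_esup_lim; exact: is_cvg_esups.
move=> nc; apply: dvgP => /cvg_ex[t st].
have [h1 h2] := @cvg_limn_einf_sup R (fun n => (s n x)%:E) t%:E (cvg_EFin_seq st).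
by move: nc; rewrite /L /l h1 h2 eqxx.
Qed.

Section exchange.
Variables (D : set (measurableTypeR R)) (v : nat -> R -> R).
Hypotheses (mD : measurable D) (mv : forall k, measurable_fun D (v k)).
Hypothesis vS : (\sum_(k <oo) \int[mu]_(x in D) `|v k x|%:E < +oo)%E.

Let mav k : measurable_fun D (fun x => `|v k x|%:E).
Proof. by apply/measurable_EFinP; exact: measurableT_comp. Qed.

Let G x := (\sum_(k <oo) `|v k x|%:E)%E.

Lemma abs_sum_integrable : mu.-integrable D G.
Proof.
apply/integrableP; split.
  by apply: ge0_emeasurable_sum => // k x _ _; rewrite lee_fin.
under eq_integral.
  move=> x _; rewrite gee0_abs; last by apply: nneseries_ge0 => k _ _; rewrite lee_fin.
  over.
rewrite /= integral_nneseries//.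
Qed.

Lemma ae_abs_summable : {ae mu, forall x, D x -> (G x < +oo)%E}.
Proof.
have := integrable_ae mD abs_sum_integrable.
by apply: filterS => x h /h /fin_numPlt /andP[].
Qed.

(** Dominated convergence for the partial sums, with majorant [G], integrable by monotone
    convergence. The partial sums are only known to converge where [G] is finite, hence almost
    everywhere on [D]; the default value of [rsum] elsewhere does not affect the integral. *)
Lemma rsum_integral :
  mu.-integrable D (fun x => (rsum (v ^~ x))%:E) /\
  \int[mu]_(x in D) rsum (v ^~ x) = rsum (fun k => \int[mu]_(x in D) v k x).
Proof.
have iv k : mu.-integrable D (fun x => (v k x)%:E).
  apply/integrableP; split; first exact/measurable_EFinP.
  apply: le_lt_trans vS => /=.
  by apply: (@nneseries_term_le (fun k => \int[mu]_(x in D) `|v k x|%:E)%E) => j;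
    exact: integral_ge0.
have sri n : mu.-integrable D (fun x => (series (v ^~ x) n)%:E).
  rewrite /series/=; under eq_fun do rewrite -sumEFin.
  exact: integrable_sum.
have := @dominated_convergence _ _ R mu D mD
  (fun n x => (series (v ^~ x) n)%:E) (fun x => (rsum (v ^~ x))%:E) G.
case.
- by move=> n; exact: measurable_int (sri n).
- apply/measurable_EFinP; apply: measurable_fun_limn => // n.
  by have /measurable_int/measurable_EFinP := sri n.
- apply: filterS ae_abs_summable => x h /h Gx.
  apply: cvg_EFin_seq; exact: (normed_cvg (abs_summable_cvg Gx)).
- exact: abs_sum_integrable.
- apply: nearW => x n Dx; rewrite /G /series/=.
  apply: (le_trans _ (nneseries_lim_ge n _)) => //.
  by rewrite sumEFin lee_fin; exact: ler_norm_sum.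
move=> irs _ cvs; split => //.
rewrite {1}/Rintegral; apply/esym/cvg_lim => //.
apply: (@fine_cvg _ _ _ _ (fun n => (series (fun k => \int[mu]_(x in D) v k x) n)%:E)).
rewrite fineK; last exact: integrable_fin_num.
rewrite (_ : (fun n => _) = (fun n => \int[mu]_(x in D) (series (v ^~ x) n)%:E))%E//.
apply/funext => n; rewrite /series/=; under [RHS]eq_integral do rewrite -sumEFin.
rewrite integral_sum// -sumEFin; apply: eq_bigr => k _.
by rewrite /Rintegral fineK//; exact: integrable_fin_num.
Qed.

End exchange.

End SeriesIntegral.

(** * Absolutely summable complex series and weighted Cauchy-Schwarz *)

Section ComplexSeries.
Variable R : realType.
Notation mu := (@lebesgue_measure R).
Implicit Types (D : set (measurableTypeR R)) (u : nat -> R[i]).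

Definition csummable u : Prop := (\sum_(k <oo) (cabs (u k))%:E < +oo)%E.

Lemma csummable_Re u : csummable u -> (\sum_(k <oo) `|complex.Re (u k)|%:E < +oo)%E.
Proof.
apply: le_lt_trans; apply: lee_nneseries => [k _ _|k _]; rewrite lee_fin//.
exact: normr_Re_cabs.
Qed.

Lemma csummable_Im u : csummable u -> (\sum_(k <oo) `|complex.Im (u k)|%:E < +oo)%E.
Proof.
apply: le_lt_trans; apply: lee_nneseries => [k _ _|k _]; rewrite lee_fin//.
exact: normr_Im_cabs.
Qed.

Lemma csummable_Re_cvg u : csummable u -> cvgn (series (fun k => complex.Re (u k))).
Proof. by move=> /csummable_Re/abs_summable_cvg/normed_cvg. Qed.

Lemma csummable_Im_cvg u : csummable u -> cvgn (series (fun k => complex.Im (u k))).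
Proof. by move=> /csummable_Im/abs_summable_cvg/normed_cvg. Qed.

Lemma csumZ (z : R[i]) u : csummable u -> csum (fun k => z * u k) = z * csum u.
Proof.
move=> su; have cr := csummable_Re_cvg su; have ci := csummable_Im_cvg su.
apply: complex_eq; rewrite ?ReM_complex ?ImM_complex /csum /= /rsum.
  have := @lim_seriesB R _ _ (is_cvg_seriesZ (k := complex.Re z) cr) (is_cvg_seriesZ (k := complex.Im z) ci).
  rewrite !lim_seriesZ// => <-; congr (limn (series _)).
  by apply/funext => k; rewrite ReM_complex.
have := @lim_seriesD R _ _ (is_cvg_seriesZ (k := complex.Re z) ci) (is_cvg_seriesZ (k := complex.Im z) cr).
rewrite !lim_seriesZ// => <-; congr (limn (series _)).
by apply/funext => k; rewrite ImM_complex.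
Qed.

Lemma csumB u v : csummable u -> csummable v ->
  csum (fun k => u k - v k) = csum u - csum v.
Proof.
move=> su sv; have cur := csummable_Re_cvg su; have cui := csummable_Im_cvg su.
have cvr := csummable_Re_cvg sv; have cvi := csummable_Im_cvg sv.
apply: complex_eq; rewrite ?ReB_complex ?ImB_complex /csum /= /rsum.
  rewrite -lim_seriesB//; congr (limn (series _)).
  by apply/funext => k; rewrite ReB_complex.
rewrite -lim_seriesB//; congr (limn (series _)).
by apply/funext => k; rewrite ImB_complex.
Qed.

Lemma csq_csum_le u : csummable u ->
  ((csq (csum u))%:E <= 2%:E * (\sum_(k <oo) (cabs (u k))%:E) ^+ 2)%E.
Proof.
move=> su; have S0 : (0 <= \sum_(k <oo) (cabs (u k))%:E)%E.
  by apply: nneseries_ge0 => k _ _; rewrite lee_fin cabs_ge0.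
have SE : (\sum_(k <oo) (cabs (u k))%:E)%E = (fine (\sum_(k <oo) (cabs (u k))%:E))%:E.
  by rewrite fineK// ge0_fin_numE.
have le1 (r : nat -> R) : (\sum_(k <oo) `|r k|%:E < +oo)%E -> (forall k, `|r k| <= cabs (u k)) ->
    rsum r ^+ 2 <= (fine (\sum_(k <oo) (cabs (u k))%:E)) ^+ 2.
  move=> sr ru; rewrite -[leLHS]real_normK ?num_real// ler_sqr ?nnegrE ?fine_ge0//.
  rewrite -lee_fin -SE; apply: (le_trans (normr_rsum_le sr)).
  by apply: lee_nneseries => // k _ ; rewrite lee_fin.
rewrite SE -EFin_expe -EFinM lee_fin mulr2n mulrDl mul1r /csq /csum /= lerD//.
  by apply: le1; [exact: csummable_Re|move=> k; exact: normr_Re_cabs].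
by apply: le1; [exact: csummable_Im|move=> k; exact: normr_Im_cabs].
Qed.

Lemma weighted_CauchySchwarz_sum (c x : nat -> R) n : (forall k, 0 <= c k) ->
  (\sum_(0 <= k < n) c k * x k) ^+ 2 <=
  (\sum_(0 <= k < n) c k) * (\sum_(0 <= k < n) c k * x k ^+ 2).
Proof.
move=> c0; elim: n => [|n IH]; first by rewrite !big_geq// expr0n mulr0.
rewrite !big_nat_recr//=.
set B := \sum_(0 <= k < n) c k * x k in IH *.
set A := \sum_(0 <= k < n) c k in IH *.
set C := \sum_(0 <= k < n) c k * x k ^+ 2 in IH *.
have A0 : 0 <= A by apply: sumr_ge0.
have C0 : 0 <= C by apply: sumr_ge0 => k _; rewrite mulr_ge0// sqr_ge0.
(* Compare squares: the induction hypothesis B^2 <= A C and the arithmetic-geometric inequality give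
   (2 B x)^2 <= 4 A C x^2 <= (C + A x^2)^2. *)
have h : 2 * B * x n <= C + A * x n ^+ 2.
  rewrite leNgt; apply/negP => h.
  have h0 : 0 <= C + A * x n ^+ 2 by rewrite addr_ge0// mulr_ge0// sqr_ge0.
  have : (C + A * x n ^+ 2) ^+ 2 < (2 * B * x n) ^+ 2.
    by rewrite ltr_sqr// nnegrE ltW// (le_lt_trans h0).
  have : 0 <= (A * C - B ^+ 2) * x n ^+ 2 by rewrite mulr_ge0 ?sqr_ge0// subr_ge0.
  have := sqr_ge0 (C - A * x n ^+ 2).
  rewrite !expr2; lra.
have := mulr_ge0 (c0 n) (_ : 0 <= C + A * x n ^+ 2 - 2 * B * x n).
rewrite subr_ge0 => /(_ h); rewrite !expr2 in IH *; lra.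
Qed.

(** Only the sum of |a_k| is known to be finite, so |a_k| serves as a weight: the right-hand side is
    linear in the |z_k|^2 and can be integrated term by term when the z_k are values of
    square-integrable functions. *)
Lemma csq_csum_weighted (a z : nat -> R[i]) :
  csummable a -> (\sum_(k <oo) (cabs (a k) * csq (z k))%:E < +oo)%E ->
  csummable (fun k => a k * z k) /\
  ((csq (csum (fun k => a k * z k)))%:E <=
   2%:E * ((\sum_(k <oo) (cabs (a k))%:E) * (\sum_(k <oo) (cabs (a k) * csq (z k))%:E)))%E.
Proof.
move=> sa sz.
have a0 k : (0 <= (cabs (a k))%:E)%E by rewrite lee_fin cabs_ge0.
have az0 k : (0 <= (cabs (a k) * csq (z k))%:E)%E.
  by rewrite lee_fin mulr_ge0// ?cabs_ge0// csq_ge0.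
have s : csummable (fun k => a k * z k).
  (* Absolute summability follows from |z| <= 1 + |z|^2. *)
  apply: (@le_lt_trans _ _ (\sum_(k <oo) ((cabs (a k))%:E + (cabs (a k) * csq (z k))%:E))%E).
    apply: lee_nneseries => [k _ _|k _]; rewrite lee_fin ?cabs_ge0//.
    rewrite cabsM -[X in _ <= X + _]mulr1 -mulrDr ler_wpM2l ?cabs_ge0//.
    rewrite -sqr_cabs; have := sqr_ge0 (cabs (z k) - 1).
    have := cabs_ge0 (z k); nra.
  by rewrite nneseriesD// lte_add_pinfty.
split => //; apply: (le_trans (csq_csum_le s)).
rewrite lee_pmul2l// ?fin_num_abs//.
set S := (\sum_(k <oo) (cabs (a k))%:E)%E; set T := (\sum_(k <oo) (cabs (a k) * csq (z k))%:E)%E.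
have SE : S = (fine S)%:E by rewrite fineK// ge0_fin_numE// nneseries_ge0.
have TE : T = (fine T)%:E by rewrite fineK// ge0_fin_numE// nneseries_ge0.
have nn : (0 <= \sum_(k <oo) (cabs (a k * z k))%:E)%E.
  by apply: nneseries_ge0 => k _ _; rewrite lee_fin cabs_ge0.
have NE : (\sum_(k <oo) (cabs (a k * z k))%:E = (fine (\sum_(k <oo) (cabs (a k * z k))%:E))%:E)%E.
  by rewrite fineK// ge0_fin_numE.
have ST0 : 0 <= fine S * fine T by rewrite mulr_ge0// fine_ge0// nneseries_ge0.
rewrite SE TE NE -EFinM -EFin_expe lee_fin -(sqr_sqrtr ST0) ler_sqr ?nnegrE ?sqrtr_ge0//; last first.
  by rewrite fine_ge0.
rewrite -lee_fin -NE.
apply: lime_le; first by apply: is_cvg_nneseries => k _ _; rewrite lee_fin cabs_ge0.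
apply: nearW => n; rewrite sumEFin lee_fin.
rewrite -ler_sqr ?nnegrE ?sqrtr_ge0//; last first.
  by apply: sumr_ge0 => k _; exact: cabs_ge0.
rewrite sqr_sqrtr//; under eq_bigr do rewrite cabsM.
apply: (le_trans (weighted_CauchySchwarz_sum _ _ (fun k => cabs_ge0 (a k)))).
rewrite ler_pM//.
- by apply: sumr_ge0 => k _; exact: cabs_ge0.
- by apply: sumr_ge0 => k _; rewrite mulr_ge0 ?sqr_ge0 ?cabs_ge0.
- by rewrite -lee_fin -SE -sumEFin; apply: nneseries_lim_ge.
- under eq_bigr do rewrite sqr_cabs.
  by rewrite -lee_fin -TE -sumEFin; apply: nneseries_lim_ge.
Qed.

Lemma csum_integral D (u : nat -> R -> R[i]) : measurable D ->
  (forall k, cmeas D (u k)) ->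
  (\sum_(k <oo) \int[mu]_(x in D) (cabs (u k x))%:E < +oo)%E ->
  [/\ {ae mu, forall x, D x -> csummable (u ^~ x)},
      cintegrable D (fun x => csum (u ^~ x)) &
      cint D (fun x => csum (u ^~ x)) = csum (fun k => cint D (u k))].
Proof.
move=> mD mu_ uS.
have mc k : measurable_fun D (fun x => cabs (u k x)) by exact: cmeas_cabs.
have mr k : measurable_fun D (fun x => complex.Re (u k x)) by case: (mu_ k).
have mi k : measurable_fun D (fun x => complex.Im (u k x)) by case: (mu_ k).
have sub (r : nat -> R -> R) : (forall k, measurable_fun D (r k)) ->
    (forall k x, `|r k x| <= cabs (u k x)) ->
    (\sum_(k <oo) \int[mu]_(x in D) `|r k x|%:E < +oo)%E.
  move=> mr_ ru; apply: le_lt_trans uS; apply: lee_nneseries => [k _ _|k _].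
    exact: integral_ge0.
  apply: ge0_le_integral => //.
  - by apply/measurable_EFinP; exact: measurableT_comp.
  - exact/measurable_EFinP.
  - by move=> x _; rewrite lee_fin.
have [ri rE] := rsum_integral mD mr (sub _ mr (fun k x => normr_Re_cabs _)).
have [ii iE] := rsum_integral mD mi (sub _ mi (fun k x => normr_Im_cabs _)).
split.
- have h : (\sum_(k <oo) \int[mu]_(x in D) `|cabs (u k x)|%:E < +oo)%E.
    by under eq_eseriesr do under eq_integral do rewrite ger0_norm ?cabs_ge0//.
  apply: filterS (ae_abs_summable mD mc h) => x Hx Dx; move: (Hx Dx).
  by under eq_eseriesr do rewrite ger0_norm ?cabs_ge0//.
- by split.
- by apply: complex_eq; rewrite /csum/= -?rE -?iE.
Qed.

End ComplexSeries.

(** * Parseval's identity and Plancherel's theorem *)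

Section FTC.
Variable R : realType.
Notation mu := (@lebesgue_measure R).

Lemma Rintegral_FTC (f F : R -> R) (a b : R) : a < b -> continuous f ->
  (forall x : R, is_derive x 1 F (f x)) -> \int[mu]_(x in `[a, b]) f x = F b - F a.
Proof.
move=> ab cf dF.
have cF : continuous F.
  by move=> x; apply/differentiable_continuous/derivable1_diffP; apply: ex_derive.
rewrite /Rintegral (@continuous_FTC2 R f F a b)//.
- exact: continuous_subspaceT.
- split.
  + by move=> x _; apply: ex_derive.
  + by apply: cvg_at_right_filter; exact: cF.
  + by apply: cvg_at_left_filter; exact: cF.
- by move=> x _; rewrite derive1E; apply: derive_val.
Qed.

Lemma is_derive_mulr (t x : R) : is_derive x 1 (fun y : R => t * y) t.
Proof.
have := @is_deriveZ R R R (@id R) t x 1 1 (is_derive_id x 1).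
by rewrite /GRing.scale/= mulr1.
Qed.

Lemma is_derive_sinM (t x : R) :
  is_derive x 1 (fun y : R => sin (t * y)) (t * cos (t * x)).
Proof.
by rewrite mulrC; exact: (is_derive1_comp (is_derive_sin (t * x)) (is_derive_mulr t x)).
Qed.

Lemma is_derive_cosM (t x : R) :
  is_derive x 1 (fun y : R => cos (t * y)) (- (t * sin (t * x))).
Proof.
have := is_derive1_comp (is_derive_cos (t * x)) (is_derive_mulr t x).
by rewrite mulNr mulrC.
Qed.

Lemma continuous_mulr_fun (t : R) : continuous (fun x : R => t * x).
Proof. by move=> x; apply: cvgM; [exact: cvg_cst|exact: cvg_id]. Qed.

Lemma continuous_cosM (t : R) : continuous (fun x : R => cos (t * x)).
Proof.
move=> x; apply: (@continuous_comp _ _ _ (fun x => t * x) (@cos R)).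
  exact: continuous_mulr_fun.
exact: continuous_cos.
Qed.

Lemma continuous_sinM (t : R) : continuous (fun x : R => sin (t * x)).
Proof.
move=> x; apply: (@continuous_comp _ _ _ (fun x => t * x) (@sin R)).
  exact: continuous_mulr_fun.
exact: continuous_sin.
Qed.

End FTC.

(** * Convolution with a finite cosine sum over one period *)

Section FourierKernel.
Variable R : realType.
Notation mu := (@lebesgue_measure R).
Variables (c p : R).
Hypothesis p0 : 0 < p.
Let D : set (measurableTypeR R) := `[c, c + p]%classic.

Let mD : measurable D. Proof. exact: measurable_itv. Qed.

Let Dfin : (mu D < +oo)%E.
Proof. by rewrite /D lebesgue_measure_itv/= lte_fin ltrDl p0 -EFinB ltry. Qed.

Definition rintegrable (E : set (measurableTypeR R)) (u : R -> R) :=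
  mu.-integrable E (fun x => (u x)%:E).

Lemma rintegrableM_bounded (u v : R -> R) (M : R) : rintegrable D u ->
  measurable_fun D v -> (forall x, D x -> `|v x| <= M) -> rintegrable D (fun x => u x * v x).
Proof.
move=> iu mv vM.
have mu_ : measurable_fun D u by have /measurable_int/measurable_EFinP := iu.
apply: (@le_integrable _ _ _ mu D mD _ (fun x => M%:E * (u x)%:E)%E) => //.
- by apply/measurable_EFinP; exact: measurable_funM.
- move=> x Dx; rewrite -EFinM !abse_EFin lee_fin !normrM mulrC ler_wpM2r//.
  exact: le_trans (vM _ Dx) (ler_norm _).
- exact: integrableZl.
Qed.

Lemma measurable_cosM (E : set (measurableTypeR R)) (t : R) : measurable_fun E (fun x => cos (t * x)).
Proof.
apply: measurableT_comp; first exact: continuous_measurable_fun (@continuous_cos R).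
exact: measurable_funM.
Qed.

Lemma measurable_sinM (E : set (measurableTypeR R)) (t : R) : measurable_fun E (fun x => sin (t * x)).
Proof.
apply: measurableT_comp; first exact: continuous_measurable_fun (@continuous_sin R).
exact: measurable_funM.
Qed.

Lemma normr_cos_le1 (x : R) : `|cos x| <= 1.
Proof. by rewrite ler_norml cos_geN1 cos_le1. Qed.

Lemma normr_sin_le1 (x : R) : `|sin x| <= 1.
Proof. by rewrite ler_norml sin_geN1 sin_le1. Qed.

Lemma rintegrable_cos (u : R -> R) (t : R) : rintegrable D u -> rintegrable D (fun x => u x * cos (t * x)).
Proof.
move=> iu; apply: (@rintegrableM_bounded _ _ 1) => //; first exact: measurable_cosM.
by move=> x _; exact: normr_cos_le1.
Qed.

Lemma rintegrable_sin (u : R -> R) (t : R) : rintegrable D u -> rintegrable D (fun x => u x * sin (t * x)).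
Proof.
move=> iu; apply: (@rintegrableM_bounded _ _ 1) => //; first exact: measurable_sinM.
by move=> x _; exact: normr_sin_le1.
Qed.

Definition fcos (t : R) (u : R -> R) : R := \int[mu]_(x in D) (u x * cos (t * x)).
Definition fsin (t : R) (u : R -> R) : R := \int[mu]_(x in D) (u x * sin (t * x)).

Lemma rintegrable_sum (T : Type) (s : seq T) (h : T -> R -> R) :
  (forall i, rintegrable D (h i)) -> rintegrable D (fun x => \sum_(i <- s) h i x).
Proof.
move=> ih; rewrite /rintegrable; under eq_fun do rewrite -sumEFin.
by apply: integrable_sum => // i _; exact: ih.
Qed.

Lemma rintegrableZ (u : R -> R) (k : R) : rintegrable D u -> rintegrable D (fun x => k * u x).
Proof. by move=> iu; rewrite /rintegrable; under eq_fun do rewrite EFinM; exact: integrableZl. Qed.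

Lemma rintegrableD (u v : R -> R) : rintegrable D u -> rintegrable D v ->
  rintegrable D (fun x => u x + v x).
Proof. by move=> iu iv; rewrite /rintegrable; under eq_fun do rewrite EFinD; exact: integrableD. Qed.

Lemma rintegrableB (u v : R -> R) : rintegrable D u -> rintegrable D v ->
  rintegrable D (fun x => u x - v x).
Proof. by move=> iu iv; rewrite /rintegrable; under eq_fun do rewrite EFinB; exact: integrableB. Qed.

Lemma Rintegral_sum_seq (T : Type) (s : seq T) (h : T -> R -> R) :
  (forall i, rintegrable D (h i)) ->
  \int[mu]_(x in D) (\sum_(i <- s) h i x) = \sum_(i <- s) \int[mu]_(x in D) h i x.
Proof.
move=> ih; elim: s => [|i s IH].
  by under eq_Rintegral do rewrite big_nil; rewrite big_nil Rintegral_cst// mul0r.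
under eq_Rintegral do rewrite big_cons.
rewrite big_cons RintegralD//; [by rewrite IH|exact: ih|exact: rintegrable_sum].
Qed.

Section pairing.
Variables (T : Type) (s : seq T) (th : T -> R).

Definition ksum (x : R) : R := \sum_(i <- s) cos (th i * x).

Let innerE (v : R -> R) (x y : R) : v y * ksum (x - y) = \sum_(i <- s)
    (cos (th i * x) * (v y * cos (th i * y)) + sin (th i * x) * (v y * sin (th i * y))).
Proof.
by rewrite /ksum mulr_sumr; apply: eq_bigr => i _; rewrite mulrBr cosB; ring.
Qed.

Let innerI (v : R -> R) (x : R) i : rintegrable D v -> rintegrable D
  (fun y => cos (th i * x) * (v y * cos (th i * y)) + sin (th i * x) * (v y * sin (th i * y))).
Proof.
by move=> iv; apply: rintegrableD; apply: rintegrableZ;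
  [exact: rintegrable_cos|exact: rintegrable_sin].
Qed.

Lemma ksum_inner_integrable (v : R -> R) (x : R) : rintegrable D v ->
  rintegrable D (fun y => v y * ksum (x - y)).
Proof.
move=> iv; rewrite /rintegrable; under eq_fun do rewrite innerE.
by apply: rintegrable_sum => i; exact: innerI.
Qed.

Lemma ksum_inner (v : R -> R) (x : R) : rintegrable D v ->
  \int[mu]_(y in D) (v y * ksum (x - y)) =
  \sum_(i <- s) (cos (th i * x) * fcos (th i) v + sin (th i * x) * fsin (th i) v).
Proof.
move=> iv; under eq_Rintegral do rewrite innerE.
rewrite Rintegral_sum_seq; last by move=> i; exact: innerI.
apply: eq_bigr => i _; rewrite RintegralD//.
- by rewrite !RintegralZl//; [exact: rintegrable_sin|exact: rintegrable_cos].
- by apply: rintegrableZ; exact: rintegrable_cos.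
- by apply: rintegrableZ; exact: rintegrable_sin.
Qed.

Let outerE (u v : R -> R) x : rintegrable D v ->
  u x * (\int[mu]_(y in D) (v y * ksum (x - y))) =
  \sum_(i <- s) (fcos (th i) v * (u x * cos (th i * x)) + fsin (th i) v * (u x * sin (th i * x))).
Proof.
move=> iv; rewrite ksum_inner// mulr_sumr; apply: eq_bigr => i _; ring.
Qed.

Let iterm (u v : R -> R) i : rintegrable D u -> rintegrable D v ->
  rintegrable D (fun x => fcos (th i) v * (u x * cos (th i * x)) + fsin (th i) v * (u x * sin (th i * x))).
Proof.
move=> iu iv; apply: rintegrableD; apply: rintegrableZ;
  [exact: rintegrable_cos|exact: rintegrable_sin].
Qed.

Lemma ksum_pairing_integrable (u v : R -> R) : rintegrable D u -> rintegrable D v ->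
  rintegrable D (fun x => u x * \int[mu]_(y in D) (v y * ksum (x - y))).
Proof.
move=> iu iv; rewrite /rintegrable; under eq_fun do rewrite outerE//.
by apply: rintegrable_sum => i; exact: iterm.
Qed.

(** The addition formula for cos(t(x - y)) separates the variables, so the double integral is a
    finite sum of products of single integrals and Fubini's theorem is avoided. *)
Lemma ksum_pairing (u v : R -> R) : rintegrable D u -> rintegrable D v ->
  \int[mu]_(x in D) (u x * \int[mu]_(y in D) (v y * ksum (x - y))) =
  \sum_(i <- s) (fcos (th i) u * fcos (th i) v + fsin (th i) u * fsin (th i) v).
Proof.
move=> iu iv; under eq_Rintegral do rewrite outerE//.
rewrite Rintegral_sum_seq; last by move=> i; exact: iterm.
apply: eq_bigr => i _; rewrite RintegralD//.
- rewrite !RintegralZl//; first by rewrite mulrC (mulrC (fsin _ v)).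
    exact: rintegrable_sin.
  exact: rintegrable_cos.
- by apply: rintegrableZ; exact: rintegrable_cos.
- by apply: rintegrableZ; exact: rintegrable_sin.
Qed.

End pairing.

Lemma rintegrable_cst (k : R) : rintegrable D (fun=> k).
Proof.
apply/integrableP; split; first exact: measurable_cst.
by under eq_integral do rewrite abse_EFin; rewrite integral_cst// lte_mul_pinfty.
Qed.

Lemma fcos0 (u : R -> R) : fcos 0 u = \int[mu]_(x in D) u x.
Proof. by apply: eq_Rintegral => x _; rewrite mul0r cos0 mulr1. Qed.

Lemma fsin0 (u : R -> R) : fsin 0 u = 0.
Proof.
rewrite /fsin; under eq_Rintegral do rewrite mul0r sin0 mulr0.
by rewrite Rintegral_cst// mul0r.
Qed.

Lemma fcosN t (u : R -> R) : fcos (- t) u = fcos t u.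
Proof. by apply: eq_Rintegral => x _; rewrite mulNr cosN. Qed.

Lemma fsinN_sqr t (u : R -> R) : rintegrable D u -> fsin (- t) u ^+ 2 = fsin t u ^+ 2.
Proof.
move=> iu; rewrite -[RHS]sqrrN; congr (_ ^+ 2).
rewrite /fsin -mulN1r -RintegralZl//; last exact: rintegrable_sin.
by apply: eq_Rintegral => x _; rewrite mulNr sinN mulN1r mulrN.
Qed.

Lemma Rintegral_cst1 : \int[mu]_(x in D) (1 : R) = p.
Proof.
have -> : \int[mu]_(x in D) (1 : R) = 1 * fine (mu D) by rewrite Rintegral_cst.
rewrite mul1r /D lebesgue_measure_itv/= lte_fin ltrDl p0.
by rewrite -EFinB/= addrAC subrr add0r.
Qed.

Lemma fcos_cst1 t : t != 0 -> cos (t * (c + p)) = cos (t * c) -> sin (t * (c + p)) = sin (t * c) ->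
  fcos t (fun=> 1) = 0 /\ fsin t (fun=> 1) = 0.
Proof.
move=> t0 Ec Es; have cD : c < c + p by rewrite ltrDl.
split.
  have dF (x : R) : is_derive x 1 (fun x : R => t^-1 * sin (t * x)) (cos (t * x)).
    have := is_deriveZ t^-1 (is_derive_sinM t x).
    by rewrite /GRing.scale/= mulKf.
  rewrite /fcos; under eq_Rintegral do rewrite mul1r.
  have -> := @Rintegral_FTC R _ _ _ _ cD (continuous_cosM (t := t)) dF.
  by rewrite Es subrr.
have dF (x : R) : is_derive x 1 (fun x : R => - t^-1 * cos (t * x)) (sin (t * x)).
  have := is_deriveZ (- t^-1) (is_derive_cosM t x).
  by rewrite /GRing.scale/= mulrNN mulKf.
rewrite /fsin; under eq_Rintegral do rewrite mul1r.
have -> := @Rintegral_FTC R _ _ _ _ cD (continuous_sinM (t := t)) dF.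
by rewrite Ec subrr.
Qed.

End FourierKernel.

(** * The Fejér kernel and the defect in Parseval's identity *)

Section Fejer.
Variable R : realType.
Notation mu := (@lebesgue_measure R).

Lemma cos_sin_2pin (n : nat) : cos (2 * pi * n%:R) = 1 :> R /\ sin (2 * pi * n%:R) = 0 :> R.
Proof.
elim: n => [|n [IHc IHs]]; first by rewrite mulr0 cos0 sin0.
rewrite -(@natr1 R n) mulrDr mulr1 cosD sinD IHc IHs mulr_natl cos2pi sin2pi.
by split; ring.
Qed.

Lemma cexpi_2pin (n : nat) : cexpi (2 * pi * n%:R) = 1 :> R[i].
Proof. by rewrite /cexpi; have [-> ->] := cos_sin_2pin n. Qed.

Lemma cexpi_2piz (z : int) : cexpi (2 * pi * z%:~R) = 1 :> R[i].
Proof.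
case: z => n; first exact: cexpi_2pin.
by rewrite NegzE mulrNz mulrN cexpiN -pmulrn cexpi_2pin conjc1.
Qed.

(** Multiplied by 2 sin x, both sums telescope. The left-hand side is |sin x|^2 times the squared
    modulus of the sum of the e^{2ixj}, that is sin^2(N x). *)
Lemma sin_dirichlet (N : nat) (x : R) :
  (sin x * \sum_(j < N) cos (2 * x * j%:R)) ^+ 2 +
  (sin x * \sum_(j < N) sin (2 * x * j%:R)) ^+ 2 <= 1.
Proof.
have Ec : 2 * (sin x * \sum_(j < N) cos (2 * x * j%:R)) = sin ((2 * N%:R - 1) * x) + sin x.
  elim: N => [|N IH]; first by rewrite big_ord0 !mulr0 sub0r mulN1r sinN addNr.
  rewrite big_ord_recr/= mulrDr mulrDr IH -(@natr1 R N).
  have -> : (2 * (N%:R + 1) - 1) * x = 2 * x * N%:R + x by ring.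
  have -> : (2 * N%:R - 1) * x = 2 * x * N%:R - x by ring.
  by rewrite !sinD sinN cosN; ring.
have Es : 2 * (sin x * \sum_(j < N) sin (2 * x * j%:R)) = cos x - cos ((2 * N%:R - 1) * x).
  elim: N {Ec} => [|N IH]; first by rewrite big_ord0 !mulr0 sub0r mulN1r cosN subrr.
  rewrite big_ord_recr/= mulrDr mulrDr IH -(@natr1 R N).
  have -> : (2 * (N%:R + 1) - 1) * x = 2 * x * N%:R + x by ring.
  have -> : (2 * N%:R - 1) * x = 2 * x * N%:R - x by ring.
  by rewrite !cosD sinN cosN; ring.
set A := sin x * _ in Ec *; set B := sin x * _ in Es *.
set t := (2 * N%:R - 1) * x in Ec Es.
have := cos2Dsin2 t; have := cos2Dsin2 x.
have := sqr_ge0 (sin t - sin x); have := sqr_ge0 (cos t + cos x).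
rewrite !expr2; nra.
Qed.

Variables (c p : R).
Hypothesis p0 : 0 < p.
Let D : set (measurableTypeR R) := `[c, c + p]%classic.
Let mD : measurable D. Proof. exact: measurable_itv. Qed.
Let w : R := 2 * pi / p.

Definition fejer_freq N (i : 'I_N * 'I_N) : R := 2 * pi / p * (i.1%:R - i.2%:R).
(** N times the classical Fejér kernel. The sum over pairs makes it an instance of [ksum], while
    [fejer_sqr] shows it as the squared modulus of an exponential sum, hence nonnegative. *)
Definition fejer N (x : R) : R := ksum (index_enum ('I_N * 'I_N)%type) (@fejer_freq N) x.

Lemma fejer_sqr N x : fejer N x =
  (\sum_(j < N) cos (w * x * j%:R)) ^+ 2 + (\sum_(j < N) sin (w * x * j%:R)) ^+ 2.
Proof.
rewrite /fejer /ksum !expr2 !big_distrlr/= -big_split/=.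
under [RHS]eq_bigr do rewrite -big_split/=.
rewrite pair_big/=; apply: eq_bigr => i _.
rewrite /fejer_freq -cosB; congr (cos _); rewrite /w; ring.
Qed.

Lemma fejer_ge0 N x : 0 <= fejer N x.
Proof. by rewrite fejer_sqr addr_ge0// sqr_ge0. Qed.

Lemma fejer_le N x : sin (pi / p * x) ^+ 2 * fejer N x <= 1.
Proof.
rewrite fejer_sqr mulrDr -!exprMn.
have -> : w * x = 2 * (pi / p * x) by rewrite /w; field; rewrite gt_eqF.
exact: sin_dirichlet.
Qed.

Lemma fejer_freq_cst N (i : 'I_N * 'I_N) :
  fcos c p (fejer_freq i) (fun=> 1) = (if i.1 == i.2 then p else 0) /\
  fsin c p (fejer_freq i) (fun=> 1) = 0.
Proof.
case: i => j k; rewrite /fejer_freq/=; case: eqVneq => [->|jk].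
  by rewrite subrr mulr0 fcos0 fsin0//; split => //; exact: Rintegral_cst1.
have t0 : 2 * pi / p * (j%:R - k%:R) != 0.
  rewrite mulf_neq0// ?subr_eq0 ?eqr_nat//.
  by rewrite gt_eqF// divr_gt0// mulr_gt0// pi_gt0.
have Et : 2 * pi / p * (j%:R - k%:R) * (c + p) =
    2 * pi / p * (j%:R - k%:R) * c + (2 * pi * j%:R - 2 * pi * k%:R).
  by field; rewrite gt_eqF.
have [cj sj] := cos_sin_2pin j; have [ck sk] := cos_sin_2pin k.
have cjk : cos (2 * pi * j%:R - 2 * pi * k%:R) = 1 :> R by rewrite cosB cj sj ck sk; ring.
have sjk : sin (2 * pi * j%:R - 2 * pi * k%:R) = 0 :> R by rewrite sinB cj sj ck sk; ring.
apply: fcos_cst1 => //; rewrite Et.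
  by rewrite cosD cjk sjk; ring.
by rewrite sinD cjk sjk; ring.
Qed.

Lemma sum_diag N (f : 'I_N * 'I_N -> R) :
  \sum_i (if i.1 == i.2 then f i else 0) = \sum_(j < N) f (j, j).
Proof.
transitivity (\sum_(j < N) \sum_(k < N) if j == k then f (j, k) else 0).
  by rewrite pair_bigA/=; apply: eq_bigr => -[j k] _.
apply: eq_bigr => j _; rewrite (bigD1 j)//= eqxx big1 ?addr0// => k kj.
by rewrite eq_sym (negbTE kj).
Qed.

Lemma fejer_integral N x : \int[mu]_(y in D) (fejer N (x - y)) = N%:R * p.
Proof.
have := @ksum_inner R c p _ (index_enum ('I_N * 'I_N)%type) (@fejer_freq N) (fun=> 1) x (rintegrable_cst c p0 1).
under eq_Rintegral do rewrite mul1r.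
move=> ->; transitivity (\sum_(i : 'I_N * 'I_N) (if i.1 == i.2 then p else 0)).
  apply: eq_bigr => -[j k] _; have [-> ->] := fejer_freq_cst (j, k).
  rewrite mulr0 addr0 /fejer_freq/=; case: eqVneq => [->|_]; last by rewrite mulr0.
  by rewrite subrr mulr0 mul0r cos0 mul1r.
rewrite (sum_diag (fun=> p)) big_const card_ord iter_addr addr0 mulr_natl.
by [].
Qed.

Definition fpow (t : R) (u : R -> R) : R := fcos c p t u ^+ 2 + fsin c p t u ^+ 2.

(* The defect in Parseval's identity for Fejer means.  It equals a double integral of
   (u x - u y)^2 against the Fejer kernel ([defectE]), so it is small for continuous u. *)
Definition defect N (u : R -> R) : R :=
  \int[mu]_(x in D) (u x ^+ 2) - (p * N%:R)^-1 * \sum_(i : 'I_N * 'I_N) fpow (fejer_freq i) u.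

Definition rL2 (u : R -> R) : Prop :=
  measurable_fun D u /\ rintegrable D (fun x => u x ^+ 2).

Lemma rL2_integrable u : rL2 u -> rintegrable D u.
Proof.
move=> [mu_ u2].
apply: (@le_integrable _ _ _ mu D mD _ (fun x => (1 + u x ^+ 2)%:E)) => //.
- exact/measurable_EFinP.
- move=> x _; rewrite !abse_EFin lee_fin (ger0_norm (addr_ge0 _ (sqr_ge0 _)))//.
  rewrite ler_norml; have := sqr_ge0 (u x - 1); have := sqr_ge0 (u x + 1).
  by rewrite !expr2 => *; apply/andP; split; nra.
- by apply: rintegrableD => //; exact: rintegrable_cst.
Qed.

Definition fejer_var N (u : R -> R) x := \int[mu]_(y in D) ((u x - u y) ^+ 2 * fejer N (x - y)).

Lemma fejer_varE N u x : rL2 u ->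
  fejer_var N u x = (u x ^+ 2 * \int[mu]_(y in D) (1 * fejer N (x - y))
    - 2 * (u x * \int[mu]_(y in D) (u y * fejer N (x - y))))
    + 1 * \int[mu]_(y in D) (u y ^+ 2 * fejer N (x - y)).
Proof.
move=> u2; have iu := rL2_integrable u2; have [mu_ iu2] := u2.
have i1 := rintegrable_cst c p0 1.
have iI (v : R -> R) := @ksum_inner_integrable R c p _ (index_enum ('I_N * 'I_N)%type) (@fejer_freq N) v x.
rewrite mul1r mulrA -!RintegralZl//; last 2 first.
- exact: iI.
- exact: iI.
rewrite -RintegralB//; last 2 first.
- by apply: rintegrableZ => //; exact: iI.
- by apply: rintegrableZ => //; exact: iI.
rewrite -RintegralD//; last 2 first.
- by apply: rintegrableB; apply: rintegrableZ; exact: iI.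
- exact: iI.
apply: eq_Rintegral => y _; rewrite /fejer; ring.
Qed.

Lemma fejer_var_integrable N u : rL2 u -> rintegrable D (fejer_var N u).
Proof.
move=> u2; have iu := rL2_integrable u2; have [mu_ iu2] := u2.
have i1 := rintegrable_cst c p0 1.
have ii := @ksum_pairing_integrable R c p _ (index_enum ('I_N * 'I_N)%type) (@fejer_freq N).
rewrite /rintegrable; under eq_fun do rewrite fejer_varE//.
apply: rintegrableD; last exact: ii.
by apply: rintegrableB; [exact: ii|apply: rintegrableZ; exact: ii].
Qed.

(** Expand (u x - u y)^2. The two square terms are paired with the constant 1, for which only the N
    diagonal frequencies contribute, each with the factor [p]; the cross term produces the power
    sum. *)
Lemma fejer_double_integral N u : rL2 u ->
  \int[mu]_(x in D) fejer_var N u x =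
  2 * (N%:R * p) * \int[mu]_(x in D) (u x ^+ 2) - 2 * \sum_(i : 'I_N * 'I_N) fpow (fejer_freq i) u.
Proof.
move=> u2; have iu := rL2_integrable u2; have [mu_ iu2] := u2.
have i1 := rintegrable_cst c p0 1.
have ii := @ksum_pairing_integrable R c p _ (index_enum ('I_N * 'I_N)%type) (@fejer_freq N).
under eq_Rintegral do rewrite fejer_varE//.
rewrite RintegralD//; last 2 first.
- by apply: rintegrableB; [exact: ii|apply: rintegrableZ; exact: ii].
- exact: ii.
rewrite RintegralB//; last 2 first.
- exact: ii.
- by apply: rintegrableZ => //; exact: ii.
rewrite RintegralZl//; last exact: ii.
rewrite !ksum_pairing//.
have h (v : R -> R) : \sum_(i : 'I_N * 'I_N)
   (fcos c p (fejer_freq i) v * fcos c p (fejer_freq i) (fun=> 1) +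
    fsin c p (fejer_freq i) v * fsin c p (fejer_freq i) (fun=> 1)) = N%:R * p * \int[mu]_(x in D) v x.
  transitivity (\sum_(i : 'I_N * 'I_N) (if i.1 == i.2 then p * \int[mu]_(x in D) v x else 0)).
    apply: eq_bigr => -[j k] _; have [-> ->] := fejer_freq_cst (j, k).
    rewrite mulr0 addr0 /fejer_freq/=; case: eqVneq => [->|_]; last by rewrite mulr0.
    by rewrite subrr mulr0 fcos0 mulrC.
  rewrite (sum_diag (fun=> p * _)) big_const card_ord iter_addr addr0 -mulrA mulr_natl.
  by [].
rewrite h; under [X in _ + X]eq_bigr do rewrite (mulrC (fcos _ _ _ (fun=> 1))) (mulrC (fsin _ _ _ (fun=> 1))).
rewrite h /fpow; under eq_bigr do rewrite -!expr2; ring.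
Qed.

Lemma defectE N u : (0 < N)%N -> rL2 u ->
  2 * (N%:R * p) * defect N u = \int[mu]_(x in D) fejer_var N u x.
Proof.
move=> N0 u2; rewrite fejer_double_integral// /defect; field.
by rewrite pnatr_eq0 -lt0n N0 gt_eqF.
Qed.

Lemma defect_ge0 N u : (0 < N)%N -> rL2 u -> 0 <= defect N u.
Proof.
move=> N0 u2; have Np : 0 < 2 * (N%:R * p) by rewrite !mulr_gt0// ltr0n.
rewrite -(pmulr_rge0 _ Np) defectE//; apply: Rintegral_ge0 => x _.
by apply: Rintegral_ge0 => y _; rewrite mulr_ge0 ?sqr_ge0 ?fejer_ge0.
Qed.

Lemma defect_le N u : rL2 u -> defect N u <= \int[mu]_(x in D) (u x ^+ 2).
Proof.
move=> u2; rewrite /defect lerBlDr lerDl mulr_ge0// ?invr_ge0 ?mulr_ge0 ?(ltW p0)//.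
by apply: sumr_ge0 => i _; rewrite addr_ge0// sqr_ge0.
Qed.

Lemma rL2D u v : rL2 u -> rL2 v -> rL2 (fun x => u x + v x).
Proof.
move=> [mu_ u2] [mv v2]; split; first exact: measurable_funD.
apply: (@le_integrable _ _ _ mu D mD _ (fun x => (2 * u x ^+ 2 + 2 * v x ^+ 2)%:E)) => //.
- by apply/measurable_EFinP; apply: (@measurableT_comp _ _ _ _ _ _ (fun x : R => x ^+ 2)) => //; exact: measurable_funD.
- move=> x _; rewrite !abse_EFin lee_fin ger0_norm ?sqr_ge0//.
  rewrite ger0_norm; last by rewrite addr_ge0// mulr_ge0// sqr_ge0.
  by have := sqr_ge0 (u x - v x); rewrite !expr2; lra.
- by apply: rintegrableD => //; exact: rintegrableZ.
Qed.

Lemma rL2Z u k : rL2 u -> rL2 (fun x => k * u x).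
Proof.
move=> [mu_ u2]; split; first exact: measurable_funM.
by rewrite /rintegrable; under eq_fun do rewrite exprMn; exact: rintegrableZ.
Qed.

(** The defect is a quadratic form and so satisfies the parallelogram law; the summand for u - v is
    nonnegative and is dropped. This stability is what lets the convergence pass from continuous
    functions to all of L^2. *)
Lemma defect_add N u v : (0 < N)%N -> rL2 u -> rL2 v ->
  defect N (fun x => u x + v x) <= 2 * defect N u + 2 * defect N v.
Proof.
move=> N0 u2 v2.
have vN2 : rL2 (fun x => - v x).
  by have := rL2Z (- 1) v2; under eq_fun do rewrite mulN1r.
have iu := rL2_integrable u2; have iv := rL2_integrable v2.
have ivN := rL2_integrable vN2.
have uv2 := rL2D u2 v2; have uvN2 := rL2D u2 vN2.
suff -> : 2 * defect N u + 2 * defect N v =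
    defect N (fun x => u x + v x) + defect N (fun x => u x + - v x).
  by rewrite lerDl defect_ge0.
have Ec t : fcos c p t (fun x => u x + v x) = fcos c p t u + fcos c p t v.
  rewrite /fcos -RintegralD//; [|exact: rintegrable_cos|exact: rintegrable_cos].
  by apply: eq_Rintegral => x _; rewrite mulrDl.
have Es t : fsin c p t (fun x => u x + v x) = fsin c p t u + fsin c p t v.
  rewrite /fsin -RintegralD//; [|exact: rintegrable_sin|exact: rintegrable_sin].
  by apply: eq_Rintegral => x _; rewrite mulrDl.
have EcN t : fcos c p t (fun x => u x + - v x) = fcos c p t u - fcos c p t v.
  rewrite /fcos -RintegralB//; [|exact: rintegrable_cos|exact: rintegrable_cos].
  by apply: eq_Rintegral => x _; rewrite mulrBl.
have EsN t : fsin c p t (fun x => u x + - v x) = fsin c p t u - fsin c p t v.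
  rewrite /fsin -RintegralB//; [|exact: rintegrable_sin|exact: rintegrable_sin].
  by apply: eq_Rintegral => x _; rewrite mulrBl.
have Ep : \sum_(i : 'I_N * 'I_N) fpow (fejer_freq i) (fun x => u x + v x) +
    \sum_(i : 'I_N * 'I_N) fpow (fejer_freq i) (fun x => u x + - v x) =
    2 * (\sum_(i : 'I_N * 'I_N) fpow (fejer_freq i) u) + 2 * \sum_(i : 'I_N * 'I_N) fpow (fejer_freq i) v.
  rewrite -big_split/= !mulr_sumr -big_split/=; apply: eq_bigr => i _.
  by rewrite /fpow Ec Es EcN EsN; ring.
have Ei : \int[mu]_(x in D) ((u x + v x) ^+ 2) + \int[mu]_(x in D) ((u x + - v x) ^+ 2) =
    2 * \int[mu]_(x in D) (u x ^+ 2) + 2 * \int[mu]_(x in D) (v x ^+ 2).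
  case: u2 v2 uv2 uvN2 => _ u2 [_ v2] [_ uv2] [_ uvN2].
  rewrite -!RintegralZl// -!RintegralD//; [|exact: rintegrableZ|exact: rintegrableZ].
  by apply: eq_Rintegral => x _; ring.
have key (I1 I2 K S1 S2 A B C E : R) : I1 + I2 = 2 * A + 2 * B ->
    S1 + S2 = 2 * C + 2 * E ->
    2 * (A - K * C) + 2 * (B - K * E) = (I1 - K * S1) + (I2 - K * S2).
  by move=> /(canRL (addrK _)) -> /(canRL (addrK _)) ->; ring.
exact: key Ei Ep.
Qed.

End Fejer.

(** * The defect tends to zero for continuous functions *)

Section FejerConvergence.
Variable R : realType.
Notation mu := (@lebesgue_measure R).
Variables (c p : R).
Hypothesis p0 : 0 < p.
Let D : set (measurableTypeR R) := `[c, c + p]%classic.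
Let mD : measurable D. Proof. exact: measurable_itv. Qed.

(** Uniform continuity with only [x] confined to the interval, which is possible because [u] is
    continuous on the whole line. *)
Lemma itv_unif_continuous (u : R -> R) (a b e : R) : continuous u -> 0 < e ->
  exists2 d : R, 0 < d & forall x y, a <= x <= b -> `|x - y| < d -> `|u x - u y| < e.
Proof.
move=> cu e0; have /compact_near_coveringP cov : compact (`[a, b]%classic : set R).
  exact: segment_compact.
have e20 : 0 < e / 2 by rewrite divr_gt0.
(* Compactness as a covering property along the filter of small positive radii [d]: it is enough to
   find, near each point, a radius that works for all neighbouring points. *)
have := cov R (0^'+) (fun d x => forall y, `|x - y| < d -> `|u x - u y| < e) _.
case.
- move=> x _; have /cvgrPdist_lt /(_ _ e20) := cu x.
  rewrite near_simpl => /nbhs_ballP[r /= r0 hr].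
  near=> x' d => y xy.
  have hx' : `|x - x'| < r / 2 by near: x'; apply: nbhsx_ballx; rewrite divr_gt0.
  have hd : d < r / 2 by near: d; apply: nbhs_right_lt; rewrite divr_gt0.
  have ux' : `|u x - u x'| < e / 2.
    by apply: hr; rewrite /ball/=; apply: lt_trans hx' _; rewrite ltr_pdivrMr// ltr_pMr// ltr1n.
  have uy : `|u x - u y| < e / 2.
    apply: hr; rewrite /ball/= -(subrKA x') (le_lt_trans (ler_normD _ _))//.
    by rewrite [ltRHS]splitr ltrD// (lt_trans xy).
  rewrite -(subrKA (u x)) (le_lt_trans (ler_normD _ _))// [ltRHS]splitr ltrD//.
  by rewrite distrC.
- move=> d0 /= d00 hd; exists (d0 / 2); first by rewrite divr_gt0.
  move=> x y xab xy; apply: (hd (d0 / 2)) => //=.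
  + by rewrite sub0r normrN ger0_norm ?divr_ge0 ?ltW// ltr_pdivrMr// ltr_pMr// ltr1n.
  + by rewrite divr_gt0.
Unshelve. all: by end_near. Qed.

Lemma itv_bounded (u : R -> R) (a b : R) : continuous u ->
  exists2 M : R, 0 < M & forall x, a <= x <= b -> `|u x| <= M.
Proof.
move=> cu; have /compact_bounded[M [_ hM]] : compact (u @` `[a, b]).
  apply: continuous_compact; first exact: continuous_subspaceT.
  exact: segment_compact.
exists (`|M| + 1); first by rewrite ltr_wpDl.
move=> x xab; apply: (hM (`|M| + 1)); last by exists x => //; rewrite /= in_itv.
by rewrite (le_lt_trans (ler_norm M))// ltrDl.
Qed.

(** By [fejer_le] the kernel is at most 1/sin^2(pi t/p), and this sine has a positive minimum on
    [d, p - d]. The bound is uniform in [N]. The upper condition on [|t|] is needed because x - y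
    ranges over [-p, p], where the periodic kernel also peaks at both ends. *)
Lemma fejer_away (d : R) : 0 < d -> d <= p / 2 ->
  exists2 s : R, 0 < s & forall N t, d <= `|t| -> `|t| <= p - d -> fejer p N t <= s.
Proof.
move=> d0 dp.
have := @EVT_min R (fun t => sin (pi / p * t) ^+ 2) d (p - d).
case; first by lra.
  apply: continuous_subspaceT => x.
  have cs := @continuous_sinM R (pi / p) x.
  by apply: (@continuous_comp _ _ _ (fun t => sin (pi / p * t)) (fun z => z ^+ 2)) => //; exact: exprn_continuous.
move=> t0; rewrite in_itv/= => /andP[t1 t2] tmin.
have s0 : 0 < sin (pi / p * t0) ^+ 2.
  rewrite exprn_gt0// sin_gt0_pi//; apply/andP; split.
    by rewrite mulr_gt0 ?divr_gt0 ?pi_gt0//; lra.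
  rewrite mulrAC ltr_pdivrMr// ltr_pM2l ?pi_gt0//; lra.
exists (sin (pi / p * t0) ^+ 2)^-1; first by rewrite invr_gt0.
move=> N t td tp; rewrite -[_^-1]mul1r ler_pdivlMr// mulrC.
apply: le_trans (fejer_le p0 N t).
rewrite ler_wpM2r ?fejer_ge0//.
have -> : sin (pi / p * t) ^+ 2 = sin (pi / p * `|t|) ^+ 2.
  case: (ger0P t) => // _.
  by rewrite mulrN sinN sqrrN.
by apply: tmin; rewrite in_itv/= td.
Qed.

Lemma Rintegral_indic_le (a b : R) : a <= b ->
  rintegrable D (\1_`[a, b]) /\ \int[mu]_(x in D) (\1_`[a, b] x) <= b - a.
Proof.
move=> ab; have mab : measurable (`[a, b]%classic : set (measurableTypeR R)) by exact: measurable_itv.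
split.
  apply: (@integrableS _ _ _ mu setT) => //.
  exact: (integrable_indic_itv a b true false).
rewrite /Rintegral integral_indic//.
have : (mu (`[a, b]%classic `&` D) <= (b - a)%:E)%E.
  apply: (@le_trans _ _ (mu `[a, b]%classic)).
    apply: le_measure; rewrite ?inE//; first exact: measurableI.
  rewrite lebesgue_measure_itv/= lte_fin; case: ifP => _; first by rewrite -EFinB.
  by rewrite lee_fin subr_ge0.
move=> h; rewrite -lee_fin fineK// ge0_fin_numE//.
exact: le_lt_trans h (ltry _).
Qed.

Lemma defect_continuous (u : R -> R) : continuous u -> rL2 c p u ->
  forall e : R, 0 < e -> exists N0, forall N, (N0 < N)%N -> defect c p N u <= e.
Proof.
move=> cu u2 e e0.
have [M M0 uM] := itv_bounded c (c + p) cu.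
(* The double integral may be as large as [2 * (N%:R * p) * e]. A third of this goes to each of
   three errors: [ep] handles close points, the length [d] handles the strips at the two ends, and
   the lower bound on [N] handles distant points. *)
pose ep := 2 / 3 * e / p.
have ep0 : 0 < ep by rewrite divr_gt0// mulr_gt0// divr_gt0.
have epE : ep = 2 / 3 * e / p by [].
clearbody ep.
have sep0 : 0 < Num.sqrt ep by rewrite sqrtr_gt0.
have [d1 d10 ud] := itv_unif_continuous c (c + p) cu sep0.
pose d := Num.min d1 (Num.min (p / 2) (e / (12 * M ^+ 2))).
have M20 : 0 < M ^+ 2 by rewrite exprn_gt0.
have d0 : 0 < d by rewrite !lt_min d10 !divr_gt0// mulr_gt0.
have dd1 : d <= d1 by rewrite ge_min lexx.
have dp : d <= p / 2 by rewrite !ge_min lexx orbT.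
have de : 12 * M ^+ 2 * d <= e.
  rewrite mulrC -ler_pdivlMr ?mulr_gt0//; by rewrite !ge_min lexx !orbT.
have [s s0 hs] := fejer_away d0 dp.
exists (Num.truncn (6 * M ^+ 2 * p * s / e)) => N NN.
have N0 : (0 < N)%N by exact: leq_ltn_trans NN.
have hN : 6 * M ^+ 2 * p * s <= e * N%:R.
  rewrite -ler_pdivrMl// mulrC ltW//.
  by rewrite -truncn_lt_nat// divr_ge0 ?mulr_ge0// ltW.
have NR0 : 0 < N%:R :> R by rewrite ltr0n.
have Np0 : 0 < 2 * (N%:R * p) by rewrite !mulr_gt0.
have [p0' s0' ep0' M20'] : [/\ 0 <= p, 0 <= s, 0 <= ep & 0 <= M ^+ 2] by split; exact: ltW.
have M0' : 0 <= M by exact: ltW.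
have usq x y : D x -> D y -> (u x - u y) ^+ 2 <= 4 * M ^+ 2.
  rewrite /D/= !in_itv/= => /uM; rewrite ler_norml => /andP[h1 h2] /uM.
  rewrite ler_norml => /andP[h3 h4].
  have : `|u x - u y| <= 2 * M by rewrite ler_norml; apply/andP; split; lra.
  move=> h; rewrite -[leLHS]real_normK ?num_real//.
  have -> : 4 * M ^+ 2 = (2 * M) ^+ 2 by ring.
  by rewrite ler_sqr ?nnegrE// mulr_ge0// ltW.
have ufar x y : D x -> `|x - y| < d -> (u x - u y) ^+ 2 <= ep.
  rewrite /D/= in_itv/= => Dx xy; rewrite -[leLHS]real_normK ?num_real//.
  rewrite -(sqr_sqrtr (ltW ep0)) ler_sqr ?nnegrE// ltW//.
  by apply: ud => //; exact: lt_le_trans dd1.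
(* For [x] in one of these strips, [y] may lie near the opposite end, where the periodic kernel
   peaks although [u x] and [u y] need not be close. There only (u x - u y)^2 <= 4M^2 is used, and
   the total length 2d of the strips makes the contribution small. *)
pose A : set R := `[c, c + d]%classic; pose B : set R := `[c + p - d, c + p]%classic.
have [iA hA] := @Rintegral_indic_le c (c + d) (ltac:(lra)).
have [iB hB] := @Rintegral_indic_le (c + p - d) (c + p) (ltac:(lra)).
pose bd x := (N%:R * p * ep + 4 * M ^+ 2 * s * p) * 1 + (4 * M ^+ 2 * (N%:R * p)) * (\1_A x + \1_B x).
have ifj x : rintegrable D (fun y => fejer p N (x - y)).
  have := @ksum_inner_integrable R c p _ (index_enum ('I_N * 'I_N)%type) (@fejer_freq R p N) (fun=> 1) x (rintegrable_cst c p0 1).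
  by rewrite /rintegrable; apply: eq_integrable => // y _; rewrite /= mul1r.
have ivar x : rintegrable D (fun y => (u x - u y) ^+ 2 * fejer p N (x - y)).
  have iI (v : R -> R) := @ksum_inner_integrable R c p _ (index_enum ('I_N * 'I_N)%type) (@fejer_freq R p N) v x.
  have [_ iu2] := u2.
  have := rintegrableD (rintegrableB (rintegrableZ (u x ^+ 2) (iI _ (rintegrable_cst c p0 1)))
    (rintegrableZ (2 * u x) (iI _ (rL2_integrable p0 u2)))) (iI _ iu2).
  rewrite /rintegrable; apply: eq_integrable => // y _.
  by rewrite /= /fejer; congr EFin; ring.
have fjI x : \int[mu]_(y in D) fejer p N (x - y) = N%:R * p.
  exact: fejer_integral.
have I1 : \int[mu]_(y in D) (1 : R) = p by exact: Rintegral_cst1.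
have vle x : D x -> fejer_var c p N u x <= bd x.
  move=> Dx; have [xA|xA] := boolP ((x \in A) || (x \in B)).
    apply: (@le_trans _ _ (\int[mu]_(y in D) (4 * M ^+ 2 * fejer p N (x - y)))).
      apply: le_Rintegral; [exact: mD|exact: ivar|exact: rintegrableZ|].
      by move=> y Dy; rewrite ler_wpM2r ?fejer_ge0// usq.
    have -> : \int[mu]_(y in D) (4 * M ^+ 2 * fejer p N (x - y)) = 4 * M ^+ 2 * (N%:R * p).
      by rewrite -(fjI x) -RintegralZl//; exact: ifj.
    rewrite /bd !indicE.
    have h : 1 <= (x \in A)%:R + (x \in B)%:R :> R.
      by case/orP : xA => ->; case: (_ \in _); rewrite ?addr0 ?add0r// lerDl.
    rewrite -[leLHS]mulr1 -[leLHS]add0r lerD//.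
      by rewrite mulr1 addr_ge0// !mulr_ge0.
    by rewrite ler_wpM2l// !mulr_ge0.
  have xmid : c + d <= x <= c + p - d.
    move: xA Dx => /norP[/negP xA /negP xB]; rewrite /D/= in_itv/= => /andP[h1 h2].
    apply/andP; split; rewrite leNgt; apply/negP => h.
      by apply: xA; rewrite inE /A/= in_itv/= h1 ltW.
    by apply: xB; rewrite inE /B/= in_itv/= h2 ltW.
  apply: (@le_trans _ _ (\int[mu]_(y in D) (ep * fejer p N (x - y) + 4 * M ^+ 2 * s * 1))).
    apply: le_Rintegral; [exact: mD|exact: ivar| |].
      by apply: rintegrableD; apply: rintegrableZ => //; exact: rintegrable_cst.
    move=> y Dy; have [xy|xy] := ltP `|x - y| d.
      rewrite -[leLHS]addr0 lerD//; first by rewrite ler_wpM2r ?fejer_ge0// ufar.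
      by rewrite mulr1 !mulr_ge0.
    rewrite -[leLHS]add0r lerD//; first by rewrite mulr_ge0 ?fejer_ge0// ltW.
    rewrite mulr1 ler_pM ?sqr_ge0 ?fejer_ge0 ?usq//; apply: hs => //.
    move: Dy xmid; rewrite /D/= in_itv/= ler_norml => /andP[? ?] /andP[? ?].
    by apply/andP; split; lra.
  rewrite RintegralD//; [|exact: rintegrableZ|by apply: rintegrableZ; exact: rintegrable_cst].
  have -> : \int[mu]_(y in D) (ep * fejer p N (x - y)) = ep * (N%:R * p).
    by rewrite -(fjI x) -RintegralZl//; exact: ifj.
  have -> : \int[mu]_(y in D) (4 * M ^+ 2 * s * 1) = 4 * M ^+ 2 * s * p.
    by rewrite RintegralZl ?I1//; exact: rintegrable_cst.
  rewrite /bd mulr1 (mulrC ep) -[leLHS]addr0 lerD//.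
  by rewrite !mulr_ge0 ?addr_ge0.
rewrite -(ler_pM2l Np0) defectE//.
apply: (@le_trans _ _ (\int[mu]_(x in D) bd x)).
  apply: le_Rintegral => //; first exact: fejer_var_integrable.
  by apply: rintegrableD; apply: rintegrableZ; [exact: rintegrable_cst|exact: rintegrableD].
rewrite /bd RintegralD//; [|by apply: rintegrableZ; exact: rintegrable_cst|by apply: rintegrableZ; exact: rintegrableD].
rewrite !RintegralZl//; [|exact: rintegrableD|exact: rintegrable_cst].
rewrite RintegralD// I1.
set X := \int[mu]_(x in D) \1_A x; set Y := \int[mu]_(x in D) \1_B x.
have XY : X + Y <= 2 * d by rewrite /X /Y; lra.
have h1 : 4 * M ^+ 2 * (N%:R * p) * (X + Y) <= 2 / 3 * (N%:R * p * e).
  apply: (@le_trans _ _ (4 * M ^+ 2 * (N%:R * p) * (2 * d))).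
    by rewrite ler_wpM2l// !mulr_ge0.
  have : 12 * M ^+ 2 * d * (N%:R * p) <= e * (N%:R * p) by rewrite ler_wpM2r// mulr_ge0.
  lra.
have h2 : 4 * M ^+ 2 * s * p * p <= 2 / 3 * (N%:R * p * e).
  have : 6 * M ^+ 2 * p * s * p <= e * N%:R * p by rewrite ler_wpM2r// ltW.
  lra.
have h3 : N%:R * p * ep * p = 2 / 3 * (N%:R * p * e).
  by rewrite epE; field; rewrite gt_eqF.
rewrite mulrDl h3; lra.
Qed.

End FejerConvergence.

(** * Parseval's identity for real functions *)

Section RealParseval.
Variable R : realType.
Notation mu := (@lebesgue_measure R).

Lemma sqr_sub_le (x y z : R) : (x - z) ^+ 2 <= 2 * (x - y) ^+ 2 + 2 * (y - z) ^+ 2.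
Proof. by have := sqr_ge0 ((x - y) - (y - z)); rewrite !expr2; lra. Qed.

Let quarters_le (e x y : R) : x <= e / 4 -> y <= e / 4 -> 2 * x + 2 * y <= e.
Proof. lra. Qed.

Definition clip (M x : R) : R := Num.max (- M) (Num.min M x).

Lemma normr_clip (M x : R) : 0 <= M -> `|clip M x| <= M.
Proof.
move=> M0; rewrite ler_norml /clip le_max lexx/= ge_max ge_min lexx andbT.
by rewrite (le_trans _ M0)// oppr_le0.
Qed.

Lemma clip_id (M x : R) : `|x| <= M -> clip M x = x.
Proof. by rewrite ler_norml => /andP[h1 h2]; rewrite /clip (min_idPr h2) (max_idPr h1). Qed.

Let max_lip (k s t : R) : `|Num.max k s - Num.max k t| <= `|s - t|.
Proof.
have h1 := ler_norm (s - t); have h2 := ler_norm (- (s - t)); rewrite normrN in h2.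
rewrite ler_norml; have [ks|ks] := leP k s; have [kt|kt] := leP k t;
  by apply/andP; split; lra.
Qed.

Let min_lip (k s t : R) : `|Num.min k s - Num.min k t| <= `|s - t|.
Proof.
have h1 := ler_norm (s - t); have h2 := ler_norm (- (s - t)); rewrite normrN in h2.
rewrite ler_norml; have [ks|ks] := leP k s; have [kt|kt] := leP k t;
  by apply/andP; split; lra.
Qed.

Lemma clip_lip (M x y : R) : `|clip M x - clip M y| <= `|x - y|.
Proof. exact: le_trans (max_lip _ _ _) (min_lip _ _ _). Qed.

Lemma normr_sub_clip (M y : R) : 0 <= M -> `|y - clip M y| <= `|y|.
Proof.
move=> M0; have [h|] := leP `|y| M; first by rewrite clip_id// subrr normr0.
rewrite /clip; have [y0|y0] := ger0P y => h.
  by rewrite (min_idPl (ltW h)) (max_idPr _) ?ger0_norm; lra.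
have h1 : y <= M by lra.
by rewrite (min_idPr h1) (max_idPl _) ?ler0_norm; lra.
Qed.

Lemma continuous_clip (M : R) : continuous (clip M).
Proof.
move=> x; apply/cvgrPdist_le => e e0; near=> y.
apply: le_trans (clip_lip _ _ _) _; near: y.
by move/cvgrPdist_le: (@cvg_id _ (nbhs x)); apply.
Unshelve. all: by end_near. Qed.

Variables (c p : R).
Hypothesis p0 : 0 < p.
Let D : set (measurableTypeR R) := `[c, c + p]%classic.
Let mD : measurable D. Proof. exact: measurable_itv. Qed.
Let Dfin : (mu D < +oo)%E.
Proof. by rewrite /D lebesgue_measure_itv/= lte_fin ltrDl p0 -EFinB ltry. Qed.

Lemma eq_rintegrable (u v : R -> R) : (forall x, u x = v x) ->
  rintegrable D u -> rintegrable D v.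
Proof. by move=> uv; apply: eq_integrable => // x _; rewrite uv. Qed.

Lemma bounded_rL2 (u : R -> R) (M : R) : measurable_fun D u ->
  (forall x, D x -> `|u x| <= M) -> rL2 c p u.
Proof.
move=> mu_ uM; split => //.
apply: (@eq_rintegrable (fun x => u x * u x)); first by move=> x; rewrite expr2.
apply: (@rintegrableM_bounded _ _ _ _ _ M) => //.
apply: measurable_bounded_integrable => //.
exists M; split; first exact: num_real.
by move=> x Mx y Dy; apply: le_trans (ltW Mx); exact: uM.
Qed.

Lemma continuous_rL2 (u : R -> R) : continuous u -> rL2 c p u.
Proof.
move=> cu; have [M M0 hM] := itv_bounded c (c + p) cu.
apply: (@bounded_rL2 _ M).
  by apply: measurable_funTS; exact: continuous_measurable_fun.
by move=> x Dx; apply: hM; move: Dx; rewrite /D/= in_itv.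
Qed.

Lemma rL2B (u v : R -> R) : rL2 c p u -> rL2 c p v -> rL2 c p (fun x => u x - v x).
Proof.
move=> u2 v2; have [m1 i1] := rL2D u2 (rL2Z (- 1) v2); split.
  by apply: eq_measurable_fun m1 => x _; rewrite mulN1r.
by apply: eq_rintegrable i1 => x; rewrite mulN1r.
Qed.

(** Dominated convergence: at each point clipping is eventually the identity, and the error never
    exceeds [|u|]. *)
Lemma rL2_clip_dense (u : R -> R) (e : R) : rL2 c p u -> 0 < e ->
  exists2 M : R, 0 < M & \int[mu]_(x in D) ((u x - clip M (u x)) ^+ 2) <= e.
Proof.
move=> [mu_ u2] e0.
pose f_ (n : nat) x := ((u x - clip n.+1%:R (u x)) ^+ 2)%:E.
have mcl M : measurable_fun D (fun x => (u x - clip M (u x)) ^+ 2).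
  apply: (@measurableT_comp _ _ _ _ _ _ (fun x : R => x ^+ 2)) => //.
  apply: measurable_funB => //; apply: measurableT_comp => //.
  exact: continuous_measurable_fun (@continuous_clip M).
have := @dominated_convergence _ _ R mu D mD f_ (cst 0%E) (fun x => (u x ^+ 2)%:E).
case.
- by move=> n; apply/measurable_EFinP; exact: mcl.
- exact: measurable_cst.
- apply: nearW => x Dx; apply: cvg_near_cst.
  exists (Num.trunc `|u x|) => // n /= hn; rewrite /f_ clip_id ?subrr ?expr0n//.
  rewrite ltW//; apply: lt_le_trans (truncnS_gt _) _.
  by rewrite ler_nat ltnS.
- exact: u2.
- apply: nearW => x n Dx; rewrite /f_ abse_EFin lee_fin ger0_norm ?sqr_ge0//.
  rewrite -[leLHS]real_normK ?num_real// -[leRHS]real_normK ?num_real// ler_sqr ?nnegrE//.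
  exact: normr_sub_clip.
move=> _ _; rewrite integral_cst// mul0e => /fine_cvgP[_ /cvgrPdist_le /(_ _ e0)].
move=> [n _ /(_ n (leqnn n))]; rewrite sub0r normrN/= => h.
exists n.+1%:R => //; apply: le_trans h; exact: ler_norm.
Qed.

(** Approximation by continuous functions is available in L^1. Clipping target and approximant at
    the same [M] gives |uM - v| <= 2M, so the squared distance is at most 2M times the L^1 distance;
    the tolerance e/(8M) turns this into e/4. *)
Lemma rL2_continuous_dense (u : R -> R) (e : R) : rL2 c p u -> 0 < e ->
  exists2 v : R -> R, continuous v & \int[mu]_(x in D) ((u x - v x) ^+ 2) <= e.
Proof.
move=> u2 e0; have e40 : 0 < e / 4 by rewrite divr_gt0.
have [M M0 hM] := rL2_clip_dense u2 e40.
have [mu_ iu2] := u2.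
pose uM x := clip M (u x).
have muM : measurable_fun D uM.
  by apply: measurableT_comp => //; exact: continuous_measurable_fun (@continuous_clip M).
have iuM : rintegrable D uM.
  apply: measurable_bounded_integrable => //.
  exists M; split; first exact: num_real.
  by move=> x Mx y Dy; apply: le_trans (ltW Mx); apply: normr_clip; exact: ltW.
have [g [cg ig /fine_cvgP[_ /cvgrPdist_le gu]]] := approximation_continuous_integrable mD Dfin iuM.
have := gu (e / (8 * M)); rewrite divr_gt0 ?mulr_gt0// => /(_ isT).
move=> [n _ /(_ n (leqnn n))]; rewrite sub0r normrN/= => h.
pose v x := clip M (g n x).
have cv : continuous v.
  by move=> x; apply: (@continuous_comp _ _ _ (g n) (clip M)); [exact: cg|exact: continuous_clip].
exists v => //.
have mv : measurable_fun D v by apply: measurable_funTS; exact: continuous_measurable_fun.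
have mg : measurable_fun D (g n) by apply: measurable_funTS; exact: continuous_measurable_fun.
have uM2 : rL2 c p uM.
  by apply: (@bounded_rL2 _ M) => // x _; apply: normr_clip; exact: ltW.
have rM := rL2B u2 uM2.
have v2 := continuous_rL2 cv.
have r2 := rL2B uM2 v2.
have b1 : \int[mu]_(x in D) ((uM x - v x) ^+ 2) <= 2 * M * \int[mu]_(x in D) `|uM x - g n x|.
  have iabs : rintegrable D (fun x => `|uM x - g n x|).
    by apply: integrable_norm; apply: rintegrableB => //; exact: (ig n).
  rewrite -RintegralZl//; apply: le_Rintegral => //; first by case: r2.
    exact: rintegrableZ.
  move=> x Dx; have h2 : `|uM x - v x| <= `|uM x - g n x|.
    rewrite {1}/uM -(@clip_id M (clip M (u x))) ?normr_clip ?(ltW M0)//.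
    exact: clip_lip.
  have h3 : `|uM x - v x| <= 2 * M.
    rewrite (le_trans (ler_normB _ _))// mulr2n mulrDl mul1r lerD//.
      by apply: normr_clip; exact: ltW.
    by apply: normr_clip; exact: ltW.
  by rewrite -[leLHS]real_normK ?num_real// expr2 ler_pM.
have b2 : \int[mu]_(x in D) `|uM x - g n x| <= e / (8 * M).
  exact: le_trans (ler_norm _) h.
apply: (@le_trans _ _ (2 * \int[mu]_(x in D) ((u x - uM x) ^+ 2) + 2 * \int[mu]_(x in D) ((uM x - v x) ^+ 2))).
  have [_ i1] := rM; have [_ i2] := r2.
  rewrite -!RintegralZl// -RintegralD//; [|exact: rintegrableZ|exact: rintegrableZ].
  apply: le_Rintegral => //.
  - by have [_] := rL2B u2 v2.
  - by apply: rintegrableD; apply: rintegrableZ.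
  - by move=> x Dx; exact: sqr_sub_le.
have : 2 * M * \int[mu]_(x in D) `|uM x - g n x| <= 2 * M * (e / (8 * M)).
  by rewrite ler_wpM2l// mulr_ge0// ltW.
have -> : 2 * M * (e / (8 * M)) = e / 4 by field; rewrite gt_eqF.
by move=> h4; apply: quarters_le => //; exact: le_trans b1 h4.
Qed.

(** Split u = v + (u - v) with v continuous: the defect of v tends to 0, and that of u - v is at
    most its squared norm, uniformly in [N]. *)
Lemma defect_cvg (u : R -> R) : rL2 c p u -> forall e : R, 0 < e ->
  exists N0, forall N, (N0 < N)%N -> defect c p N u <= e.
Proof.
move=> u2 e e0; have e40 : 0 < e / 4 by rewrite divr_gt0.
have [v cv hv] := rL2_continuous_dense u2 e40.
have v2 := continuous_rL2 cv; have r2 := rL2B u2 v2.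
have [N0 hN0] := defect_continuous p0 cv v2 e40.
exists N0 => N NN; have N0' : (0 < N)%N by exact: leq_ltn_trans NN.
have := defect_add p0 N0' v2 r2.
have -> : (fun x => v x + (u x - v x)) = u by apply/funext => x; rewrite addrC subrK.
move=> /le_trans; apply; apply: quarters_le; first exact: hN0.
exact: le_trans (defect_le p0 N r2) hv.
Qed.

(** The squared modulus of the integral of u(x) e^{2 pi i n x/p} over the period. For integrable
    real [u] it is even in the frequency, so natural indices suffice. *)
Definition fcoef (u : R -> R) (n : nat) : R := fpow c p (2 * pi / p * n%:R) u.

Let ps u M : R := fcoef u 0 + 2 * \sum_(0 <= n < M) fcoef u n.+1.

(** The summand depends only on the distance of the two indices. Enlarging the square of pairs by
    one row and one column adds the symmetric partial sum [ps u N], so that division by [N] yields a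
    Cesàro mean. *)
Lemma sum_fejer_freq u N : rintegrable D u ->
  \sum_(i : 'I_N * 'I_N) fpow c p (fejer_freq p i) u = series (ps u) N.
Proof.
move=> iu; rewrite /series/=.
have FE i j : fpow c p (2 * pi / p * (i%:R - j%:R)) u = fcoef u (maxn i j - minn i j).
  have [ij|ji] := leqP i j.
    rewrite /fcoef natrB// -[i%:R - j%:R]opprB mulrN /fpow fcosN fsinN_sqr//.
  by rewrite /fcoef natrB// ltnW.
transitivity (\sum_(i < N) \sum_(j < N) fcoef u (maxn i j - minn i j)).
  by rewrite pair_bigA/=; apply: eq_bigr => -[i j] _; rewrite -FE.
elim: N => [|N IH]; first by rewrite big_ord0 big_geq.
rewrite big_nat_recr//= -IH big_ord_recr/=.
under eq_bigr do rewrite big_ord_recr/=.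
rewrite big_split/= -addrA; congr (_ + _).
rewrite big_ord_recr/= maxnn minnn subnn /ps.
have h : \sum_(i < N) fcoef u (maxn i N - minn i N) = \sum_(0 <= n < N) fcoef u n.+1.
  rewrite big_mkord (reindex_inj rev_ord_inj)/=; apply: eq_bigr => i _.
  have iN : (N - i.+1 <= N)%N by rewrite leq_subr.
  rewrite (maxn_idPr iN) (minn_idPl iN); congr (fcoef u _).
  by rewrite subKn// ltn_ord.
have -> : \sum_(i < N) fcoef u (maxn N i - minn N i) = \sum_(i < N) fcoef u (maxn i N - minn i N).
  by apply: eq_bigr => i _; rewrite maxnC minnC.
rewrite h; ring.
Qed.

(** The defect estimate says that the Cesàro means of the symmetric partial sums tend to [L]. These
    partial sums are nondecreasing, hence convergent once bounded, and Cesàro's theorem then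
    identifies their limit as [L]. *)
Lemma real_parseval u : rL2 c p u ->
  ((fcoef u 0)%:E + 2%:E * \sum_(n <oo) (fcoef u n.+1)%:E =
   (p * \int[mu]_(x in D) (u x ^+ 2))%:E)%E.
Proof.
move=> u2; have iu := rL2_integrable p0 u2.
set L := p * \int[mu]_(x in D) (u x ^+ 2).
have f0 n : 0 <= fcoef u n by rewrite /fcoef /fpow addr_ge0// sqr_ge0.
have dE N : (0 < N)%N -> series (ps u) N / N%:R = L - p * defect c p N u.
  move=> N0; rewrite /L /defect sum_fejer_freq//; field.
  by rewrite pnatr_eq0 -lt0n N0 gt_eqF.
have mean_cvg : arithmetic_mean (ps u) @ \oo --> L.
  apply/cvgrPdist_le => e e0.
  have [N0 hN0] := defect_cvg u2 (divr_gt0 e0 p0).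
  exists N0 => // n /= hn; rewrite /arithmetic_mean/= mulrC dE// subKr.
  rewrite ger0_norm; last by rewrite mulr_ge0 ?(ltW p0)// defect_ge0.
  by rewrite mulrC -ler_pdivlMr//; exact: hN0.
have nd : nondecreasing_seq (ps u).
  apply/nondecreasing_seqP => n; rewrite /ps big_nat_recr//= lerD2l ler_wpM2l//.
  by rewrite lerDl.
(* Among the first 2(M + 1) partial sums the last M + 1 are at least [ps u M], while the mean of all
   of them is at most [L] because the defect is nonnegative. *)
have ub M : ps u M <= 2 * L.
  have M0 : (0 < M.+1 + M.+1)%N by rewrite addnS.
  have h1 : M.+1%:R * ps u M <= series (ps u) (M.+1 + M.+1).
    rewrite /series/= (@big_cat_nat _ _ _ M.+1)//=; last by rewrite leq_addr.
    apply: (@le_trans _ _ (\sum_(M.+1 <= i < M.+1 + M.+1) ps u M)).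
      by rewrite sumr_const_nat addnK mulr_natl.
    rewrite -[leLHS]add0r lerD//.
      by apply: sumr_ge0 => i _; rewrite /ps addr_ge0// mulr_ge0// sumr_ge0.
    rewrite !big_nat; apply: ler_sum => i /andP[h _]; apply: nd; exact: ltnW.
  have h2 := dE _ M0.
  have h3 : series (ps u) (M.+1 + M.+1) <= L * (M.+1 + M.+1)%:R.
    rewrite -ler_pdivrMr ?ltr0n// h2 gerBl mulr_ge0 ?(ltW p0)//.
    exact: defect_ge0.
  have M1 : 0 < M.+1%:R :> R by rewrite ltr0n.
  by rewrite -(ler_pM2l M1); move: h3; rewrite natrD; lra.
have cs : cvgn (ps u).
  by apply: nondecreasing_is_cvgn => //; exists (2 * L) => _ [M _ <-].
have sL : ps u @ \oo --> L.
  have h := cesaro cs.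
  by rewrite -(cvg_unique (@Rhausdorff R) mean_cvg h) in cs *.
have sE : (fun n => \sum_(0 <= k < n) (fcoef u k.+1)%:E)%E @ \oo --> ((L - fcoef u 0) / 2)%:E.
  rewrite (_ : (fun n => _) = (fun n => ((ps u n - fcoef u 0) / 2)%:E)).
    apply: cvg_EFin_seq; apply: cvgM; last exact: cvg_cst.
    by apply: cvgB => //; exact: cvg_cst.
  apply/funext => n; rewrite sumEFin /ps; congr EFin; by field.
rewrite (cvg_lim _ sE)// -EFinM -EFinD; congr EFin; by field.
Qed.

End RealParseval.

(** * Parseval's identity for complex functions *)

Section ComplexParseval.
Variable R : realType.
Notation mu := (@lebesgue_measure R).

Lemma esum_int_sym (f : int -> \bar R) : (forall z, (0 <= f z)%E) ->
  (\esum_(z in [set: int]) f z =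
   f 0%:Z + \sum_(n <oo) (f (Posz n.+1) + f (- Posz n.+1)%R))%E.
Proof.
move=> f0; rewrite (esumID (range Posz))//.
rewrite !setTI nneseriesD// addeA; congr (_ + _)%E.
  rewrite (reindex_esum [set: nat] _ Posz)//; last first.
    by split => //; move=> m n _ _ [->].
  rewrite -nneseries_esumT// nneseries_recl// -(@nneseries_addn _ (fun n => f (Posz n)) 1)//.
  by under eq_eseriesr do rewrite addn1.
rewrite (_ : ~` range Posz = range Negz); last first.
  apply/seteqP; split => [[n|n] /= h|_ [n _ <-] /= [m _]]//.
  - by exfalso; apply: h; exists n.
  - by exists n.
rewrite (reindex_esum [set: nat] _ Negz)//; last first.
  by split => //; move=> m n _ _ [->].
by rewrite -nneseries_esumT.
Qed.

Variables (c p : R).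
Hypothesis p0 : 0 < p.
Let D : set (measurableTypeR R) := `[c, c + p]%classic.
Let mD : measurable D. Proof. exact: measurable_itv. Qed.

Lemma L2on_Re (h : R -> R[i]) : L2on D h -> rL2 c p (fun x => complex.Re (h x)).
Proof.
move=> [mh h2]; split; first by case: mh.
apply/integrableP; split.
  apply/measurable_EFinP; apply: (@measurableT_comp _ _ _ _ _ _ (fun x : R => x ^+ 2)) => //.
  by case: mh.
apply: le_lt_trans h2; apply: ge0_le_integral => //.
- apply: measurableT_comp => //; apply/measurable_EFinP.
  apply: (@measurableT_comp _ _ _ _ _ _ (fun x : R => x ^+ 2)) => //.
  by case: mh.
- exact: cmeas_csqE.
- by move=> x _; rewrite abse_EFin lee_fin ger0_norm ?sqr_ge0// /csq lerDl sqr_ge0.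
Qed.

Lemma L2on_Im (h : R -> R[i]) : L2on D h -> rL2 c p (fun x => complex.Im (h x)).
Proof.
move=> [mh h2]; split; first by case: mh.
apply/integrableP; split.
  apply/measurable_EFinP; apply: (@measurableT_comp _ _ _ _ _ _ (fun x : R => x ^+ 2)) => //.
  by case: mh.
apply: le_lt_trans h2; apply: ge0_le_integral => //.
- apply: measurableT_comp => //; apply/measurable_EFinP.
  apply: (@measurableT_comp _ _ _ _ _ _ (fun x : R => x ^+ 2)) => //.
  by case: mh.
- exact: cmeas_csqE.
- by move=> x _; rewrite abse_EFin lee_fin ger0_norm ?sqr_ge0// /csq lerDr sqr_ge0.
Qed.

Let coefE (h : R -> R[i]) (t : R) : L2on D h ->
  cint D (fun x => h x * cexpi (t * x)) =
  ((fcos c p t (fun x => complex.Re (h x)) - fsin c p t (fun x => complex.Im (h x)))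
  +i* (fsin c p t (fun x => complex.Re (h x)) + fcos c p t (fun x => complex.Im (h x))))%C.
Proof.
move=> h2; have /(rL2_integrable p0) ir := L2on_Re h2.
have /(rL2_integrable p0) ii := L2on_Im h2.
apply: complex_eq => /=.
  rewrite -RintegralB//; [|exact: rintegrable_cos|exact: rintegrable_sin].
  by apply: eq_Rintegral => x _; rewrite ReM_complex.
rewrite -RintegralD//; [|exact: rintegrable_sin|exact: rintegrable_cos].
by apply: eq_Rintegral => x _; rewrite ImM_complex.
Qed.

(** For h = u + iv the cross terms in the squared coefficients at n and -n cancel, which is why the
    sum over [int] is first arranged in such pairs. What remains is the real identity for u and for
    v. *)
Theorem parseval (h : R -> R[i]) : L2on D h ->
  (\esum_(n in [set: int])
     (csq (cint D (fun x => h x * cexpi (2 * pi / p * n%:~R * x))%R))%:E =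
   p%:E * sqint D h)%E.
Proof.
move=> h2; have ru := L2on_Re h2; have rv := L2on_Im h2.
set u := (fun x => complex.Re (h x)) in ru; set v := (fun x => complex.Im (h x)) in rv.
have iu := rL2_integrable p0 ru; have iv := rL2_integrable p0 rv.
rewrite esum_int_sym; last by move=> z; rewrite lee_fin csq_ge0.
have E0 : csq (cint D (fun x => h x * cexpi (2 * pi / p * 0%:~R * x))) = fcoef c p u 0 + fcoef c p v 0.
  by rewrite coefE// /fcoef /fpow mulr0 !fsin0 /csq/= subr0 add0r expr0n !addr0.
have En n : csq (cint D (fun x => h x * cexpi (2 * pi / p * (Posz n.+1)%:~R * x))) +
   csq (cint D (fun x => h x * cexpi (2 * pi / p * (- Posz n.+1)%:~R * x))) =
   2 * (fcoef c p u n.+1 + fcoef c p v n.+1).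
  rewrite !coefE// mulrNz mulrN !fcosN.
  have sN w : rintegrable D w -> fsin c p (- (2 * pi / p * (Posz n.+1)%:~R)) w = - fsin c p (2 * pi / p * n.+1%:R) w.
    move=> iw; rewrite -[RHS]mulN1r /fsin -RintegralZl//; last exact: rintegrable_sin.
    by apply: eq_Rintegral => x _; rewrite mulNr sinN mulrN mulN1r.
  rewrite !sN// /fcoef /fpow /csq/=; ring.
have R0 w n : (0 <= (fcoef c p w n)%:E)%E by rewrite lee_fin /fcoef /fpow addr_ge0// sqr_ge0.
rewrite E0; under eq_eseriesr do rewrite -EFinD En EFinM.
rewrite nneseriesZl//; last by move=> n _; rewrite EFinD adde_ge0.
under eq_eseriesr do rewrite EFinD.
rewrite nneseriesD// EFinD.
have Pu := real_parseval p0 ru; have Pv := real_parseval p0 rv.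
transitivity ((p * \int[mu]_(x in D) (u x ^+ 2))%:E + (p * \int[mu]_(x in D) (v x ^+ 2))%:E)%E.
  rewrite -Pu -Pv addeACA ge0_muleDr//; exact: nneseries_ge0.
rewrite -EFinD -mulrDr EFinM; congr (_ * _)%E.
case: ru rv => _ iu2 [_ iv2].
rewrite -RintegralD// /Rintegral fineK//; last first.
  by apply: integrable_fin_num => //; exact: rintegrableD.
Qed.

End ComplexParseval.

(** * The Fourier integral and its multiplication formula *)

Section FourierTransform.
Variable R : realType.
Notation mu := (@lebesgue_measure R).
Notation RR := (measurableTypeR R * measurableTypeR R)%type.
Notation setTR := [set: measurableTypeR R].

(* The sign in the exponent is +. *)
Definition hat (f : R -> R[i]) (xi : R) : R[i] :=
  cint setT (fun t => f t * cexpi (2 * pi * xi * t)).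

(** Tonelli is applied to the positive and negative parts separately, so kernels with non-integrable
    sections are covered too; [fine] returns a default value where the integral is infinite. *)
Lemma measurable_integral2 (k : RR -> R) : measurable_fun setT k ->
  measurable_fun setTR (fun x => \int[mu]_y k (x, y)).
Proof.
move=> mk; apply: (@measurableT_comp _ _ _ _ _ _ fine) => //.
under eq_fun do rewrite integralE.
have mk' : measurable_fun setT (EFin \o k) by exact/measurable_EFinP.
apply: emeasurable_funB.
  have := @measurable_fun_fubini_tonelli_F _ _ _ _ R mu (EFin \o k)^\+%E (measurable_funepos mk') (fun x => funepos_ge0 _ x).
  by apply: eq_measurable_fun => x _; apply: eq_integral => y _; rewrite !funeposE.
have := @measurable_fun_fubini_tonelli_F _ _ _ _ R mu (EFin \o k)^\-%E (measurable_funeneg mk') (fun x => funeneg_ge0 _ x).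
by apply: eq_measurable_fun => x _; apply: eq_integral => y _; rewrite !funenegE.
Qed.

(** A majorant of product form makes every section integrable, not merely almost every one, so the
    real-valued inner integrals agree with the extended ones at each point. *)
Lemma Fubini_Rintegral (k : RR -> R) (A B : R -> R) : measurable_fun setT k ->
  (forall x y, `|k (x, y)| <= A x * B y) ->
  rintegrable setTR A -> rintegrable setTR B ->
  \int[mu]_x \int[mu]_y k (x, y) = \int[mu]_y \int[mu]_x k (x, y).
Proof.
move=> mk kAB iA iB.
have mk' : measurable_fun setT (EFin \o k) by exact/measurable_EFinP.
have mk1 x : measurable_fun setTR (fun y => k (x, y)).
  by apply: measurableT_comp => //; exact: measurable_pair1.
have mk2 y : measurable_fun setTR (fun x => k (x, y)).
  by apply: measurableT_comp => //; exact: measurable_pair2.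
have i1 x : rintegrable setTR (fun y => k (x, y)).
  apply: (@le_integrable _ _ _ mu _ _ _ (fun y => (A x)%:E * (B y)%:E)%E) => //.
  - exact/measurable_EFinP.
  - move=> y _; rewrite -EFinM !abse_EFin lee_fin.
    exact: le_trans (kAB _ _) (ler_norm _).
  - exact: integrableZl.
have i2 y : rintegrable setTR (fun x => k (x, y)).
  apply: (@le_integrable _ _ _ mu _ _ _ (fun x => (B y)%:E * (A x)%:E)%E) => //.
  - exact/measurable_EFinP.
  - move=> x _; rewrite -EFinM !abse_EFin lee_fin mulrC.
    exact: le_trans (kAB _ _) (ler_norm _).
  - exact: integrableZl.
have ik : (mu \x mu)%E.-integrable setT (EFin \o k).
  apply/integrable12ltyP => //.
  have := integrable_abse iA; have := integrable_abse iB.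
  move=> /integrable_lty iB' /integrable_lty iA'.
  have mA : measurable_fun setTR (fun x => `|(A x)%:E|%E).
    by apply: measurableT_comp => //; exact: measurable_int iA.
  have mB : measurable_fun setTR (fun x => `|(B x)%:E|%E).
    by apply: measurableT_comp => //; exact: measurable_int iB.
  have Bge0 : (0 <= \int[mu]_y `|(B y)%:E|)%E by exact: integral_ge0.
  apply: (@le_lt_trans _ _ (\int[mu]_x (`|(A x)%:E| * \int[mu]_y `|(B y)%:E|))%E).
    apply: ge0_le_integral => //.
    - by move=> x _; exact: integral_ge0.
    - have mak : measurable_fun setT (abse \o (EFin \o k)) by exact: measurableT_comp.
      exact: (@measurable_fun_fubini_tonelli_F _ _ _ _ R mu _ mak (fun x => abse_ge0 _)).
    - exact: emeasurable_funM.
    - move=> x _; rewrite -ge0_integralZl//; apply: ge0_le_integral => //.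
      + by apply: measurableT_comp => //; exact/measurable_EFinP.
      + exact: measurable_funeM.
      + move=> y _; rewrite -abseM -EFinM !abse_EFin lee_fin.
        exact: le_trans (kAB _ _) (ler_norm _).
  rewrite ge0_integralZr//; apply: lte_mul_pinfty => //; first exact: integral_ge0.
    have Age0 : (0 <= \int[mu]_x `|(A x)%:E|)%E by exact: integral_ge0.
    rewrite ge0_fin_numE//; exact: iA'.
  exact: iB'.
rewrite /Rintegral; congr fine.
transitivity (\int[mu]_x \int[mu]_y (k (x, y))%:E)%E.
  by apply: eq_integral => x _; rewrite fineK//; apply: integrable_fin_num => //; exact: i1.
transitivity (\int[mu]_y \int[mu]_x (k (x, y))%:E)%E; first exact: (Fubini ik).
by apply: eq_integral => y _; rewrite fineK//; apply: integrable_fin_num => //; exact: i2.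
Qed.

Lemma measurable_fst_comp (u : R -> R) : measurable_fun setTR u ->
  measurable_fun setT (fun z : RR => u z.1).
Proof. by move=> h; apply: (@measurableT_comp _ _ _ _ _ _ u) => //; exact: measurable_fst. Qed.

Lemma measurable_snd_comp (u : R -> R) : measurable_fun setTR u ->
  measurable_fun setT (fun z : RR => u z.2).
Proof. by move=> h; apply: (@measurableT_comp _ _ _ _ _ _ u) => //; exact: measurable_snd. Qed.

Let phase_cos : measurable_fun setT (fun z : RR => cos (2 * pi * z.1 * z.2)).
Proof.
apply: measurableT_comp; first exact: continuous_measurable_fun (@continuous_cos R).
apply: measurable_funM; last exact: measurable_snd.
by apply: measurable_funM => //; exact: measurable_fst.
Qed.

Let phase_sin : measurable_fun setT (fun z : RR => sin (2 * pi * z.1 * z.2)).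
Proof.
apply: measurableT_comp; first exact: continuous_measurable_fun (@continuous_sin R).
apply: measurable_funM; last exact: measurable_snd.
by apply: measurable_funM => //; exact: measurable_fst.
Qed.

Lemma cmeas_hat (f : R -> R[i]) : cmeas setTR f -> cmeas setTR (hat f).
Proof.
move=> [fr fi]; split.
  apply: (@measurable_integral2 (fun z => complex.Re (f z.2 * cexpi (2 * pi * z.1 * z.2)))).
  under eq_fun do rewrite ReM_complex.
  by apply: measurable_funB; apply: measurable_funM => //;
    exact: (measurable_snd_comp (u := fun x => _ (f x))).
apply: (@measurable_integral2 (fun z => complex.Im (f z.2 * cexpi (2 * pi * z.1 * z.2)))).
under eq_fun do rewrite ImM_complex.
by apply: measurable_funD; apply: measurable_funM => //;
  exact: (measurable_snd_comp (u := fun x => _ (f x))).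
Qed.

Lemma cintegrable_phase (D : set (measurableTypeR R)) (f : R -> R[i]) (t : R -> R) : measurable D ->
  measurable_fun D t -> cintegrable D f -> cintegrable D (fun x => f x * cexpi (t x)).
Proof.
move=> mD mt fi; under [X in cintegrable D X]eq_fun do rewrite mulrC.
apply: (@cintegrableM_bounded _ _ _ _ 1) => //.
  exact: cmeas_cexpi.
by move=> x _; rewrite csq_cexpi expr1n.
Qed.

(** Fubini for f(t) u(x) e^{2 pi i t x}, whose phase is symmetric in t and x; integrability of both
    functions provides the product majorant. *)
Lemma hat_swap (f u : R -> R[i]) : cintegrable setTR f -> cintegrable setTR u ->
  cint setT (fun t => f t * hat u t) = cint setT (fun x => u x * hat f x).
Proof.
move=> fi ui.
have E (g v : R -> R[i]) t : cintegrable setTR v ->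
    g t * hat v t = cint setT (fun x => g t * v x * cexpi (2 * pi * t * x)).
  move=> vi; rewrite /hat -cintZ//; first by apply: eq_cint => x _; rewrite mulrA.
  by apply: cintegrable_phase => //; exact: measurable_funM.
have [fr fim] := cintegrable_cmeas fi; have [ur uim] := cintegrable_cmeas ui.
have mfu : measurable_fun setT (fun z : RR => complex.Re (f z.1 * u z.2)) /\
           measurable_fun setT (fun z : RR => complex.Im (f z.1 * u z.2)).
  split.
    under eq_fun do rewrite ReM_complex.
    by apply: measurable_funB; apply: measurable_funM;
      [exact: (measurable_fst_comp (u := fun x => _ (f x)))|exact: (measurable_snd_comp (u := fun x => _ (u x)))|
       exact: (measurable_fst_comp (u := fun x => _ (f x)))|exact: (measurable_snd_comp (u := fun x => _ (u x)))].
  under eq_fun do rewrite ImM_complex.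
  by apply: measurable_funD; apply: measurable_funM;
    [exact: (measurable_fst_comp (u := fun x => _ (f x)))|exact: (measurable_snd_comp (u := fun x => _ (u x)))|
     exact: (measurable_fst_comp (u := fun x => _ (f x)))|exact: (measurable_snd_comp (u := fun x => _ (u x)))].
have [mre mim] := mfu.
pose K (z : RR) := f z.1 * u z.2 * cexpi (2 * pi * z.1 * z.2).
have mKr : measurable_fun setT (fun z => complex.Re (K z)).
  rewrite /K; under eq_fun do rewrite ReM_complex.
  by apply: measurable_funB; apply: measurable_funM.
have mKi : measurable_fun setT (fun z => complex.Im (K z)).
  rewrite /K; under eq_fun do rewrite ImM_complex.
  by apply: measurable_funD; apply: measurable_funM.
have bK t x : cabs (K (t, x)) <= cabs (f t) * cabs (u x).
  by rewrite /K cabsM cabs_cexpi mulr1 cabsM.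
under eq_cint do rewrite (E f u)//.
transitivity (cint setT (fun x => cint setT (fun t => K (t, x)))); last first.
  apply: eq_cint => x _; rewrite (E u f)//; apply: eq_cint => t _.
  by rewrite /K/= (mulrC (f t)) -(mulrA _ t) (mulrC t) mulrA.
apply: complex_eq => /=.
  apply: (@Fubini_Rintegral (fun z => complex.Re (K z)) (fun t => cabs (f t)) (fun t => cabs (u t))) => //.
  - by move=> x y; apply: le_trans (normr_Re_cabs _) _.
  - exact: cintegrable_cabs.
  - exact: cintegrable_cabs.
apply: (@Fubini_Rintegral (fun z => complex.Im (K z)) (fun t => cabs (f t)) (fun t => cabs (u t))) => //.
- by move=> x y; apply: le_trans (normr_Im_cabs _) _.
- exact: cintegrable_cabs.
- exact: cintegrable_cabs.
Qed.

End FourierTransform.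

(** * Plancherel's theorem for functions of bounded support *)

Section Plancherel.
Variable R : realType.
Notation mu := (@lebesgue_measure R).
Notation setTR := [set: measurableTypeR R].

Lemma integral_esum_int (D : set (measurableTypeR R)) (f : int -> R -> \bar R) : measurable D ->
  (forall z, measurable_fun D (f z)) -> (forall z x, (0 <= f z x)%E) ->
  (\int[mu]_(x in D) (\esum_(z in [set: int]) f z x) =
   \esum_(z in [set: int]) \int[mu]_(x in D) f z x)%E.
Proof.
move=> mD mf f0; rewrite esum_int; last by move=> z; exact: integral_ge0.
under eq_integral do rewrite esum_int//.
by rewrite integral_nneseries.
Qed.

(** |f| <= |f|^2 + 1 on the interval [-N, N], whose indicator is integrable. *)
Lemma bounded_support_L2_integrable (f : R -> R[i]) (N : R) : L2on setTR f ->
  (forall t, N < `|t| -> f t = 0) -> cintegrable setTR f.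
Proof.
move=> [mf f2] fN.
pose D : set (measurableTypeR R) := `[- N, N]%classic.
have mD : measurable D by exact: measurable_itv.
apply: (@cintegrable_le _ _ _ (fun t => csq (f t) + \1_D t)) => //.
- move=> t _; rewrite indicE; have [tN|tN] := boolP (t \in D).
    rewrite -sqr_cabs; have := sqr_ge0 (cabs (f t) - 1); have := cabs_ge0 (f t).
    by rewrite !expr2 /=; nra.
  rewrite fN; first by rewrite /cabs csq0 sqrtr0 addr0.
  rewrite ltNge; apply: contra tN => tN; rewrite inE /D/= in_itv/=.
  by rewrite -ler_norml.
- under eq_fun do rewrite EFinD; apply: integrableD => //; last exact: integrable_indic_itv.
  apply/integrableP; split; first exact: cmeas_csqE.
  by under eq_integral do rewrite abse_EFin ger0_norm ?csq_ge0//.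
Qed.

(* By Parseval on a period p containing the support, the sum of |hat f|^2 over
   xi + Z/p does not depend on xi; integrate over a period of length 1/p. *)
Theorem plancherel (f : R -> R[i]) (N : R) : 0 < N -> L2on setTR f ->
  (forall t, N < `|t| -> f t = 0) ->
  sqint setT (hat f) = sqint setT f.
Proof.
move=> N0 f2 fN; have fi := bounded_support_L2_integrable f2 fN.
have [mf f2y] := f2.
pose p := 2 * N; have p0 : 0 < p by rewrite mulr_gt0.
pose D : set (measurableTypeR R) := `[- N, - N + p]%classic.
have mD : measurable D by exact: measurable_itv.
have DE t : t \in D = (`|t| <= N).
  have Np : - N + p = N by rewrite /p; ring.
  by rewrite /D; apply/idP/idP; rewrite inE/= in_itv/= Np -ler_norml.
have cD (g : R -> R[i]) : cint setT (fun t => f t * g t) = cint D (fun t => f t * g t).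
  rewrite [RHS]cint_mkcond; apply: eq_cint => t _; case: ifPn => //.
  by rewrite DE -ltNge => /fN ->; rewrite mul0r.
have sD : sqint setT f = sqint D f.
  rewrite /sqint [RHS]integral_mkcond; apply: eq_integral => t _; rewrite patchE; case: ifPn => //.
  by rewrite DE -ltNge => /fN ->; rewrite csq0.
have d0 : 0 < p^-1 by rewrite invr_gt0.
have mh : cmeas setTR (hat f) by exact: cmeas_hat.
(* The samples of [hat f] at xi + z/p are the Fourier integrals over [D] of the modulated function
   e^{2 pi i xi t} f(t), which has the same modulus as f. *)
have inner xi : (\esum_(z in [set: int]) (csq (hat f (xi + z%:~R * p^-1)))%:E = p%:E * sqint D f)%E.
  have h2 : L2on D (fun t => cexpi (2 * pi * xi * t) * f t).
    apply: (@L2onM_bounded _ _ _ _ 1) => //.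
    - by apply: cmeas_cexpi; exact: measurable_funM.
    - by move=> x _; rewrite csq_cexpi.
    - exact: L2onS f2.
  have := parseval p0 h2.
  rewrite (@eq_sqint _ D _ f); last by move=> x _; rewrite csqM csq_cexpi mul1r.
  move=> <-; apply: eq_esum => z _; congr (csq _)%:E.
  rewrite /hat (cD (fun t => cexpi (2 * pi * (xi + z%:~R / p) * t))); apply: eq_cint => t _.
  have -> : 2 * pi * (xi + z%:~R / p) * t = 2 * pi * xi * t + 2 * pi / p * z%:~R * t.
    by field; rewrite gt_eqF.
  by rewrite cexpiD; ring.
rewrite {1}/sqint (@ge0_integral_periodize _ p^-1)//; last 2 first.
- exact: cmeas_csqE.
- by move=> x; rewrite lee_fin csq_ge0.
rewrite -integral_esum_int//; last 2 first.
- move=> z; apply: measurable_funTS.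
  by apply/measurable_EFinP; apply: cmeas_csq; have := cmeas_shift (z%:~R * p^-1) measurableT mh; rewrite preshiftT.
- by move=> z x; rewrite lee_fin csq_ge0.
under eq_integral do rewrite inner.
have muI : (mu `[0%R, p^-1%R]%classic = (p^-1)%:E)%E.
  by rewrite lebesgue_measure_itv/= lte_fin d0 sube0.
transitivity (p%:E * sqint D f * mu `[0%R, p^-1%R]%classic)%E.
  exact: (integral_cst mu (measurable_itv _)).
by rewrite muI sD muleAC -EFinM divff ?mul1e// gt_eqF.
Qed.

Lemma hat_L2 (f : R -> R[i]) (N : R) : 0 < N -> L2on setTR f ->
  (forall t, N < `|t| -> f t = 0) -> L2on setTR (hat f).
Proof.
move=> N0 f2 fN; split; first by apply: cmeas_hat; case: f2.
by rewrite (plancherel N0)//; case: f2.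
Qed.

End Plancherel.

(** * Frame bounds on dense subspaces *)

Section FrameDensity.
Variable R : realType.
Notation setTR := [set: measurableTypeR R].
Notation L2T := (L2on setTR).
Notation norm2 := (sqint setTR).

Definition frame_bounds (P : (R -> R[i]) -> Prop) (Q : (R -> R[i]) -> \bar R) : Prop :=
  exists A B : R, 0 < A /\ 0 < B /\
    forall f, P f -> (A%:E * norm2 f <= Q f)%E /\ (Q f <= B%:E * norm2 f)%E.

Lemma L2T_fin f : L2T f -> norm2 f = (fine (norm2 f))%:E.
Proof. by move=> [_ f2]; rewrite fineK// ge0_fin_numE// sqint_ge0. Qed.

Section dense.
Variables (J : choiceType) (La : J -> (R -> R[i]) -> R[i]) (P : (R -> R[i]) -> Prop).
Hypothesis PL2 : forall f, P f -> L2T f.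
Hypothesis Pdense : forall f (e : R), L2T f -> 0 < e ->
  exists2 g, P g & (norm2 (fun x => f x - g x)%R <= e%:E)%E.
Hypothesis LaB : forall j f g, L2T f -> L2T g ->
  La j (fun x => f x - g x) = La j f - La j g.
Hypothesis La_bounded : forall j, exists M : R, forall f, L2T f ->
  ((csq (La j f))%:E <= M%:E * norm2 f)%E.

Let Q f : \bar R := (\esum_(j in [set: J]) (csq (La j f))%:E)%E.

Let Q_ge0 f : (0 <= Q f)%E.
Proof. by apply: esum_ge0 => j _; rewrite lee_fin csq_ge0. Qed.

Let approx f (e : R) : L2T f -> 0 < e -> exists g,
  [/\ P g, L2T g, fine (norm2 g) <= 2 * fine (norm2 f) + 2 * e,
   fine (norm2 f) <= 2 * fine (norm2 g) + 2 * e & (norm2 (fun x => f x - g x)%R <= e%:E)%E].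
Proof.
move=> f2 e0; have [g Pg fg] := Pdense f2 e0; exists g; have g2 := PL2 Pg.
have d2 := L2onB measurableT f2 g2.
have [mf _] := f2; have [mg _] := g2; have [md _] := d2.
split => //.
  rewrite -lee_fin EFinD !EFinM -!L2T_fin//.
  have := sqintB_le measurableT mf md.
  rewrite (_ : (fun x => f x - (f x - g x)) = g); last by apply/funext => x; rewrite subKr.
  by move=> /le_trans; apply; rewrite leeD2l// lee_pmul2l// fin_num_abs.
rewrite -lee_fin EFinD !EFinM -!L2T_fin//.
have := sqintD_le measurableT mg md.
rewrite (_ : (fun x => g x + (f x - g x)) = f); last by apply/funext => x; rewrite addrC subrK.
by move=> /le_trans; apply; rewrite leeD2l// lee_pmul2l// fin_num_abs.
Qed.

Let upper (B : R) : 0 < B -> (forall f, P f -> (Q f <= B%:E * norm2 f)%E) ->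
  forall f, L2T f -> (Q f <= (4 * B)%:E * norm2 f)%E.
Proof.
move=> B0 hB f f2; rewrite (L2T_fin f2) -EFinM.
apply: ge_ereal_sup => _ [F [Ffin _] <-]; rewrite fsbig_finite//= sumEFin.
have /choice[M HM] := La_bounded.
set s := finmap.enum_fset (fset_set F).
pose K := \sum_(j <- s) `|M j|.
have K0 : 0 <= K by apply: sumr_ge0.
(* If f - g has squared norm at most d, the bound for g costs 2B(2n + 2d), where n is the squared
   norm of f, and the finitely many functionals on f - g cost 2Kd; the excess over 4Bn is thus (4B +
   2K)d. *)
have c0 : 0 < 4 * B + 2 * K by rewrite ltr_wpDr ?mulr_ge0// mulr_gt0.
apply/lee_addgt0Pr => e e0.
have d0 : 0 < e / (4 * B + 2 * K) by rewrite divr_gt0.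
have [g [Pg g2 gf _ fg]] := approx f2 d0.
have Qg : \sum_(j <- s) csq (La j g) <= B * fine (norm2 g).
  rewrite -lee_fin EFinM -L2T_fin//; apply: le_trans (hB _ Pg).
  apply: esum_ge; exists F => //.
  by rewrite fsbig_finite//= sumEFin.
have Qd : \sum_(j <- s) csq (La j (fun x => f x - g x)) <= K * (e / (4 * B + 2 * K)).
  rewrite /K mulr_suml; apply: ler_sum => j _; rewrite -lee_fin EFinM.
  apply: (le_trans (HM j _ (L2onB measurableT f2 g2))).
  apply: (@le_trans _ _ (`|M j|%:E * norm2 (fun x => f x - g x)%R)%E).
    by rewrite lee_wpmul2r ?sqint_ge0// lee_fin ler_norm.
  by rewrite lee_wpmul2l// lee_fin.
rewrite -EFinD lee_fin.
have : \sum_(j <- s) csq (La j f) <= 2 * \sum_(j <- s) csq (La j g)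
    + 2 * \sum_(j <- s) csq (La j (fun x => f x - g x)).
  rewrite !mulr_sumr -big_split/=; apply: ler_sum => j _.
  have -> : La j f = La j g + La j (fun x => f x - g x) by rewrite LaB// addrC subrK.
  exact: csqD_le.
have key (S Sg Sd n ng d : R) : S <= 2 * Sg + 2 * Sd -> Sg <= B * ng -> Sd <= K * d ->
    B * ng <= B * (2 * n + 2 * d) -> (4 * B + 2 * K) * d = e -> S <= 4 * B * n + e.
  by move=> ? ? ? ? <-; lra.
move=> h; apply: key h Qg Qd _ _.
  by rewrite ler_pM2l.
by field; rewrite gt_eqF.
Qed.

(* Each [La j] is continuous, hence so are the finite partial sums of [Q]: this gives the
   upper bound on L2T, which in turn makes [Q] continuous and yields the lower bound. *)
Lemma frame_bounds_dense : frame_bounds P Q -> frame_bounds L2T Q.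
Proof.
move=> [A [B [A0 [B0 h]]]].
have up := upper B0 (fun f Pf => (h f Pf).2).
exists (A / 4), (4 * B); split; first by rewrite divr_gt0.
split; first by rewrite mulr_gt0.
move=> f f2; split; last exact: up.
rewrite (L2T_fin f2) -EFinM.
have Qfin : Q f = (fine (Q f))%:E.
  rewrite fineK// ge0_fin_numE//; apply: (le_lt_trans (up _ f2)).
  by rewrite (L2T_fin f2) -EFinM ltry.
rewrite Qfin; apply/lee_addgt0Pr => e e0; rewrite -EFinD lee_fin.
(* With squared error d, the energy of f - g is at most 4Bd by the upper bound just proved, and
   replacing f by g in the norm costs at most Ad/2; both fit into e = (4B + A)d. *)
have c0 : 0 < 4 * B + A by rewrite addr_gt0// mulr_gt0.
have d0 : 0 < e / (4 * B + A) by rewrite divr_gt0.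
have [g [Pg g2 _ gf fg]] := approx f2 d0.
have d2 := L2onB measurableT f2 g2.
have Qd : (Q (fun x => f x - g x)%R <= (4 * B * (e / (4 * B + A)))%:E)%E.
  apply: (le_trans (up _ d2)); rewrite [leRHS]EFinM lee_wpmul2l// lee_fin mulr_ge0// ltW//.
have Qdfin : Q (fun x => f x - g x) = (fine (Q (fun x => f x - g x)))%:E.
  by rewrite fineK// ge0_fin_numE// (le_lt_trans Qd)// ltry.
have Qg : (Q g <= (2 * fine (Q f) + 2 * fine (Q (fun x => f x - g x)))%:E)%E.
  rewrite (mulr_natl _ 2) (mulr_natl (fine (Q (fun x => f x - g x))) 2) !mulr2n !EFinD -Qfin -Qdfin /Q.
  rewrite -!esumD; do ?[by move=> j _; rewrite ?adde_ge0// lee_fin csq_ge0].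
  apply: le_esum => j _; rewrite -!EFinD lee_fin.
  have -> : La j g = La j f - La j (fun x => f x - g x) by rewrite LaB// subKr.
  by apply: le_trans (csqB_le _ _) _; lra.
have Ag : A * fine (norm2 g) <= 2 * fine (Q f) + 2 * fine (Q (fun x => f x - g x)).
  rewrite -lee_fin EFinM -L2T_fin//; exact: le_trans (h _ Pg).1 Qg.
move: Qd; rewrite Qdfin lee_fin => Qd.
have h1 : A * fine (norm2 f) <= A * (2 * fine (norm2 g) + 2 * (e / (4 * B + A))) by rewrite ler_pM2l.
have key (n ng q qd d : R) : A * n <= A * (2 * ng + 2 * d) -> A * ng <= 2 * q + 2 * qd ->
    qd <= 4 * B * d -> (4 * B + A) * d = e -> 0 <= A * d -> A / 4 * n <= q + e.
  by move=> ? ? ? <- ?; lra.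
apply: key h1 Ag Qd _ _; last by rewrite mulr_ge0 ?ltW.
by field; rewrite gt_eqF.
Qed.

End dense.
End FrameDensity.

(** * Density of bounded-support functions and of their Fourier transforms *)

Section Density.
Variable R : realType.
Notation mu := (@lebesgue_measure R).
Notation setTR := [set: measurableTypeR R].
Notation L2T := (L2on setTR).
Notation norm2 := (sqint setTR).

Definition trunc_supp (n : nat) (f : R -> R[i]) (t : R) : R[i] :=
  if `|t| <= n%:R then f t else 0.

Let itvn (n : nat) : set (measurableTypeR R) := `[- n%:R, n%:R]%classic.

Let itvnE n t : (t \in itvn n) = (`|t| <= n%:R).
Proof. by rewrite /itvn; apply/idP/idP; rewrite inE/= in_itv/= -ler_norml. Qed.

Let mitvn n : measurable (itvn n). Proof. exact: measurable_itv. Qed.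

Lemma trunc_suppE n f t : trunc_supp n f t = (\1_(itvn n) t)%:C%C * f t.
Proof.
rewrite /trunc_supp indicE itvnE; case: ifP => _.
  by rewrite mul1r.
by rewrite mul0r.
Qed.

Lemma trunc_supp_out n f t : n%:R < `|t| -> trunc_supp n f t = 0.
Proof. by rewrite /trunc_supp ltNge => /negbTE ->. Qed.

Lemma cmeas_trunc n f : cmeas setTR f -> cmeas setTR (trunc_supp n f).
Proof.
move=> mf; rewrite (_ : trunc_supp n f = fun t => (\1_(itvn n) t)%:C%C * f t).
  by apply: cmeasM => //; apply: cmeas_real; exact: measurable_indic.
by apply/funext => t; rewrite trunc_suppE.
Qed.

Lemma L2_trunc n f : L2T f -> L2T (trunc_supp n f).
Proof.
move=> f2; rewrite (_ : trunc_supp n f = fun t => (\1_(itvn n) t)%:C%C * f t).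
  apply: (@L2onM_bounded _ _ _ _ 1) => //.
    by apply: cmeas_real; exact: measurable_indic.
  by move=> t _; rewrite csq_real indicE; case: (_ \in _); rewrite ?expr1n ?expr0n.
by apply/funext => t; rewrite trunc_suppE.
Qed.

Lemma norm2_trunc n f : norm2 (trunc_supp n f) = sqint (itvn n) f.
Proof.
rewrite /sqint [RHS]integral_mkcond; apply: eq_integral => t _; rewrite patchE /trunc_supp itvnE.
by case: ifP; rewrite // csq0.
Qed.

Lemma norm2_trunc_split n f : cmeas setTR f ->
  (norm2 (fun t => f t - trunc_supp n f t)%R + norm2 (trunc_supp n f) = norm2 f)%E.
Proof.
move=> mf; have mt := cmeas_trunc n mf.
rewrite /sqint -ge0_integralD//; last 4 first.
- by move=> t _; rewrite lee_fin csq_ge0.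
- by apply: cmeas_csqE; exact: cmeasB.
- by move=> t _; rewrite lee_fin csq_ge0.
- exact: cmeas_csqE.
apply: eq_integral => t _; rewrite -EFinD /trunc_supp; case: ifP => _.
  by rewrite subrr csq0 add0r.
by rewrite subr0 csq0 addr0.
Qed.

Lemma norm2_trunc_cvg f (e : R) : L2T f -> 0 < e ->
  exists2 n : nat, (0 < n)%N & (norm2 f <= norm2 (trunc_supp n f) + e%:E)%E.
Proof.
move=> [mf f2] e0.
have UT : \bigcup_n itvn n = setTR.
  apply/seteqP; split => // t _; exists (Num.trunc `|t|).+1 => //.
  by rewrite /itvn/= in_itv/= -ler_norml ltW// truncnS_gt.
have := @ge0_nondecreasing_set_cvg_integral _ _ R itvn (fun t => (csq (f t))%:E) mu.
rewrite UT => cv.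
have {}cv : (fun n => sqint (itvn n) f) @ \oo --> norm2 f.
  apply: cv => //.
  - move=> m n mn; apply/subsetPset => t; rewrite /itvn/= !in_itv/= -!ler_norml => /le_trans; apply.
    by rewrite ler_nat.
  - by move=> i; apply: cmeas_csqE; exact: cmeasTS.
  - by move=> i t _; rewrite lee_fin csq_ge0.
have NE : norm2 f = (fine (norm2 f))%:E by rewrite fineK// ge0_fin_numE// sqint_ge0.
move: cv; rewrite NE => /fine_cvgP[_ /cvgrPdist_le /(_ _ e0)] [n _ hn].
exists n.+1 => //; rewrite norm2_trunc.
have fn : sqint (itvn n.+1) f = (fine (sqint (itvn n.+1) f))%:E.
  rewrite fineK// ge0_fin_numE ?sqint_ge0//; apply: le_lt_trans f2.
  exact: sqintS.
rewrite fn -EFinD lee_fin; have := hn n.+1 (leqnSn n); rewrite /= => h.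
by have := le_trans (ler_norm _) h; lra.
Qed.

Lemma trunc_dense f (e : R) : L2T f -> 0 < e ->
  exists2 n : nat, (0 < n)%N & (norm2 (fun t => f t - trunc_supp n f t)%R <= e%:E)%E.
Proof.
move=> f2 e0; have [n n0 hn] := norm2_trunc_cvg f2 e0; exists n => //.
have t2 := L2_trunc n f2; have [mf _] := f2.
rewrite -(norm2_trunc_split n mf) addeC leeD2lE// in hn.
by rewrite (L2T_fin t2).
Qed.

Lemma L2_sub_fine (u v : R -> R[i]) : L2T u -> L2T v ->
  fine (norm2 (fun t => u t - v t)) = fine (norm2 u) + fine (norm2 v)
   - 2 * complex.Re (cint setT (fun t => u t * conjc (v t))).
Proof.
move=> u2 v2; have [mu_ _] := u2; have [mv _] := v2.
have iuv := cintegrable_mulL2 measurableT u2 (L2onJ v2).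
have isq f : L2T f -> mu.-integrable setTR (fun t => (csq (f t))%:E).
  move=> [mf f2]; apply/integrableP; split; first exact: cmeas_csqE.
  by under eq_integral do rewrite abse_EFin ger0_norm ?csq_ge0//.
rewrite -[norm2 u]/(\int[mu]_x (csq (u x))%:E)%E.
rewrite -/(Rintegral mu setT (fun x => csq (u x))) -/(Rintegral mu setT (fun x => csq (v x))).
rewrite -/(Rintegral mu setT (fun x => csq (u x - v x)))/=.
have [ir _] := iuv.
rewrite -RintegralZl// -RintegralD//; [|exact: isq|exact: isq].
rewrite -RintegralB//; last 2 first.
- by under [X in _.-integrable _ X]eq_fun do rewrite /= EFinD; apply: integrableD => //; exact: isq.
- by under [X in _.-integrable _ X]eq_fun do rewrite /= EFinM; apply: integrableZl.
apply: eq_Rintegral => t _; case: (u t) (v t) => [x y] [x' y']; rewrite /csq /=; ring.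
Qed.

(** The class on the frequency side on which Plancherel is available; it is the image under [hat] of
    the functions of bounded support. *)
Definition hat_bounded (g : R -> R[i]) : Prop :=
  exists f n, [/\ L2T f, (forall t, n%:R < `|t| -> f t = 0), (0 < n)%N & g = hat f].

(* F is first truncated to F1, and then approximated by [hat f] for f a truncation of
   the inverse transform [conjc (hat (conjc F1))]; the cross term in |F1 - hat f|^2
   is evaluated by [hat_swap]. *)
Lemma hat_bounded_dense F (e : R) : L2T F -> 0 < e ->
  exists2 g, hat_bounded g & (norm2 (fun t => F t - g t)%R <= e%:E)%E.
Proof.
move=> F2 e0; have e40 : 0 < e / 4 by rewrite divr_gt0.
have [N N0 hN] := trunc_dense F2 e40.
set F1 := trunc_supp N F in hN.
have F12 : L2T F1 by exact: L2_trunc.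
have NR : 0 < N%:R :> R by rewrite ltr0n.
have J2 := L2onJ F12.
have Jout t : N%:R < `|t| -> conjc (F1 t) = 0 by move=> h; rewrite /F1 trunc_supp_out// conjc0.
pose h := hat (fun t => conjc (F1 t)).
have h2 : L2T h := hat_L2 NR J2 Jout.
have hn : norm2 h = norm2 F1.
  by rewrite (plancherel NR J2 Jout); apply: eq_sqint => t _; rewrite csqJ.
have [n n0 hn'] := norm2_trunc_cvg h2 e40.
pose f := trunc_supp n (fun t => conjc (h t)).
have f2 : L2T f by apply: L2_trunc; exact: L2onJ.
have nR : 0 < n%:R :> R by rewrite ltr0n.
have fout t : n%:R < `|t| -> f t = 0 by exact: trunc_supp_out.
have hf2 := hat_L2 nR f2 fout.
exists (hat f); first by exists f, n.
have fE t : f t * h t = (csq (trunc_supp n h t))%:C%C.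
  rewrite /f /trunc_supp; case: ifP => _; last by rewrite mul0r csq0.
  by case: (h t) => x y; apply: complex_eq; rewrite /csq/=; ring.
have nf : norm2 f = norm2 (trunc_supp n h).
  by rewrite /f !norm2_trunc; apply: eq_sqint => t _; rewrite csqJ.
have pair : complex.Re (cint setT (fun t => hat f t * conjc (F1 t))) = fine (norm2 f).
  under eq_cint do rewrite mulrC.
  rewrite hat_swap; last 2 first.
  - exact: bounded_support_L2_integrable J2 Jout.
  - exact: bounded_support_L2_integrable f2 fout.
  by under eq_cint do rewrite fE; rewrite nf.
have d2 := L2onB measurableT F12 hf2.
have dist : (norm2 (fun t => F1 t - hat f t)%R <= (e / 4)%:E)%E.
  rewrite (L2T_fin d2) lee_fin.
  have -> : norm2 (fun t => F1 t - hat f t) = norm2 (fun t => hat f t - F1 t).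
    by apply: eq_sqint => t _; rewrite -csqN opprB.
  (* Since f h = |trunc_supp n h|^2, the cross term is exactly [norm2 f]. The squared distance
     therefore collapses to the squared norm of [h] minus that of its truncation, which [n] was
     chosen to make small. *)
  rewrite L2_sub_fine// pair (plancherel nR f2 fout) nf -hn.
  move: hn'; rewrite (L2T_fin h2) (L2T_fin (L2_trunc n h2)) -EFinD lee_fin.
  rewrite /=; move: (fine (norm2 h)) (fine (norm2 (trunc_supp n h))) => x y; lra.
have [m1 _] := L2onB measurableT F2 F12; have [m2 _] := d2.
have := sqintD_le measurableT m1 m2.
rewrite (_ : (fun x => F x - F1 x + (F1 x - hat f x)) = (fun x => F x - hat f x)); last first.
  by apply/funext => t; rewrite addrA subrK.
move=> /le_trans; apply.
rewrite (_ : e%:E = 2%:E * (e / 4)%:E + 2%:E * (e / 4)%:E)%E; last first.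
  by rewrite -!EFinM -EFinD; congr EFin; field.
by rewrite leeD// lee_pmul2l// fin_num_abs.
Qed.

End Density.

(** * The twisted difference: two-sided bounds and dense range *)

Section TwistedDifference.
Variable R : realType.
Notation mu := (@lebesgue_measure R).
Notation setTR := [set: measurableTypeR R].
Notation L2T := (L2on setTR).
Notation norm2 := (sqint setTR).
Variables (q p : R).
Hypotheses (q0 : 0 < q) (q1 : q < 1).

Lemma norm2_shift (c : R) (G : R -> R[i]) : cmeas setTR G ->
  norm2 (fun x => G (x + c)) = norm2 G.
Proof. by move=> mG; rewrite [RHS](sqint_shift c measurableT mG) preshiftT. Qed.

Lemma L2_shift (c : R) (G : R -> R[i]) : L2T G -> L2T (fun x => G (x + c)).
Proof.
move=> [mG G2]; split; last by rewrite norm2_shift.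
by have := cmeas_shift c measurableT mG; rewrite preshiftT.
Qed.

Definition tdiff (G : R -> R[i]) (x : R) : R[i] := G x - q%:C%C * G (x + p).

Lemma L2_tdiff G : L2T G -> L2T (tdiff G).
Proof. by move=> G2; apply: L2onB => //; apply: L2onZ => //; exact: L2_shift. Qed.

Lemma norm2_tdiff_le G : L2T G -> (norm2 (tdiff G) <= 4%:E * norm2 G)%E.
Proof.
move=> G2; have [mG _] := G2; have G2' := L2_shift p G2; have [mG' _] := G2'.
apply: le_trans (sqintB_le measurableT mG (cmeasZ _ mG')) _.
rewrite sqintZ// norm2_shift// csq_real (L2T_fin G2) -!EFinM -EFinD lee_fin.
have : 0 <= fine (norm2 G) by rewrite fine_ge0// sqint_ge0.
move: (fine _) => x x0.
have q2 : q ^+ 2 <= 1 by rewrite expr_le1// ltW.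
by have := ler_wpM2r x0 q2; lra.
Qed.

(** Writing x as the convex combination of (x - qy)/(1 - q) and y with weights 1 - q and q gives
    [split_sq]. Integrated with y = G(. + p), which has the norm of G, the last term is absorbed on
    the left; this yields the constant of the triangle inequality without square roots of norms. *)
Lemma norm2_tdiff_ge G : L2T G -> (((1 - q) ^+ 2)%:E * norm2 G <= norm2 (tdiff G))%E.
Proof.
move=> G2; have [mG _] := G2; have G2' := L2_shift p G2; have [mG' _] := G2'.
have T2 := L2_tdiff G2; have [mT _] := T2.
have split_sq (x y : R[i]) : csq x <= (1 - q)^-1 * csq (x - q%:C%C * y) + q * csq y.
  have h0 : 0 < 1 - q by rewrite subr_gt0.
  rewrite -(ler_pM2l h0) [leRHS]mulrDr mulVKf ?gt_eqF//.
  case: x y => [x x'] [y y']; rewrite /csq/=.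
  have key (s t : R) : (1 - q) * s ^+ 2 <= (s - q * t) ^+ 2 + (1 - q) * (q * t ^+ 2).
    rewrite -subr_ge0.
    suff -> : (s - q * t) ^+ 2 + (1 - q) * (q * t ^+ 2) - (1 - q) * s ^+ 2 = q * (s - t) ^+ 2.
      by rewrite mulr_ge0 ?sqr_ge0 ?ltW.
    by ring.
  by have := key x y; have := key x' y'; rewrite !mul0r !subr0 !addr0; lra.
have le : (norm2 G <= ((1 - q)^-1)%:E * norm2 (tdiff G) + q%:E * norm2 G)%E.
  rewrite -{2}(norm2_shift p mG) /sqint -!ge0_integralZl//; last 6 first.
  - exact: cmeas_csqE.
  - by move=> x _; rewrite lee_fin csq_ge0.
  - by rewrite lee_fin ltW.
  - exact: cmeas_csqE.
  - by move=> x _; rewrite lee_fin csq_ge0.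
  - by rewrite lee_fin invr_ge0 subr_ge0 ltW.
  rewrite -ge0_integralD//; last 4 first.
  - by move=> x _; rewrite -EFinM lee_fin mulr_ge0 ?csq_ge0// invr_ge0 subr_ge0 ltW.
  - by apply: emeasurable_funM => //; exact: cmeas_csqE.
  - by move=> x _; rewrite -EFinM lee_fin mulr_ge0 ?csq_ge0// ltW.
  - by apply: emeasurable_funM => //; exact: cmeas_csqE.
  apply: ge0_le_integral => //.
  - by move=> x _; rewrite lee_fin csq_ge0.
  - exact: cmeas_csqE.
  - by apply: emeasurable_funD; apply: emeasurable_funM => //; exact: cmeas_csqE.
  - by move=> x _; rewrite -!EFinM -EFinD lee_fin; exact: split_sq.
move: le; rewrite (L2T_fin G2) (L2T_fin T2) -!EFinM -EFinD !lee_fin.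
move: (fine _) (fine _) => x y.
have h0 : 0 < 1 - q by rewrite subr_gt0.
rewrite -(ler_pM2l h0) mulrDr mulVKf ?gt_eqF// => h.
by rewrite expr2; lra.
Qed.

(** The G constructed are the partial sums of the Neumann series of the F(x + jp) q^j. Each step
    replaces the residual by q times its translate by p, so its squared norm is multiplied by
    q^2. *)
Lemma tdiff_approx F (J : nat) : L2T F -> exists2 G, L2T G &
  (norm2 (fun x => F x - tdiff G x)%R = (q ^+ J.*2)%:E * norm2 F)%E.
Proof.
move=> F2; elim: J => [|J [G G2 h]].
  exists (fun=> 0).
    split; first exact: cmeas_cst.
    by rewrite /sqint; under eq_integral do rewrite csq0; rewrite integral0.
  by rewrite expr0 mul1e; apply: eq_sqint => x _; rewrite /tdiff mulr0 !subr0.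
exists (fun x => F x + q%:C%C * G (x + p)).
  by apply: L2onD => //; apply: L2onZ => //; exact: L2_shift.
have [md _] := L2onB measurableT F2 (L2_tdiff G2).
have [md' _] := L2_shift p (L2onB measurableT F2 (L2_tdiff G2)).
rewrite doubleS 2!exprS mulrA -expr2 EFinM -muleA -h -(norm2_shift p md) -csq_real -sqintZ//.
by apply: eq_sqint => x _; rewrite /tdiff; congr csq; ring.
Qed.

Definition tdiff_range (g : R -> R[i]) : Prop := exists2 G, L2T G & g = tdiff G.

Lemma tdiff_dense F (e : R) : L2T F -> 0 < e ->
  exists2 g, tdiff_range g & (norm2 (fun x => F x - g x)%R <= e%:E)%E.
Proof.
move=> F2 e0; set K := fine (norm2 F).
have K0 : 0 <= K by rewrite fine_ge0// sqint_ge0.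
have : (fun n => q ^+ n * K) @ \oo --> (0 : R).
  by rewrite -[X in _ --> X](mul0r K); apply: cvgMr_tmp; apply: cvg_expr; rewrite ger0_norm// ltW.
move=> /cvgrPdist_le /(_ _ e0)[n _ hn].
have [G G2 h] := tdiff_approx n F2; exists (tdiff G); first by exists G.
have := hn n.*2; rewrite /= -addnn leq_addr sub0r normrN => /(_ isT) hl.
by rewrite h (L2T_fin F2) -EFinM lee_fin -addnn; exact: le_trans (ler_norm _) hl.
Qed.

End TwistedDifference.

(** * The Gabor system on the Fourier side *)

Section ExponentialTail.
Variable R : realType.
Notation mu := (@lebesgue_measure R).
Notation setTR := [set: measurableTypeR R].
Notation L2T := (L2on setTR).
Notation norm2 := (sqint setTR).

Definition etail (w x : R) : R[i] := if 0 < x then (expR (2 * pi * w * x))%:C%C else 0.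

Lemma real_complexM (x y : R) : (x * y)%:C%C = x%:C%C * y%:C%C.
Proof. by rewrite rmorphM. Qed.

Lemma etail_pos w x : 0 < x -> etail w x = (expR (2 * pi * w * x))%:C%C.
Proof. by rewrite /etail => ->. Qed.

Lemma etail_neg w x : x <= 0 -> etail w x = 0.
Proof. by rewrite /etail leNgt => /negbTE ->. Qed.

Lemma etail_real w x : etail w x = (if 0 < x then expR (2 * pi * w * x) else 0)%:C%C.
Proof. by rewrite /etail; case: ifP. Qed.

Lemma cint_itv_obnd_cbnd (x y : R) (f : R -> R[i]) :
  cmeas `]x, y] f -> cint `]x, y] f = cint `[x, y] f.
Proof.
move=> [fr fi]; rewrite /cint /Rintegral; congr (fine _ +i* fine _)%C;
  by apply: integral_itv_obnd_cbnd; apply/measurable_EFinP.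
Qed.

Lemma measurable_expRM D (k : R) : measurable_fun D (fun x : R => expR (k * x)).
Proof.
apply: measurable_funTS; apply: continuous_measurable_fun => x.
apply: (@continuous_comp _ _ _ (fun x => k * x) (@expR R)).
  exact: continuous_mulr_fun.
exact: continuous_expR.
Qed.

Lemma cmeas_etail w : cmeas setTR (etail w).
Proof.
rewrite (_ : etail w = fun x => (if 0 < x then expR (2 * pi * w * x) else 0)%:C%C); last first.
  by apply/funext => x; rewrite etail_real.
apply: cmeas_real; apply: measurable_fun_if => //.
- exact: measurable_fun_ltr.
- exact: measurable_expRM.
Qed.

Variable w : R.
Hypothesis w0 : w < 0.

Let rate_gt0 : 0 < - (2 * pi * w).
Proof. by rewrite oppr_gt0 nmulr_llt0// mulr_gt0// pi_gt0. Qed.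

(** Up to a constant, [etail w] is the density of the exponential law of rate -2 pi w, so
    integrability is inherited from that density. *)
Lemma cabs_etail_le x : cabs (etail w x) <= (- (2 * pi * w))^-1 * exponential_pdf (- (2 * pi * w)) x.
Proof.
rewrite etail_real cabs_real; case: ifPn => [x0|x0].
  by rewrite exponential_pdfE ?(ltW x0)// mulKf ?gt_eqF// opprK ger0_norm ?expR_ge0.
by rewrite normr0 mulr_ge0 ?invr_ge0 ?exponential_pdf_ge0// ltW.
Qed.

Lemma etail_integrable : cintegrable setTR (etail w).
Proof.
apply: (@cintegrable_le _ _ _ (fun x => (- (2 * pi * w))^-1 * exponential_pdf (- (2 * pi * w)) x)).
- exact: measurableT.
- exact: cmeas_etail.
- by move=> x _; exact: cabs_etail_le.
- under [X in _.-integrable _ X]eq_fun do rewrite /= EFinM.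
  by apply: integrableZl => //; exact: integrable_exponential_pdf.
Qed.

Lemma cabs_etail_le1 x : cabs (etail w x) <= 1.
Proof.
rewrite etail_real cabs_real; case: ifPn => [x0|x0]; last by rewrite normr0.
rewrite ger0_norm ?expR_ge0// -[leRHS]expR0 ler_expR.
by rewrite nmulr_rle0 ?(ltW x0)// -oppr_gt0.
Qed.

Lemma L2_etail : L2T (etail w).
Proof.
split; first exact: cmeas_etail.
apply: le_lt_trans (cintegrable_lty measurableT etail_integrable).
apply: ge0_le_integral => //.
- by move=> x _; rewrite lee_fin csq_ge0.
- by apply: cmeas_csqE; exact: cmeas_etail.
- by apply/measurable_EFinP; apply: cmeas_cabs; exact: cmeas_etail.
- by move=> x _; rewrite lee_fin -sqr_cabs expr2 ler_piMl ?cabs_ge0 ?cabs_etail_le1.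
Qed.

Lemma is_derive_expRM (k x : R) : is_derive x 1 (fun y : R => expR (k * y)) (k * expR (k * x)).
Proof. by rewrite mulrC; exact: (is_derive1_comp (is_derive_expR (k * x)) (is_derive_mulr k x)). Qed.

(** The two antiderivatives are the real and imaginary parts of e^{(k + ic)x}/(k + ic), with [D] the
    squared modulus of k + ic. *)
Lemma cint_expRM_cexpi (k c : R) : k != 0 ->
  (k +i* c)%C * cint `[0, 1] (fun x => (expR (k * x))%:C%C * cexpi (c * x)) =
  (expR k)%:C%C * cexpi c - 1.
Proof.
move=> k0.
have D0 : k ^+ 2 + c ^+ 2 != 0.
  by rewrite gt_eqF// ltr_wpDr ?sqr_ge0// exprn_even_gt0.
set D := k ^+ 2 + c ^+ 2 in D0.
have dc (x : R) : is_derive x 1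
   (fun x : R => D^-1 * (expR (k * x) * (k * cos (c * x) + c * sin (c * x))))
   (expR (k * x) * cos (c * x)).
  have h := is_deriveZ D^-1 (is_deriveM (is_derive_expRM k x)
     (is_deriveD (is_deriveZ k (is_derive_cosM c x)) (is_deriveZ c (is_derive_sinM c x)))).
  apply: is_derive_eq h _.
  transitivity (D^-1 * (expR (k * x) * (k * - (c * sin (c * x)) + c * (c * cos (c * x))) +
    (k * cos (c * x) + c * sin (c * x)) * (k * expR (k * x)))) => //.
  by move: D0; rewrite /D => D0; field.
have ds (x : R) : is_derive x 1
   (fun x : R => D^-1 * (expR (k * x) * (k * sin (c * x) - c * cos (c * x))))
   (expR (k * x) * sin (c * x)).
  have h := is_deriveZ D^-1 (is_deriveM (is_derive_expRM k x)
     (is_deriveB (is_deriveZ k (is_derive_sinM c x)) (is_deriveZ c (is_derive_cosM c x)))).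
  apply: is_derive_eq h _.
  transitivity (D^-1 * (expR (k * x) * (k * (c * cos (c * x)) - c * - (c * sin (c * x))) +
    (k * sin (c * x) - c * cos (c * x)) * (k * expR (k * x)))) => //.
  by move: D0; rewrite /D => D0; field.
have ce : continuous (fun x : R => expR (k * x)).
  move=> x; apply: (@continuous_comp _ _ _ (fun x => k * x) (@expR R)).
    exact: continuous_mulr_fun.
  exact: continuous_expR.
have cc : continuous (fun x : R => expR (k * x) * cos (c * x)).
  by move=> x; apply: cvgM; [exact: ce|exact: continuous_cosM].
have cs : continuous (fun x : R => expR (k * x) * sin (c * x)).
  by move=> x; apply: cvgM; [exact: ce|exact: continuous_sinM].
have Ec : cint `[0, 1] (fun x => (expR (k * x))%:C%C * cexpi (c * x)) =
  ((D^-1 * (expR k * (k * cos c + c * sin c)) - D^-1 * k) +i*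
   (D^-1 * (expR k * (k * sin c - c * cos c)) + D^-1 * c))%C.
  rewrite /cint; congr Complex.
    transitivity (\int[mu]_(x in `[0, 1]) (expR (k * x) * cos (c * x))).
      by apply: eq_Rintegral => x _; rewrite /= mul0r subr0.
    rewrite (Rintegral_FTC ltr01 cc dc) !mulr1 !mulr0 expR0 cos0 sin0.
    by ring.
  transitivity (\int[mu]_(x in `[0, 1]) (expR (k * x) * sin (c * x))).
    by apply: eq_Rintegral => x _; rewrite /= mul0r addr0.
  rewrite (Rintegral_FTC ltr01 cs ds) !mulr1 !mulr0 expR0 cos0 sin0.
  by ring.
rewrite Ec; apply: complex_eq => /=; rewrite /D; field.
  by [].
by [].
Qed.

(* The transform E of etail satisfies E = e^z E + (an integral over [0, 1]), by a unit shift. *)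
Lemma hat_etail t : hat (etail w) t = - (2 * pi * w +i* (2 * pi * t))%C^-1.
Proof.
set k := 2 * pi * w; set c := 2 * pi * t.
have k0 : k < 0 by rewrite -oppr_gt0.
pose E x := etail w x * cexpi (c * x).
have mE : cmeas setTR E.
  apply: cmeasM; first exact: cmeas_etail.
  by apply: cmeas_cexpi; apply: measurable_funM.
have iE : cintegrable setTR E.
  by apply: cintegrable_phase etail_integrable => //; apply: measurable_funM.
pose z := (k +i* c)%C.
pose ez := (expR k)%:C%C * cexpi c.
(* [J] carries the mismatch of the unit shift: for -1 < x <= 0 the shifted tail is already nonzero
   while the unshifted one still vanishes. *)
pose J x := if x \in (`]0, 1]%classic : set (measurableTypeR R)) then (expR (k * x))%:C%C * cexpi (c * x) else 0.
have shiftE x : E (x + 1) = ez * E x + J (x + 1).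
  rewrite /E /J /ez; have [x0|x0] := ltP 0 x.
    rewrite !etail_pos ?addr_gt0// ifF.
      rewrite addr0 -/k [k * _]mulrDr [c * _]mulrDr !mulr1 cexpiD expRD real_complexM.
      by rewrite mulrACA mulrC.
    by apply/negbTE; rewrite mem_setE in_itv/= negb_and; apply/orP; right; lra.
  rewrite [etail w x]etail_neg// mul0r mulr0 add0r.
  have [x2|x2] := ltP (-1) x.
    rewrite etail_pos ?ifT//; last lra.
    by rewrite mem_setE in_itv/=; apply/andP; split; lra.
  rewrite etail_neg ?ifF ?mul0r//; last lra.
  by apply/negbTE; rewrite mem_setE in_itv/= negb_and; apply/orP; left; lra.
have JE x : J x = E x - ez * E (x - 1).
  by have := shiftE (x - 1); rewrite subrK => ->; rewrite addrC addKr.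
have iE' : cintegrable setTR (fun x => E (x - 1)).
  by have := cintegrable_shift (-1) measurableT iE; rewrite preshiftT.
have cE' : cint setTR (fun x => E (x - 1)) = cint setTR E.
  by rewrite [RHS](cint_shift (-1) measurableT mE) preshiftT.
have key : cint setTR J = (1 - ez) * cint setTR E.
  rewrite (eq_cint (g := fun x => E x - ez * E (x - 1))); last by move=> x _; exact: JE.
  rewrite cintB//; last exact: cintegrableZ.
  by rewrite cintZ// cE' mulrBl mul1r.
have Jint : z * cint setTR J = ez - 1.
  rewrite /J -cint_mkcond cint_itv_obnd_cbnd; last first.
    apply: cmeasM; first by apply: cmeas_real; exact: measurable_expRM.
    by apply: cmeas_cexpi; exact: measurable_funM.
  by rewrite cint_expRM_cexpi// lt_eqF.
have z0 : z != 0.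
  by rewrite eq_complex/= lt_eqF.
(* The modulus of [ez] is e^k < 1 because w < 0, so the shift relation can be solved for the
   transform. *)
have ez1 : 1 - ez != 0.
  rewrite subr_eq0; apply/eqP => /(congr1 (@cabs R)).
  rewrite -[X in cabs X = _]cexpi0 cabs_cexpi.
  rewrite /ez cabsM cabs_cexpi mulr1 cabs_real ger0_norm ?expR_ge0// => h.
  by move: k0; rewrite -expR_lt1 -h ltxx.
rewrite -[LHS]/(cint setTR E).
apply: (mulfI ez1); rewrite -key; apply: (mulfI z0); rewrite Jint.
by rewrite mulrCA mulrN divff// mulrN1 opprB.
Qed.

Lemma csq_hat_etail t : csq (hat (etail w) t) <= (1 + w^-1 ^+ 2) * (oneDsqr t)^-1.
Proof.
rewrite hat_etail csqN.
have w20 : 0 < w ^+ 2 by rewrite exprn_even_gt0//= lt_eqF.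
have D0 : 0 < w ^+ 2 + t ^+ 2 by rewrite ltr_wpDr ?sqr_ge0.
have pi1 : 1 <= 2 * pi :> R by have := pi_ge2 R; lra.
have -> : csq ((2 * pi * w +i* (2 * pi * t))^-1)%C = ((2 * pi) ^+ 2 * (w ^+ 2 + t ^+ 2))^-1.
  have z0 : (2 * pi * w +i* (2 * pi * t))%C != 0.
    by rewrite eq_complex/= mulf_eq0 negb_and (lt_eqF w0) orbF gt_eqF// mulr_gt0// pi_gt0.
  have c1 : csq ((2 * pi * w +i* (2 * pi * t))^-1)%C * csq (2 * pi * w +i* (2 * pi * t))%C = 1.
    by rewrite -csqM mulVf// /csq/= expr1n expr0n addr0.
  have cE : csq (2 * pi * w +i* (2 * pi * t))%C = (2 * pi) ^+ 2 * (w ^+ 2 + t ^+ 2).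
    by rewrite /csq/=; ring.
  by rewrite -cE -[LHS]mulr1 -[X in _ * X](divff (_ : csq (2 * pi * w +i* (2 * pi * t))%C != 0));
    [rewrite mulrA c1 mul1r|rewrite cE gt_eqF// mulr_gt0// exprn_gt0// (lt_le_trans _ pi1)].
have O0 : 0 < oneDsqr t by rewrite (lt_le_trans _ (oneDsqr_ge1 t)).
rewrite ler_pdivlMr// ler_pdivrMl; last by rewrite mulr_gt0// exprn_gt0// (lt_le_trans _ pi1).
(* The constant is chosen so that the difference of the two sides is w^2 + t^2/w^2. *)
have h : oneDsqr t <= (1 + w^-1 ^+ 2) * (w ^+ 2 + t ^+ 2).
  rewrite /oneDsqr -subr_ge0.
  have -> : (1 + w^-1 ^+ 2) * (w ^+ 2 + t ^+ 2) - (1 + t ^+ 2) = w ^+ 2 + w^-1 ^+ 2 * t ^+ 2.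
    by field; rewrite lt_eqF.
  by rewrite addr_ge0 ?sqr_ge0// -exprMn sqr_ge0.
apply: (le_trans h); rewrite mulrC -[leRHS]mulrA ler_peMl//.
  by rewrite mulr_ge0 ?addr_ge0 ?sqr_ge0.
by rewrite exprn_ege1.
Qed.

Lemma integral_oneDsqr : (\int[mu]_x ((oneDsqr x)^-1)%:E < +oo)%E.
Proof.
rewrite ge0_symfun_integralT.
- rewrite (_ : [set x | _] = `[0, +oo[%classic); last first.
    by apply/seteqP; split => x/=; rewrite in_itv/= andbT.
  by rewrite integral0y_oneDsqr -EFinM ltry.
- by move=> x; rewrite invr_ge0 (le_trans _ (oneDsqr_ge1 x)).
- exact: continuous_oneDsqrV.
- by move=> x; rewrite /= /oneDsqr sqrrN.
Qed.

(** [etail w] has unbounded support, so [plancherel] does not apply to it; the explicit formula for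
    its transform gives a majorant proportional to 1/(1 + t^2) instead. *)
Lemma L2_hat_etail : L2T (hat (etail w)).
Proof.
have mh := cmeas_hat (cmeas_etail w); split => //.
have mo : measurable_fun setTR (fun x : R => ((oneDsqr x)^-1)%:E).
  by apply/measurable_EFinP; apply: continuous_measurable_fun; exact: continuous_oneDsqrV.
have o0 (x : R) : (0 <= ((oneDsqr x)^-1)%:E)%E.
  by rewrite lee_fin invr_ge0 (le_trans _ (oneDsqr_ge1 x)).
apply: (@le_lt_trans _ _ ((1 + w^-1 ^+ 2)%:E * \int[mu]_x ((oneDsqr x)^-1)%:E)%E).
  rewrite -ge0_integralZl//; last by rewrite lee_fin addr_ge0 ?sqr_ge0.
  apply: ge0_le_integral => //.
  - by move=> x _; rewrite lee_fin csq_ge0.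
  - exact: cmeas_csqE.
  - exact: emeasurable_funM.
  - by move=> x _; rewrite -EFinM lee_fin csq_hat_etail.
by rewrite lte_mul_pinfty ?integral_oneDsqr// lee_fin addr_ge0 ?sqr_ge0.
Qed.

End ExponentialTail.

(** * Sums weighted by an absolutely summable sequence *)

Section WeightedSums.
Variable R : realType.
Notation mu := (@lebesgue_measure R).

Lemma cmeas_csum (D : set (measurableTypeR R)) (u : nat -> R -> R[i]) : measurable D ->
  (forall k, cmeas D (u k)) -> cmeas D (fun x => csum (u ^~ x)).
Proof.
move=> mD mu_; split => /=; rewrite /rsum; apply: measurable_fun_limn => // n;
  apply: measurable_sum => k; by have [] := mu_ k.
Qed.

Variable a : nat -> R[i].
Hypothesis asum : csummable a.

Definition abs_total : R := fine (\sum_(k <oo) (cabs (a k))%:E)%E.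

Lemma abs_totalE : (\sum_(k <oo) (cabs (a k))%:E = abs_total%:E)%E.
Proof. by rewrite fineK// ge0_fin_numE// nneseries_ge0// => k _ _; rewrite lee_fin cabs_ge0. Qed.

Lemma abs_total_ge0 : 0 <= abs_total.
Proof. by rewrite fine_ge0// nneseries_ge0// => k _ _; rewrite lee_fin cabs_ge0. Qed.

Lemma weighted_sum_le (c : nat -> R) (M : R) : (forall k, 0 <= c k <= M) ->
  (\sum_(k <oo) (cabs (a k) * c k)%:E <= (abs_total * M)%:E)%E.
Proof.
move=> cM; rewrite EFinM -abs_totalE muleC -nneseriesZl//; last first.
  by move=> k _; rewrite lee_fin cabs_ge0.
apply: lee_nneseries => [k _ _|k _].
  by have /andP[? _] := cM k; rewrite lee_fin mulr_ge0// cabs_ge0.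
by have /andP[_ ?] := cM k; rewrite -EFinM lee_fin mulrC ler_wpM2r// cabs_ge0.
Qed.

Lemma csq_csum_bounded (z : nat -> R[i]) (M : R) : (forall k, csq (z k) <= M) ->
  csummable (fun k => a k * z k) /\
  csq (csum (fun k => a k * z k)) <= 2 * abs_total ^+ 2 * M.
Proof.
move=> zM.
have le := @weighted_sum_le (fun k => csq (z k)) M.
have {}le : (\sum_(k <oo) (cabs (a k) * csq (z k))%:E <= (abs_total * M)%:E)%E.
  by apply: le => k; rewrite csq_ge0 zM.
have fin : (\sum_(k <oo) (cabs (a k) * csq (z k))%:E < +oo)%E by apply: le_lt_trans le (ltry _).
have [h1 h2] := csq_csum_weighted asum fin; split => //.
move: h2 le; rewrite abs_totalE.
set S := (\sum_(k <oo) (cabs (a k) * csq (z k))%:E)%E in fin *.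
have -> : S = (fine S)%:E.
  rewrite fineK// ge0_fin_numE// nneseries_ge0// => k _ _.
  by rewrite lee_fin mulr_ge0 ?cabs_ge0 ?csq_ge0.
rewrite -!EFinM !lee_fin => h2 le; apply: (le_trans h2).
by rewrite expr2 -!mulrA ler_wpM2l// ler_wpM2l ?abs_total_ge0.
Qed.

End WeightedSums.

(** * The Gabor system as a superposition of transforms of translated exponentials *)

Section Atoms.
Variable R : realType.
Notation mu := (@lebesgue_measure R).
Notation setTR := [set: measurableTypeR R].
Notation L2T := (L2on setTR).
Notation norm2 := (sqint setTR).
Variables (alpha w : R) (a : nat -> R[i]) (b : nat -> R).
Hypotheses (w0 : w < 0) (asum : csummable a).

(* [hat (atom mn k)] is, up to the constant [kap], the [k]-th term of [gabor mn]. *)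
Definition atom (mn : int * int) (k : nat) (x : R) : R[i] :=
  etail w (x - mn.1%:~R - b k) * cexpi (- (2 * pi * alpha * mn.2%:~R) * (x - mn.1%:~R)).

Definition kap : R[i] := (0 +i* (- (2 * pi)))%C.

Lemma csq_kap : csq kap = 4 * pi ^+ 2.
Proof. by rewrite /csq/=; ring. Qed.

Lemma kernelE (s : R) : (s%:C%C - 'i * w%:C%C)^-1 = kap * hat (etail w) s.
Proof.
have pi0 : pi != 0 :> R by rewrite gt_eqF// pi_gt0.
rewrite -complexiE.
have z0 : s%:C%C - 'i%C * w%:C%C != 0.
  apply/eqP => /(congr1 (@complex.Im R)).
  have -> : complex.Im (s%:C%C - 'i%C * w%:C%C) = - w by rewrite /=; ring.
  by move=> /eqP; rewrite oppr_eq0 lt_eqF.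
have y0 : (2 * pi * w +i* (2 * pi * s))%C != 0.
  by rewrite eq_complex/= mulf_eq0 negb_and (lt_eqF w0) orbF gt_eqF// mulr_gt0// pi_gt0.
apply: (mulfI z0); rewrite divff// hat_etail// mulrA; apply: (mulIf y0).
rewrite mulrN mulNr mulfVK// mul1r.
by apply: complex_eq => /=; ring.
Qed.

Lemma cmeas_atom mn k : cmeas setTR (atom mn k).
Proof.
apply: cmeasM.
  have := cmeas_shift (- mn.1%:~R - b k) measurableT (cmeas_etail w).
  by rewrite preshiftT; under eq_fun do rewrite addrA.
apply: cmeas_cexpi; apply: measurable_funM => //; exact: measurable_funB.
Qed.

Lemma norm2_atom mn k : norm2 (atom mn k) = norm2 (etail w).
Proof.
rewrite -[RHS](norm2_shift (- mn.1%:~R - b k) (cmeas_etail w)).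
by apply: eq_sqint => x _; rewrite /atom csqM csq_cexpi mulr1 addrA.
Qed.

Lemma L2_atom mn k : L2T (atom mn k).
Proof.
by split; [exact: cmeas_atom|rewrite norm2_atom; have [] := L2_etail w0].
Qed.

Lemma atom_integrable mn k : cintegrable setTR (atom mn k).
Proof.
apply: cintegrable_phase => //.
  by apply: measurable_funM => //; exact: measurable_funB.
have := cintegrable_shift (- mn.1%:~R - b k) measurableT (etail_integrable w0).
by rewrite preshiftT; under eq_fun do rewrite addrA.
Qed.

Lemma hat_atom mn k t : hat (atom mn k) t =
  cexpi (2 * pi * mn.1%:~R * t) * (cexpi (2 * pi * b k * (t - alpha * mn.2%:~R)) *
  hat (etail w) (t - alpha * mn.2%:~R)).
Proof.
set m : R := mn.1%:~R; set s := t - alpha * mn.2%:~R.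
have ie : cintegrable setTR (fun x => etail w x * cexpi (2 * pi * s * x)).
  by apply: cintegrable_phase (etail_integrable w0) => //; apply: measurable_funM.
rewrite mulrA /hat -cintZ//.
rewrite [LHS](cint_shift (m + b k) measurableT); last first.
  apply: cmeasM; first exact: cmeas_atom.
  by apply: cmeas_cexpi; exact: measurable_funM.
rewrite preshiftT; apply: eq_cint => x _.
rewrite /atom -/m (_ : x + (m + b k) - m - b k = x); last by ring.
rewrite -cexpiD -[LHS]mulrA -cexpiD [RHS]mulrCA -cexpiD; congr (_ * cexpi _).
by rewrite /s; ring.
Qed.

Lemma csummable_phase (t : nat -> R) : csummable (fun k => a k * cexpi (t k)).
Proof.
rewrite /csummable; under eq_eseriesr do rewrite cabsM cabs_cexpi mulr1.
exact: asum.
Qed.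

Lemma gaborE mn t : gabor (gfun a b w) alpha mn t =
  kap * csum (fun k => a k * hat (atom mn k) t).
Proof.
rewrite /gabor /gfun kernelE /Defs.Pfun; set s := t - _.
transitivity (kap * (cexpi (2 * pi * mn.1%:~R * t) * hat (etail w) s *
   csum (fun k => a k * cexpi (2 * pi * b k * s)))).
  have perm (x y z t' : R[i]) : x * (y * (z * t')) = z * (x * t' * y) by ring.
  exact: perm.
rewrite -csumZ; last exact: csummable_phase.
congr (_ * csum _); apply/funext => k; rewrite hat_atom -/s.
have perm (x y z t' : R[i]) : x * y * (z * t') = z * (x * (t' * y)) by ring.
exact: perm.
Qed.

Lemma csq_Pfun_le t : csq (Defs.Pfun a b t) <= 2 * abs_total a ^+ 2.
Proof.
rewrite -[leRHS]mulr1; apply: (csq_csum_bounded asum _).2 => k.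
by rewrite csq_cexpi.
Qed.

Lemma cmeas_Pfun : cmeas setTR (Defs.Pfun a b).
Proof.
apply: cmeas_csum => // k; apply: cmeasM; first exact: cmeas_cst.
by apply: cmeas_cexpi; apply: measurable_funM.
Qed.

(** [Pfun] is bounded because its coefficients are absolutely summable, and the kernel is square
    integrable; translation and modulation preserve both properties. *)
Lemma L2_gabor mn : L2T (gabor (gfun a b w) alpha mn).
Proof.
set m : R := mn.1%:~R; set c := alpha * mn.2%:~R.
rewrite (_ : gabor _ _ _ = fun t => (cexpi (2 * pi * m * t) * kap) *
   (Defs.Pfun a b (t - c) * hat (etail w) (t - c))); last first.
  have perm (x y z t' : R[i]) : x * (y * (z * t')) = x * z * (y * t') by ring.
  by apply/funext => t; rewrite /gabor /gfun kernelE; exact: perm.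
apply: (@L2onM_bounded _ _ _ _ (4 * pi ^+ 2)) => //.
- apply: cmeasM; last exact: cmeas_cst.
  by apply: cmeas_cexpi; apply: measurable_funM.
- by move=> t _; rewrite csqM csq_cexpi mul1r csq_kap.
apply: (@L2_shift _ (- c) (fun t => Defs.Pfun a b t * hat (etail w) t)).
apply: (@L2onM_bounded _ _ _ _ (2 * abs_total a ^+ 2)) => //.
- exact: cmeas_Pfun.
- by move=> t _; exact: csq_Pfun_le.
- exact: L2_hat_etail.
Qed.

(* Bilinear pairings; the conjugation in [inner] is moved onto f in [csq_inner_fgabor]. *)
Definition fgabor (mn : int * int) (f : R -> R[i]) : R[i] :=
  cint setTR (fun t => f t * gabor (gfun a b w) alpha mn t).

Definition fatom (mn : int * int) (F : R -> R[i]) : R[i] :=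
  csum (fun k => a k * cint setTR (fun x => F x * atom mn k x)).

Lemma fgaborB mn f g : L2T f -> L2T g ->
  fgabor mn (fun x => f x - g x) = fgabor mn f - fgabor mn g.
Proof.
move=> f2 g2; have h2 := L2_gabor mn.
rewrite /fgabor -cintB//; [|exact: cintegrable_mulL2|exact: cintegrable_mulL2].
by apply: eq_cint => x _; rewrite mulrBl.
Qed.

Lemma fgabor_bounded mn : exists M : R, forall f, L2T f ->
  ((csq (fgabor mn f))%:E <= M%:E * norm2 f)%E.
Proof.
have h2 := L2_gabor mn.
exists (2 * fine (norm2 (gabor (gfun a b w) alpha mn))) => f f2.
have := CauchySchwarz_cint measurableT f2 h2.
by rewrite (L2T_fin f2) (L2T_fin h2) -!EFinM mulrAC mulrA.
Qed.

Lemma fatom_term_le mn k F : L2T F ->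
  csq (cint setTR (fun x => F x * atom mn k x)) <= 2 * (fine (norm2 F) * fine (norm2 (etail w))).
Proof.
move=> F2; have := CauchySchwarz_cint measurableT F2 (L2_atom mn k).
by rewrite norm2_atom (L2T_fin F2) (L2T_fin (L2_etail w0)) -!EFinM lee_fin.
Qed.

Lemma fatom_summable mn F : L2T F ->
  csummable (fun k => a k * cint setTR (fun x => F x * atom mn k x)).
Proof. by move=> F2; apply: (csq_csum_bounded asum _).1 => k; exact: fatom_term_le. Qed.

Lemma fatomB mn f g : L2T f -> L2T g ->
  fatom mn (fun x => f x - g x) = fatom mn f - fatom mn g.
Proof.
move=> f2 g2; rewrite /fatom -csumB; [|exact: fatom_summable|exact: fatom_summable].
congr csum; apply/funext => k.
rewrite -mulrBr -cintB//; last 2 first.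
- exact: cintegrable_mulL2 (L2_atom _ _).
- exact: cintegrable_mulL2 (L2_atom _ _).
by congr (_ * _); apply: eq_cint => x _; rewrite mulrBl.
Qed.

Lemma fatom_bounded mn : exists M : R, forall f, L2T f ->
  ((csq (fatom mn f))%:E <= M%:E * norm2 f)%E.
Proof.
exists (2 * abs_total a ^+ 2 * (2 * fine (norm2 (etail w)))) => f f2.
rewrite (L2T_fin f2) -EFinM lee_fin.
have := (csq_csum_bounded asum (fun k => fatom_term_le mn k f2)).2.
by move=> /le_trans; apply; rewrite -!mulrA [fine _ * fine _]mulrC.
Qed.

Lemma cabs_hat_etail_le t : cabs (hat (etail w) t) <= Num.sqrt (1 + w^-1 ^+ 2).
Proof.
rewrite /cabs ler_sqrt ?addr_ge0 ?sqr_ge0//; apply: (le_trans (csq_hat_etail w0 t)).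
by rewrite ler_piMr ?addr_ge0 ?sqr_ge0// oneDsqrV_le1.
Qed.

(** The transforms of the atoms differ from translates of [hat (etail w)] by unimodular factors, so
    they share the bound [M]. Together with integrability of f this justifies taking the series out
    of the integral, and the multiplication formula then moves the transform onto f. *)
Lemma fgabor_fatom mn f : L2T f -> cintegrable setTR f ->
  fgabor mn f = kap * fatom mn (hat f).
Proof.
move=> [mf _] fi; set M := Num.sqrt (1 + w^-1 ^+ 2).
pose u k t := a k * (f t * hat (atom mn k) t).
have mh k : cmeas setTR (hat (atom mn k)) by apply: cmeas_hat; exact: cmeas_atom.
have mu_ k : cmeas setTR (u k) by apply: cmeasZ; exact: cmeasM.
have fle := cintegrable_lty measurableT fi.
set I := (\int[mu]_x (cabs (f x))%:E)%E in fle.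
have I0 : (0 <= I)%E by apply: integral_ge0 => x _; rewrite lee_fin cabs_ge0.
have IE : I = (fine I)%:E by rewrite fineK// ge0_fin_numE.
have ule : (\sum_(k <oo) \int[mu]_x (cabs (u k x))%:E < +oo)%E.
  apply: (@le_lt_trans _ _ (\sum_(k <oo) (cabs (a k) * (M * fine I))%:E)%E).
    apply: lee_nneseries => [k _ _|k _].
      by apply: integral_ge0 => x _; rewrite lee_fin cabs_ge0.
    rewrite mulrA EFinM -IE /I -ge0_integralZl//; last 3 first.
    - by apply/measurable_EFinP; exact: cmeas_cabs.
    - by move=> x _; rewrite lee_fin cabs_ge0.
    - by rewrite lee_fin mulr_ge0 ?cabs_ge0// sqrtr_ge0.
    apply: ge0_le_integral => //.
    - by move=> x _; rewrite lee_fin cabs_ge0.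
    - by apply/measurable_EFinP; exact: cmeas_cabs.
    - by apply: emeasurable_funM => //; apply/measurable_EFinP; exact: cmeas_cabs.
    move=> x _; rewrite -EFinM lee_fin /u !cabsM hat_atom !cabsM !cabs_cexpi !mul1r -mulrA.
    rewrite ler_wpM2l ?cabs_ge0// mulrC ler_wpM2r ?cabs_ge0//.
    exact: cabs_hat_etail_le.
  apply: (@le_lt_trans _ _ (abs_total a * (M * fine I))%:E); last exact: ltry.
  by apply: weighted_sum_le => // k; rewrite lexx andbT mulr_ge0 ?sqrtr_ge0// fine_ge0.
have [_ ci cE] := csum_integral measurableT mu_ ule.
rewrite /fgabor /fatom.
transitivity (cint setTR (fun t => kap * csum (u ^~ t))).
  apply: eq_cint => t _; rewrite gaborE mulrCA; congr (_ * _).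
  rewrite -csumZ.
    by congr csum; apply/funext => k; rewrite /u mulrCA.
  apply: (csq_csum_bounded asum (M := 1 + w^-1 ^+ 2) _).1 => k.
  rewrite hat_atom !csqM !csq_cexpi !mul1r; apply: (le_trans (csq_hat_etail w0 _)).
  by rewrite ler_piMr ?addr_ge0 ?sqr_ge0// oneDsqrV_le1.
rewrite cintZ// cE; congr (_ * csum _); apply/funext => k.
rewrite cintZ//; last first.
  rewrite (_ : (fun x => f x * _) = fun x => hat (atom mn k) x * f x); last first.
    by apply/funext => x; rewrite mulrC.
  apply: (@cintegrableM_bounded _ _ _ _ (Num.sqrt (1 + w^-1 ^+ 2))) => // x _.
  rewrite sqr_sqrtr ?addr_ge0 ?sqr_ge0//.
  rewrite hat_atom !csqM !csq_cexpi !mul1r; apply: (le_trans (csq_hat_etail w0 _)).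
  by rewrite ler_piMr ?addr_ge0 ?sqr_ge0// oneDsqrV_le1.
congr (_ * _); rewrite hat_swap//; last exact: atom_integrable.
by apply: eq_cint => x _; rewrite mulrC.
Qed.

End Atoms.

(** * Folding a window of one period onto the base interval *)

Section Periodization.
Variable R : realType.
Notation mu := (@lebesgue_measure R).
Notation setTR := [set: measurableTypeR R].

Lemma cintegrable_restrict (D : set (measurableTypeR R)) (f : R -> R[i]) : measurable D ->
  cintegrable D f -> cintegrable setTR (fun x => if x \in D then f x else 0).
Proof.
move=> mD [/(integrable_mkcond _ mD) fr /(integrable_mkcond _ mD) fi]; split.
  move: fr; apply: eq_integrable => // x _; rewrite patchE; by case: ifP.
move: fi; apply: eq_integrable => // x _; rewrite patchE; by case: ifP.
Qed.

Lemma cmeas_if_lt (D : set (measurableTypeR R)) (c : R) (f g : R -> R[i]) : measurable D ->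
  cmeas D f -> cmeas D g -> cmeas D (fun x => if c < x then f x else g x).
Proof.
have mlt : measurable_fun D (fun x : R => c < x) by exact: measurable_fun_ltr.
move=> mD [fr fi] [gr gi]; split.
  rewrite (_ : (fun x => _) = fun x => if c < x then complex.Re (f x) else complex.Re (g x)); last first.
    by apply/funext => x; case: ifP.
    apply: measurable_fun_if => //.
  - by apply: measurable_funS fr => // x [].
  - by apply: measurable_funS gr => // x [].
rewrite (_ : (fun x => _) = fun x => if c < x then complex.Im (f x) else complex.Im (g x)); last first.
  by apply/funext => x; case: ifP.
  apply: measurable_fun_if => //.
  - by apply: measurable_funS fi => // x [].
  - by apply: measurable_funS gi => // x [].
Qed.

(** The point (N + 1)p cuts the window in two. Translating the left piece by -Np gives ]bs, p], and
    translating the right piece by -(N + 1)p gives ]0, bs]: these are the two branches of the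
    circular shift. *)
Lemma cint_fold_period (p bs N : R) (K : R -> R[i]) : 0 <= bs < p ->
  cintegrable setTR K ->
  cint `]bs + N * p, bs + N * p + p] K =
  cint `]0, p] (fun x => if bs < x then K (x + N * p) else K (x + (N + 1) * p)).
Proof.
move=> /andP[bs0 bsp] iK; set b := bs + N * p; set M := (N + 1) * p.
pose U : set (measurableTypeR R) := `]b, M]; pose V : set (measurableTypeR R) := `]M, b + p].
have bM : b <= M by rewrite /b /M; lra.
have Mb : M <= b + p by rewrite /b /M; lra.
have iU : cintegrable setTR (fun x => if x \in U then K x else 0).
  by apply: cintegrable_restrict; [exact: measurable_itv|apply: cintegrableS iK => //; exact: measurable_itv].
have iV : cintegrable setTR (fun x => if x \in V then K x else 0).
  by apply: cintegrable_restrict; [exact: measurable_itv|apply: cintegrableS iK => //; exact: measurable_itv].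
have split_ : cint `]b, b + p] K = cint setTR (fun x => if x \in U then K x else 0) +
                             cint setTR (fun x => if x \in V then K x else 0).
  rewrite -cintD// cint_mkcond; apply: eq_cint => x _.
  rewrite /U /V !mem_setE !in_itv/=.
  have [xb|xb] := leP x b.
    by rewrite [M < x]ltNge (le_trans xb bM)/= addr0.
  have [xM|xM] := leP x M; first by rewrite (le_trans xM Mb)/= addr0.
  by rewrite /= add0r.
rewrite split_ (cint_shift (N * p) measurableT (cintegrable_cmeas iU)).
rewrite [X in _ + X](cint_shift M measurableT (cintegrable_cmeas iV)) !preshiftT.
rewrite -cintD//; last 2 first.
- by have := cintegrable_shift (N * p) measurableT iU; rewrite preshiftT.
- by have := cintegrable_shift M measurableT iV; rewrite preshiftT.
rewrite [RHS]cint_mkcond; apply: eq_cint => x _.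
rewrite /U /V !mem_setE !in_itv/= -/M.
rewrite ltrD2r (_ : (x + N * p <= M) = (x <= p)); last first.
  by rewrite /M mulrDl mul1r addrC lerD2l.
rewrite (_ : (M < x + M) = (0 < x)); last by rewrite ltrDr.
rewrite (_ : (x + M <= b + p) = (x <= bs)); last first.
  by rewrite /M /b mulrDl mul1r addrA addrAC -[bs + _ + p]addrA [_ * _ + p]addrC addrA lerD2r lerD2r.
have [xbs|xbs] := ltP bs x.
  by rewrite /= andbF addr0 (le_lt_trans bs0 xbs).
by rewrite add0r andbT (le_trans xbs (ltW bsp)) andbT.
Qed.

Lemma cabs_le_1csq (z : R[i]) : cabs z <= 1 + csq z.
Proof. by rewrite -sqr_cabs; have := sqr_ge0 (cabs z - 1); have := sqr_ge0 (cabs z); nra. Qed.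

Lemma esumZl_int (c : R) (f : int -> \bar R) : 0 <= c -> (forall z, (0 <= f z)%E) ->
  (\esum_(z in [set: int]) (c%:E * f z) = c%:E * \esum_(z in [set: int]) f z)%E.
Proof.
move=> c0 f0; rewrite !esum_int//; last by move=> z; rewrite mule_ge0// lee_fin.
by rewrite nneseriesZl.
Qed.

Lemma esum_int_opp (f : int -> \bar R) : (forall z, (0 <= f z)%E) ->
  (\esum_(z in [set: int]) f (- z)%R = \esum_(z in [set: int]) f z)%E.
Proof.
move=> f0; rewrite [RHS](reindex_esum [set: int] [set: int] -%R f)//.
Qed.

Lemma esum_int2 (f : int * int -> \bar R) : (forall z, (0 <= f z)%E) ->
  (\esum_(z in [set: int * int]) f z =
   \esum_(m in [set: int]) \esum_(n in [set: int]) f (m, n))%E.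
Proof.
move=> f0; rewrite (@esum_esum _ _ _ _ (fun=> [set: int]) (fun m n => f (m, n)))//.
rewrite (_ : setT `*`` _ = setT); first by apply: eq_esum => -[].
by apply/seteqP; split.
Qed.

End Periodization.

(** * The operators A_k *)

Section GaborIdentity.
Variable R : realType.
Notation mu := (@lebesgue_measure R).
Notation setTR := [set: measurableTypeR R].
Notation L2T := (L2on setTR).
Notation norm2 := (sqint setTR).
Variables (alpha w : R) (a : nat -> R[i]) (b : nat -> R).
Hypotheses (alpha0 : 0 < alpha) (w0 : w < 0) (asum : csummable a).

Let p := alpha^-1.
Let p0 : 0 < p. Proof. by rewrite invr_gt0. Qed.
Let I : set (measurableTypeR R) := `[0, p].
Let mI : measurable I. Proof. exact: measurable_itv. Qed.
Let q := expR (2 * pi * w * p).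

Let piw0 : 2 * pi * w < 0.
Proof. by rewrite nmulr_llt0// mulr_gt0// pi_gt0. Qed.

Lemma shift_ratio_lt1 : q < 1.
Proof. by rewrite /q -[ltRHS]expR0 ltr_expR nmulr_rlt0. Qed.

Lemma rmod_range (x : R) : 0 <= rmod x p < p.
Proof.
rewrite /rmod; have /andP[h1 h2] := real_floor_itv (num_real (x / p)).
move: h1 h2; rewrite ler_pdivlMr// ltr_pdivrMr// intrD mulrDl mul1r.
by rewrite [p * _]mulrC => h1 h2; apply/andP; split; lra.
Qed.

Variable G : R -> R[i].
Hypothesis G2 : L2T G.

Definition aterm (m : int) (k : nat) (x : R) : R[i] :=
  Aop alpha w (rmod (b k) alpha^-1) (fun s => G (s + m%:~R + b k)) x.

Definition asumfun (m : int) (x : R) : R[i] := csum (fun k => a k * aterm m k x).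

Definition eweight (x : R) : R[i] := (expR (2 * pi * w * x))%:C%C.

Lemma L2_shift2 (c d : R) : L2T (fun x => G (x + c + d)).
Proof. by have := L2_shift (c + d) G2; under eq_fun do rewrite addrA. Qed.

Lemma cmeas_aterm (D : set (measurableTypeR R)) m k : measurable D -> cmeas D (aterm m k).
Proof.
have [m2 _] := L2_shift2 m%:~R (b k).
move=> mD; apply: cmeas_if_lt => //.
  apply: cmeasZ; apply: cmeasTS.
  by have := cmeas_shift (- rmod (b k) alpha^-1) measurableT m2; rewrite preshiftT.
apply: cmeasZ; apply: cmeasTS.
have := cmeas_shift (- rmod (b k) alpha^-1 + p) measurableT m2; rewrite preshiftT.
by under eq_fun do rewrite addrA.
Qed.

(* etail (x + p - b) = q etail (x - b) for x > b and the phase is p-periodic, so the two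
   terms of [tdiff] cancel except on one period. *)
Lemma cint_tdiff_atom (mn : int * int) k :
  cint setTR (fun x => tdiff q p G x * atom alpha w b mn k x) =
  cint I (fun x => eweight x * aterm mn.1 k x * cexpi (2 * pi / p * (- mn.2)%:~R * x)).
Proof.
set m : R := mn.1%:~R; set c : R := - (2 * pi * alpha * mn.2%:~R).
set bs := rmod (b k) p; pose N : R := (Num.floor (b k / p))%:~R.
have bE : b k = bs + N * p by rewrite /bs /rmod [p * _]mulrC subrK.
have bsr : 0 <= bs < p by exact: rmod_range.
have T2 : L2T (tdiff q p G) by exact: L2_tdiff.
pose K y := G (y + m) * (etail w (y - b k) * cexpi (c * y)).
have e2 : L2T (fun y => etail w (y - b k) * cexpi (c * y)).
  rewrite (_ : (fun y => _) = fun y => cexpi (c * y) * etail w (y - b k)); last first.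
    by apply/funext => y; rewrite mulrC.
  apply: (@L2onM_bounded _ _ _ _ 1) => //.
  - by apply: cmeas_cexpi; exact: measurable_funM.
  - by move=> y _; rewrite csq_cexpi.
  - exact: (L2_shift (- b k) (L2_etail w0)).
have iK : cintegrable setTR K by apply: cintegrable_mulL2 => //; exact: L2_shift.
rewrite (cint_shift m measurableT); last first.
  by have [mT _] := T2; apply: cmeasM => //; exact: cmeas_atom.
rewrite preshiftT.
pose K' y := if y \in (`]b k + p, +oo[%classic : set (measurableTypeR R)) then K y else 0.
have iK' : cintegrable setTR K'.
  by apply: cintegrable_restrict => //; exact: cintegrableS iK.
have cp (y : R) : cexpi (c * (y + p)) = cexpi (c * y).
  rewrite mulrDr cexpiD (_ : c * p = 2 * pi * (- mn.2)%:~R) ?cexpi_2piz ?mulr1//.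
  by rewrite /c /p mulrNz; field; rewrite gt_eqF.
have step y : tdiff q p G (y + m) * atom alpha w b mn k (y + m) = K y - K' (y + p).
  rewrite /K' /K /atom /tdiff -/m addrK -/c mem_setE in_itv/= andbT ltrD2r cp.
  rewrite mulrBl; congr (_ - _); have [yb|yb] := ltP (b k) y.
    rewrite !etail_pos ?subr_gt0//; last by lra.
    rewrite (_ : 2 * pi * w * (y + p - b k) = 2 * pi * w * p + 2 * pi * w * (y - b k)); last by ring.
    rewrite expRD real_complexM -/q addrAC.
    have perm (z1 z2 z3 z4 : R[i]) : z1 * z2 * (z3 * z4) = z2 * (z1 * z3 * z4) by ring.
    exact: perm.
  by rewrite [etail w (y - b k)]etail_neg ?subr_le0// mul0r mulr0.
have -> : cint setTR (fun x => tdiff q p G (x + m) * atom alpha w b mn k (x + m)) =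
          cint `]b k, b k + p] K.
  rewrite (eq_cint (g := fun y => K y - K' (y + p))); last by move=> y _; exact: step.
  rewrite cintB//; last by have := cintegrable_shift p measurableT iK'; rewrite preshiftT.
  have := cint_shift p measurableT (cintegrable_cmeas iK'); rewrite preshiftT => <-.
  rewrite -cintB// [RHS]cint_mkcond; apply: eq_cint => y _.
  rewrite /K' !mem_setE !in_itv/= andbT.
  have [yb|yb] := ltP (b k) y.
    by have [yp|yp] := leP y (b k + p); rewrite ?subr0 ?subrr.
  rewrite /= ltNge (le_trans yb)/= ?subr0 ?lerDl ?(ltW p0)//.
  by rewrite /K etail_neg ?mul0r ?mulr0// subr_le0.
rewrite [in LHS]bE cint_fold_period// -/bs.
pose Lf x := eweight x * aterm mn.1 k x * cexpi (c * x).
have mL (D : set (measurableTypeR R)) : measurable D -> cmeas D Lf.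
  move=> mD; apply: cmeasM; last by apply: cmeas_cexpi; exact: measurable_funM.
  apply: cmeasM; last exact: cmeas_aterm.
  by apply: cmeas_real; exact: measurable_expRM.
transitivity (cint I Lf); last first.
  apply: eq_cint => x _; rewrite /Lf; congr (_ * cexpi (_ * x)).
  by rewrite /c /p mulrNz; field; rewrite gt_eqF.
rewrite /I -cint_itv_obnd_cbnd; last exact: mL.
apply: eq_cint => x; rewrite /= in_itv/= => /andP[x0 xp].
have cN (M : int) : cexpi (c * (x + M%:~R * p)) = cexpi (c * x).
  rewrite mulrDr cexpiD (_ : c * (M%:~R * p) = 2 * pi * (- mn.2 * M)%:~R) ?cexpi_2piz ?mulr1//.
  by rewrite /c /p intrM mulrNz; field; rewrite gt_eqF.
have perm (z1 z2 z3 z4 z5 : R[i]) : z2 = z3 * z4 -> z1 * (z2 * z5) = z3 * (z4 * z1) * z5 by move=> ->; ring.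
(* The prefactors of [Aop] appear here: after folding, the argument of [etail] is x - bs on the
   first branch and x - (bs - p) on the second, and its exponential splits as [eweight x] times the
   corresponding prefactor. *)
rewrite /Lf /aterm /Aop -/p -/bs -/m /K /eweight; case: ifPn => [bx|].
  rewrite cN etail_pos; last by rewrite bE; lra.
  rewrite (_ : x - bs + m + b k = x + N * p + m); last by rewrite bE; ring.
  apply: perm; rewrite -real_complexM -expRD; congr (expR _)%:C%C.
  by rewrite bE; ring.
rewrite -leNgt => xb.
rewrite (_ : N + 1 = (Num.floor (b k / p) + 1)%:~R); last by rewrite intrD.
rewrite cN intrD -/N etail_pos; last by rewrite bE; lra.
rewrite (_ : x - bs + p + m + b k = x + (N + 1) * p + m); last by rewrite bE; ring.
apply: perm; rewrite -real_complexM -expRD; congr (expR _)%:C%C.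
by rewrite bE; ring.
Qed.

Let normG := fine (norm2 G).
Let normG_ge0 : 0 <= normG. Proof. by rewrite fine_ge0// sqint_ge0. Qed.

Definition aterm_cst : R := 2 * expR (- (2 * pi * w * p)) ^+ 2.

Lemma aterm_cst_ge0 : 0 <= aterm_cst.
Proof. by rewrite /aterm_cst mulr_ge0// sqr_ge0. Qed.

(** Both prefactors are at most e^{-2 pi w p} and both branches evaluate translates of G. Bounding
    each branch by its norm over the whole line costs a factor 2 but gives a constant independent of
    m and k, as the summation over k demands. *)
Lemma sqint_aterm m k : (sqint I (aterm m k) <= (aterm_cst * normG)%:E)%E.
Proof.
set bs := rmod (b k) p; have /andP[bs0 bsp] : 0 <= bs < p := rmod_range (b k).
set E := expR (- (2 * pi * w * p)).
pose f s := G (s + m%:~R + b k); have f2 : L2T f := L2_shift2 m%:~R (b k).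
have nf : norm2 f = normG%:E.
  rewrite /normG -(L2T_fin G2) -(norm2_shift (m%:~R + b k) G2.1).
  by apply: eq_sqint => x _; rewrite addrA.
pose f1 x := f (x - bs); pose f3 x := f (x - bs + p).
have f12 : L2T f1 by exact: (L2_shift (- bs) f2).
have f32 : L2T f3.
  by have := L2_shift (- bs + p) f2; under eq_fun do rewrite addrA.
have n1 : norm2 f1 = normG%:E by rewrite -nf -(norm2_shift (- bs) f2.1).
have n3 : norm2 f3 = normG%:E.
  by rewrite -nf -(norm2_shift (- bs + p) f2.1); apply: eq_sqint => x _; rewrite addrA.
have E1 : expR (- (2 * pi * w * bs)) <= E.
  by rewrite ler_expR lerN2 ler_nM2l// ltW.
have E2 : expR (- (2 * pi * w * (bs - p))) <= E.
  rewrite ler_expR lerN2 ler_nM2l//; lra.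
have pw x : csq (aterm m k x) <= E ^+ 2 * csq (f1 x) + E ^+ 2 * csq (f3 x).
  have sqE (e : R) : 0 <= e -> e <= E -> e ^+ 2 <= E ^+ 2.
    by move=> e0 eE; rewrite ler_sqr ?nnegrE ?expR_ge0.
  rewrite /aterm /Aop -/p -/bs -/(f _) -/(f (x - bs + p)); case: ifP => _; rewrite csqM csq_real.
    apply: ler_wpDr; first by rewrite mulr_ge0 ?csq_ge0// sqr_ge0.
    by rewrite ler_wpM2r ?csq_ge0// sqE// expR_ge0.
  apply: ler_wpDl; first by rewrite mulr_ge0 ?csq_ge0// sqr_ge0.
  by rewrite ler_wpM2r ?csq_ge0// sqE// expR_ge0.
have E20 : (0 <= (E ^+ 2)%:E)%E by rewrite lee_fin sqr_ge0.
have part h : L2T h -> norm2 h = normG%:E ->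
    (\int[mu]_(x in I) ((E ^+ 2)%:E * (csq (h x))%:E) <= (E ^+ 2 * normG)%:E)%E.
  move=> [mh _] nh; rewrite ge0_integralZl//; last 2 first.
  - by apply: cmeas_csqE; exact: cmeasTS.
  - by move=> x _; rewrite lee_fin csq_ge0.
  by rewrite [leRHS]EFinM; apply: lee_wpmul2l => //; rewrite -nh; exact: sqintS.
apply: (@le_trans _ _ (\int[mu]_(x in I) ((E ^+ 2)%:E * (csq (f1 x))%:E + (E ^+ 2)%:E * (csq (f3 x))%:E))%E).
  apply: ge0_le_integral => //.
  - by move=> x _; rewrite lee_fin csq_ge0.
  - by apply: cmeas_csqE; exact: cmeas_aterm.
  - apply: emeasurable_funD; apply: emeasurable_funM => //; apply: cmeas_csqE; apply: cmeasTS.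
      by case: f12.
    by case: f32.
  - by move=> x _; rewrite -!EFinM -EFinD lee_fin.
rewrite ge0_integralD//; last 4 first.
- by move=> x _; rewrite -EFinM lee_fin mulr_ge0 ?csq_ge0// sqr_ge0.
- by apply: emeasurable_funM => //; apply: cmeas_csqE; apply: cmeasTS; case: f12.
- by move=> x _; rewrite -EFinM lee_fin mulr_ge0 ?csq_ge0// sqr_ge0.
- by apply: emeasurable_funM => //; apply: cmeas_csqE; apply: cmeasTS; case: f32.
apply: (le_trans (leeD (part _ f12 n1) (part _ f32 n3))).
by rewrite -EFinD lee_fin /aterm_cst -/E -mulrDl -mulr2n mulr_natl.
Qed.

Lemma cmeas_asumfun (D : set (measurableTypeR R)) m : measurable D -> cmeas D (asumfun m).
Proof.
by move=> mD; apply: cmeas_csum => // k; apply: cmeasZ; exact: cmeas_aterm.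
Qed.

Lemma sum_sqint_aterm m :
  (\sum_(k <oo) \int[mu]_(x in I) (cabs (a k) * csq (aterm m k x))%:E < +oo)%E.
Proof.
apply: (@le_lt_trans _ _ (abs_total a * (aterm_cst * normG))%:E); last exact: ltry.
apply: le_trans (weighted_sum_le asum (c := fun=> aterm_cst * normG) _); last first.
  by move=> k; rewrite lexx andbT mulr_ge0// aterm_cst_ge0.
apply: lee_nneseries => [k _ _|k _].
  by apply: integral_ge0 => x _; rewrite lee_fin mulr_ge0 ?cabs_ge0 ?csq_ge0.
under eq_integral do rewrite EFinM.
rewrite ge0_integralZl ?lee_fin ?cabs_ge0//; last 2 first.
- by apply: cmeas_csqE; exact: cmeas_aterm.
- by move=> x _; rewrite lee_fin csq_ge0.
by rewrite [leRHS]EFinM; apply: lee_wpmul2l; [rewrite lee_fin cabs_ge0|exact: sqint_aterm].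
Qed.

(** The weighted Cauchy-Schwarz inequality bounds the squared modulus, at almost every point, by a
    constant times the sum of the |a_k||t_k|^2, where t_k is the k-th [aterm]; that sum is
    integrable by the uniform bound on the terms. *)
Lemma L2_asumfun m : L2on I (asumfun m).
Proof.
have mt k := cmeas_aterm m k mI.
split; first exact: cmeas_asumfun.
pose v k x := cabs (a k) * csq (aterm m k x).
have v0 k x : 0 <= v k x by rewrite mulr_ge0 ?cabs_ge0 ?csq_ge0.
have mv k : measurable_fun I (v k) by apply: measurable_funM => //; exact: cmeas_csq.
have vS : (\sum_(k <oo) \int[mu]_(x in I) `|v k x|%:E < +oo)%E.
  apply: le_lt_trans (sum_sqint_aterm m).
  apply: lee_nneseries => [k _ _|k _]; first exact: integral_ge0.
  by under eq_integral do rewrite ger0_norm//.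
have := abs_sum_integrable mI mv vS; set S := fun x => _ => iS.
have aeS := ae_abs_summable mI mv vS.
have mS := measurable_int _ iS.
have S0 x : (0 <= S x)%E by apply: nneseries_ge0.
have fin := integrable_lty mI iS.
apply: (@le_lt_trans _ _ (\int[mu]_(x in I) ((2 * abs_total a)%:E * S x))%E).
  apply: ae_ge0_le_integral => //.
  - by move=> x _; rewrite lee_fin csq_ge0.
  - by apply: cmeas_csqE; exact: cmeas_asumfun.
  - by move=> x _; rewrite mule_ge0// lee_fin mulr_ge0 ?abs_total_ge0.
  - exact: emeasurable_funM.
  apply: filterS aeS => x /[apply] Sx.
  have E : S x = (\sum_(k <oo) (cabs (a k) * csq (aterm m k x))%:E)%E.
    by apply: eq_eseriesr => k _; rewrite ger0_norm.
  rewrite -/(S x) E in Sx.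
  have [_ le] := csq_csum_weighted asum Sx.
  apply: (le_trans le); rewrite E (abs_totalE asum) EFinM -muleA.
  exact: lexx.
rewrite ge0_integralZl//; last by rewrite lee_fin mulr_ge0 ?abs_total_ge0.
by rewrite lte_mul_pinfty ?lee_fin ?mulr_ge0 ?abs_total_ge0.
Qed.

Lemma ae_eq_cint (D : set (measurableTypeR R)) (f g : R -> R[i]) : measurable D ->
  cmeas D f -> cmeas D g -> {ae mu, forall x, D x -> f x = g x} -> cint D f = cint D g.
Proof.
move=> mD [fr fi] [gr gi] fg; rewrite /cint /Rintegral; congr (fine _ +i* fine _)%C;
  apply: ae_eq_integral => //; try exact/measurable_EFinP;
  by apply: filterS fg => x /[apply] ->.
Qed.

Lemma ae_csummable_aterm m : {ae mu, forall x, I x -> csummable (fun k => a k * aterm m k x)}.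
Proof.
have mt k := cmeas_aterm m k mI.
pose v k x := cabs (a k) * csq (aterm m k x).
have v0 k x : 0 <= v k x by rewrite mulr_ge0 ?cabs_ge0 ?csq_ge0.
have mv k : measurable_fun I (v k) by apply: measurable_funM => //; exact: cmeas_csq.
have vS : (\sum_(k <oo) \int[mu]_(x in I) `|v k x|%:E < +oo)%E.
  apply: le_lt_trans (sum_sqint_aterm m).
  apply: lee_nneseries => [k _ _|k _]; first exact: integral_ge0.
  by under eq_integral do rewrite ger0_norm//.
have := ae_abs_summable mI mv vS.
apply: filterS => x /[apply] Sx.
have E : (\sum_(k <oo) `|v k x|%:E = \sum_(k <oo) (cabs (a k) * csq (aterm m k x))%:E)%E.
  by apply: eq_eseriesr => k _; rewrite ger0_norm.
rewrite E in Sx.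
exact: (csq_csum_weighted asum Sx).1.
Qed.

(** The period formula for each atom is summed over k under the integral. Domination uses |t| <= 1 +
    |t|^2 and the finite length of [I]; since the series is only known to converge almost
    everywhere, factoring out the weight and the phase is an almost everywhere identity. *)
Lemma fatom_tdiff mn : fatom alpha w a b mn (tdiff q p G) =
  cint I (fun x => eweight x * asumfun mn.1 x * cexpi (2 * pi / p * (- mn.2)%:~R * x)).
Proof.
have muI : (mu I <= p%:E)%E by rewrite /I lebesgue_measure_itv/= lte_fin p0 oppr0 addr0.
pose ph x := cexpi (2 * pi / p * (- mn.2)%:~R * x).
have mt k := cmeas_aterm mn.1 k mI.
have mph : cmeas I ph by apply: cmeas_cexpi; exact: measurable_funM.
have me : cmeas I eweight by apply: cmeas_real; exact: measurable_expRM.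
have e1 x : I x -> cabs (eweight x) <= 1.
  rewrite /I/= in_itv/= => /andP[x0 _]; rewrite cabs_real ger0_norm ?expR_ge0//.
  by rewrite -[leRHS]expR0 ler_expR nmulr_rle0.
pose u k x := a k * (eweight x * aterm mn.1 k x * ph x).
have mu_ k : cmeas I (u k) by apply: cmeasZ; apply: cmeasM => //; exact: cmeasM.
have tb k x : I x -> cabs (eweight x * aterm mn.1 k x * ph x) <= 1 + csq (aterm mn.1 k x).
  move=> Ix; rewrite !cabsM cabs_cexpi mulr1; apply: le_trans (cabs_le_1csq _).
  by rewrite ler_piMl ?cabs_ge0// e1.
have it k : cintegrable I (fun x => eweight x * aterm mn.1 k x * ph x).
  apply: cintegrable_mulL2 => //.
    apply: (@L2onM_bounded _ _ _ _ 1) => //.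
      by move=> x Ix; rewrite -sqr_cabs expr_le1 ?cabs_ge0 ?e1.
    split => //; apply: (le_lt_trans (sqint_aterm _ _)); exact: ltry.
  split => //; rewrite /sqint; under eq_integral do rewrite csq_cexpi.
  rewrite integral_cst// mul1e; apply: (le_lt_trans _ (ltry p)).
  exact: muI.
have ule : (\sum_(k <oo) \int[mu]_(x in I) (cabs (u k x))%:E < +oo)%E.
  apply: (@le_lt_trans _ _ (abs_total a * (p + aterm_cst * normG))%:E); last exact: ltry.
  apply: le_trans (weighted_sum_le asum (c := fun=> p + aterm_cst * normG) _); last first.
    by move=> k; rewrite lexx andbT addr_ge0 ?(ltW p0)// mulr_ge0 ?aterm_cst_ge0.
  apply: lee_nneseries => [k _ _|k _].
    by apply: integral_ge0 => x _; rewrite lee_fin cabs_ge0.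
  under eq_integral do rewrite cabsM EFinM.
  rewrite ge0_integralZl ?lee_fin ?cabs_ge0//; last 2 first.
  - by apply/measurable_EFinP; apply: cmeas_cabs; apply: cmeasM => //; exact: cmeasM.
  - by move=> x _; rewrite lee_fin cabs_ge0.
  rewrite [leRHS]EFinM; apply: lee_wpmul2l; first by rewrite lee_fin cabs_ge0.
  apply: (@le_trans _ _ (\int[mu]_(x in I) (1 + (csq (aterm mn.1 k x))%:E))%E).
    apply: ge0_le_integral => //.
    - by move=> x _; rewrite lee_fin cabs_ge0.
    - by apply/measurable_EFinP; apply: cmeas_cabs; apply: cmeasM => //; exact: cmeasM.
    - by apply: emeasurable_funD => //; exact: cmeas_csqE.
    - by move=> x Ix; rewrite -EFinD lee_fin tb.
  rewrite ge0_integralD//; last 2 first.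
  - by move=> x _; rewrite lee_fin csq_ge0.
  - exact: cmeas_csqE.
  rewrite integral_cst// mul1e EFinD; apply: leeD; last exact: sqint_aterm.
  exact: muI.
have [ae _ cE] := csum_integral mI mu_ ule.
rewrite /fatom.
transitivity (csum (fun k => cint I (u k))).
  by congr csum; apply/funext => k; rewrite cint_tdiff_atom cintZ.
rewrite -cE.
have csE : {ae mu, forall x, I x -> csum (u ^~ x) = eweight x * asumfun mn.1 x * ph x}.
  apply: filterS (ae_csummable_aterm mn.1) => x /[apply] sx.
  rewrite mulrAC -csumZ//; congr csum; apply/funext => k.
  have perm (z1 z2 z3 z4 : R[i]) : z1 * (z2 * z3 * z4) = z2 * z4 * (z1 * z3) by ring.
  exact: perm.
apply: ae_eq_cint => //; first exact: cmeas_csum.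
by apply: cmeasM => //; apply: cmeasM => //; exact: cmeas_asumfun.
Qed.

End GaborIdentity.

(** * Transferring frame bounds and assembling the equivalences *)

Section FrameTransfer.
Variable R : realType.
Notation setTR := [set: measurableTypeR R].
Notation L2T := (L2on setTR).
Notation norm2 := (sqint setTR).

(** Each f' is matched with some f of comparable norm and comparable energy; no linearity of the
    matching enters, which leaves linearity to the density arguments alone. *)
Lemma frame_bounds_comp (P P' : (R -> R[i]) -> Prop) (Q Q' : (R -> R[i]) -> \bar R)
    (k1 k2 c1 c2 : R) : 0 < k1 -> 0 < k2 -> 0 < c1 -> 0 < c2 ->
  (forall f', P' f' -> exists f, [/\ P f,
     (k1%:E * norm2 f' <= norm2 f)%E, (norm2 f <= k2%:E * norm2 f')%E,
     (c1%:E * Q f <= Q' f')%E & (Q' f' <= c2%:E * Q f)%E]) ->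
  frame_bounds P Q -> frame_bounds P' Q'.
Proof.
move=> k10 k20 c10 c20 h [A [B [A0 [B0 AB]]]].
exists (c1 * (A * k1)), (c2 * (B * k2)); rewrite !mulr_gt0//; do 2 split => //.
  move=> f' /h[f [Pf n1 n2 q1 q2]]; have [Af Bf] := AB _ Pf; split.
  apply: le_trans q1; rewrite EFinM -muleA; apply: lee_wpmul2l; first by rewrite lee_fin ltW.
  apply: le_trans Af; rewrite EFinM -muleA; apply: lee_wpmul2l => //; by rewrite lee_fin ltW.
apply: (le_trans q2); rewrite EFinM -muleA; apply: lee_wpmul2l; first by rewrite lee_fin ltW.
apply: (le_trans Bf); rewrite EFinM -muleA; apply: lee_wpmul2l => //; by rewrite lee_fin ltW.
Qed.

End FrameTransfer.

Section MainChain.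
Variable R : realType.
Notation mu := (@lebesgue_measure R).
Notation setTR := [set: measurableTypeR R].
Notation L2T := (L2on setTR).
Notation norm2 := (sqint setTR).
Variables (alpha w : R) (a : nat -> R[i]) (b : nat -> R).
Hypotheses (alpha0 : 0 < alpha) (w0 : w < 0) (asum : csummable a).

Let p := alpha^-1.
Let p0 : 0 < p. Proof. by rewrite invr_gt0. Qed.
Let I : set (measurableTypeR R) := `[0, p].
Let mI : measurable I. Proof. exact: measurable_itv. Qed.
Let q := expR (2 * pi * w * p).
Let q0 : 0 < q. Proof. exact: expR_gt0. Qed.
Let q1 : q < 1. Proof. exact: shift_ratio_lt1. Qed.

Definition energy (La : int * int -> (R -> R[i]) -> R[i]) (f : R -> R[i]) : \bar R :=
  (\esum_(mn in [set: int * int]) (csq (La mn f))%:E)%E.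

Lemma sum_fatom_tdiff G m : L2T G ->
  (\esum_(n in [set: int]) (csq (fatom alpha w a b (m, n) (tdiff q p G)))%:E =
   p%:E * sqint I (fun x => eweight w x * asumfun alpha w a b G m x)%R)%E.
Proof.
move=> G2.
have me : cmeas I (eweight w) by apply: cmeas_real; exact: measurable_expRM.
have h2 : L2on `[0, 0 + p] (fun x => eweight w x * asumfun alpha w a b G m x).
  rewrite add0r; apply: (@L2onM_bounded _ _ _ _ 1) => //; last exact: L2_asumfun.
  move=> x; rewrite /= in_itv/= => /andP[x0 _].
  rewrite csq_real expr_le1 ?expR_ge0// -[leRHS]expR0 ler_expR nmulr_rle0//.
  by rewrite nmulr_llt0// mulr_gt0// pi_gt0.
have := parseval p0 h2; rewrite add0r -/I => <-.
(* [fatom_tdiff] produces the frequency of index -n, while [parseval] is indexed by n. *)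
rewrite -[RHS]esum_int_opp; last by move=> z; rewrite lee_fin csq_ge0.
by apply: eq_esum => n _; rewrite fatom_tdiff.
Qed.

Lemma Aquad_asumfun G :
  Aquad alpha w a b G = (\esum_(m in [set: int]) sqint I (asumfun alpha w a b G m))%E.
Proof. by []. Qed.

Lemma sqint_eweight G m : L2T G ->
  ((q ^+ 2)%:E * sqint I (asumfun alpha w a b G m) <=
   sqint I (fun x => eweight w x * asumfun alpha w a b G m x)%R)%E /\
  (sqint I (fun x => eweight w x * asumfun alpha w a b G m x)%R <=
   sqint I (asumfun alpha w a b G m))%E.
Proof.
move=> G2.
have piw0 : 2 * pi * w < 0 by rewrite nmulr_llt0// mulr_gt0// pi_gt0.
have me : cmeas I (eweight w) by apply: cmeas_real; exact: measurable_expRM.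
have [ma _] : L2on I (asumfun alpha w a b G m) by exact: L2_asumfun.
have e1 x : I x -> q ^+ 2 <= csq (eweight w x) <= 1.
  rewrite /I/= in_itv/= => /andP[x0 xp]; rewrite csq_real; apply/andP; split.
    by rewrite ler_sqr ?nnegrE ?expR_ge0// ler_expR ler_nM2l.
  by rewrite expr_le1 ?expR_ge0// -[leRHS]expR0 ler_expR nmulr_rle0.
split.
  rewrite /sqint -ge0_integralZl//; last 3 first.
  - exact: cmeas_csqE.
  - by move=> x _; rewrite lee_fin csq_ge0.
  - by rewrite lee_fin sqr_ge0.
  apply: ge0_le_integral => //.
  - by move=> x _; rewrite -EFinM lee_fin mulr_ge0 ?csq_ge0// sqr_ge0.
  - by apply: emeasurable_funM => //; exact: cmeas_csqE.
  - by apply: cmeas_csqE; exact: cmeasM.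
  - by move=> x /e1/andP[h _]; rewrite -EFinM lee_fin csqM ler_wpM2r ?csq_ge0.
apply: ge0_le_integral => //.
- by move=> x _; rewrite lee_fin csq_ge0.
- by apply: cmeas_csqE; exact: cmeasM.
- exact: cmeas_csqE.
- by move=> x /e1/andP[_ h]; rewrite lee_fin csqM ler_piMl ?csq_ge0.
Qed.

Lemma energy_tdiff G : L2T G ->
  ((p * q ^+ 2)%:E * Aquad alpha w a b G <= energy (fatom alpha w a b) (tdiff q p G))%E /\
  (energy (fatom alpha w a b) (tdiff q p G) <= p%:E * Aquad alpha w a b G)%E.
Proof.
move=> G2; rewrite /energy esum_int2; last by move=> z; rewrite lee_fin csq_ge0.
rewrite (eq_esum (fun m _ => sum_fatom_tdiff m G2)) Aquad_asumfun.
rewrite -esumZl_int; last 2 first.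
- by rewrite mulr_ge0 ?sqr_ge0// ltW.
- by move=> z; exact: sqint_ge0.
rewrite -esumZl_int; last 2 first.
- exact: ltW.
- by move=> z; exact: sqint_ge0.
split; apply: le_esum => m _; have [h1 h2] := sqint_eweight m G2.
  by rewrite EFinM -muleA; apply: lee_wpmul2l => //; rewrite lee_fin ltW.
by apply: lee_wpmul2l => //; rewrite lee_fin ltW.
Qed.

(** From [fatom] to [Aquad] it suffices to insert [tdiff G], which is defined for every G.
    Conversely, a bound for [Aquad] controls the energy only on the range of [tdiff], and density
    extends it. The constants combine [norm2_tdiff_ge], [norm2_tdiff_le] and the range of the
    exponential weight. *)
Lemma frame_Aquad_fatom :
  frame_bounds L2T (energy (fatom alpha w a b)) <-> frame_bounds L2T (Aquad alpha w a b).
Proof.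
have d0 : 0 < 1 - q by rewrite subr_gt0.
have pq0 : 0 < p * q ^+ 2 by rewrite mulr_gt0// exprn_gt0.
split=> h.
  apply: (@frame_bounds_comp _ _ _ _ _ ((1 - q) ^+ 2) 4 p^-1 (p * q ^+ 2)^-1 _ _ _ _ _ h).
  - by rewrite exprn_gt0.
  - by [].
  - by rewrite invr_gt0.
  - by rewrite invr_gt0.
  move=> G G2; exists (tdiff q p G); have [e1 e2] := energy_tdiff G2; split.
  - exact: L2_tdiff.
  - exact: norm2_tdiff_ge.
  - exact: norm2_tdiff_le.
  - by rewrite lee_pdivrMl.
  - by rewrite lee_pdivlMl.
apply: (@frame_bounds_dense _ _ (fatom alpha w a b) (@tdiff_range R q p)).
- by move=> _ [G G2 ->]; exact: L2_tdiff.
- by move=> f e; exact: tdiff_dense.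
- by move=> mn f g f2 g2; exact: fatomB.
- by move=> mn; exact: fatom_bounded.
apply: (@frame_bounds_comp _ _ _ _ _ 4^-1 ((1 - q) ^+ 2)^-1 (p * q ^+ 2) p _ _ _ _ _ h) => //.
  by rewrite invr_gt0 exprn_gt0.
move=> _ [G G2 ->]; exists G; have [e1 e2] := energy_tdiff G2; split => //.
- by rewrite lee_pdivrMl//; exact: norm2_tdiff_le.
- by rewrite lee_pdivlMl ?exprn_gt0//; exact: norm2_tdiff_ge.
Qed.

Definition bounded_L2 (f : R -> R[i]) : Prop :=
  exists n : nat, [/\ L2T f, (forall t, n%:R < `|t| -> f t = 0) & (0 < n)%N].

Lemma energy_hat f : bounded_L2 f ->
  energy (fgabor alpha w a b) f = ((csq (kap R))%:E * energy (fatom alpha w a b) (hat f))%E.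
Proof.
move=> [n [f2 fout _]]; have fi := bounded_support_L2_integrable f2 fout.
rewrite /energy !esum_int2; last 2 first.
- by move=> z; rewrite lee_fin csq_ge0.
- by move=> z; rewrite lee_fin csq_ge0.
rewrite -esumZl_int ?csq_ge0//; last first.
  by move=> z; apply: esum_ge0 => ? _; rewrite lee_fin csq_ge0.
apply: eq_esum => m _; rewrite -esumZl_int ?csq_ge0//; last first.
  by move=> z; rewrite lee_fin csq_ge0.
by apply: eq_esum => k _; rewrite fgabor_fatom// csqM EFinM.
Qed.

Lemma norm2_hat_bounded f : bounded_L2 f -> norm2 (hat f) = norm2 f.
Proof.
by move=> [n [f2 fout n0]]; apply: plancherel fout => //; rewrite ltr0n.
Qed.

(** For bounded-support functions the two energies are proportional and the norms agree. To conclude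
    for [fatom] one needs density of the transforms of such functions; to conclude for [fgabor],
    density of the functions themselves. *)
Lemma frame_fgabor_fatom :
  frame_bounds L2T (energy (fgabor alpha w a b)) <-> frame_bounds L2T (energy (fatom alpha w a b)).
Proof.
have kap0 : 0 < csq (kap R) by rewrite csq_kap mulr_gt0// exprn_gt0// pi_gt0.
split=> h.
  apply: (@frame_bounds_dense _ _ (fatom alpha w a b) (@hat_bounded R)).
  - by move=> _ [f [n [f2 fout n0 ->]]]; apply: hat_L2 fout => //; rewrite ltr0n.
  - by move=> f e; exact: hat_bounded_dense.
  - by move=> mn f g f2 g2; exact: fatomB.
  - by move=> mn; exact: fatom_bounded.
  apply: (@frame_bounds_comp _ _ _ _ _ 1 1 (csq (kap R))^-1 (csq (kap R))^-1 _ _ _ _ _ h).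
  - by [].
  - by [].
  - by rewrite invr_gt0.
  - by rewrite invr_gt0.
  move=> _ [f [n [f2 fout n0 ->]]]; have fb : bounded_L2 f by exists n.
  exists f; rewrite (norm2_hat_bounded fb) (energy_hat fb) !mul1e.
  by rewrite muleA -EFinM mulVf ?gt_eqF// mul1e; split.
apply: (@frame_bounds_dense _ _ (fgabor alpha w a b) bounded_L2).
- by move=> f [n []].
- move=> f e f2 e0; have [n n0 hn] := trunc_dense f2 e0; exists (trunc_supp n f) => //.
  by exists n; split => //; [exact: L2_trunc|move=> t; exact: trunc_supp_out].
- by move=> mn f g f2 g2; exact: fgaborB.
- by move=> mn; exact: fgabor_bounded.
apply: (@frame_bounds_comp _ _ _ _ _ 1 1 (csq (kap R)) (csq (kap R)) _ _ _ _ _ h) => //.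
move=> f fb; have [n [f2 fout n0]] := fb; exists (hat f).
rewrite -/(energy (fgabor alpha w a b) f).
rewrite (norm2_hat_bounded fb) (energy_hat fb) !mul1e; split => //.
by apply: hat_L2 fout => //; rewrite ltr0n.
Qed.

Lemma csq_inner_fgabor f mn : L2T f ->
  csq (inner f (gabor (gfun a b w) alpha mn)) = csq (fgabor alpha w a b mn (fun t => conjc (f t))).
Proof.
move=> f2; have h2 := L2_gabor alpha b w0 asum mn.
rewrite -[RHS]csqJ /fgabor -cintJ//; last exact: cintegrable_mulL2 (L2onJ f2) _.
congr csq; rewrite -[LHS]/(cint setTR (fun t => f t * conjc (gabor (gfun a b w) alpha mn t))).
apply: eq_cint => t _; move: (gabor _ _ _ _) => z.
by case: (f t) z => [x y] [x' y']; apply: complex_eq => /=; ring.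
Qed.

(** Pointwise conjugation is an involution of L^2 preserving the norm, so quantifying over f or over
    its conjugate gives the same bounds. *)
Lemma is_frame_fgabor :
  is_frame (gabor (gfun a b w) alpha) <-> frame_bounds L2T (energy (fgabor alpha w a b)).
Proof.
have E f : L2T f -> (\esum_(j in [set: int * int])
   (csq (inner f (gabor (gfun a b w) alpha j)))%:E)%E =
   energy (fgabor alpha w a b) (fun t => conjc (f t)).
  by move=> f2; apply: eq_esum => mn _; rewrite csq_inner_fgabor.
have N f : norm2 (fun t => conjc (f t)) = norm2 f.
  by apply: eq_sqint => t _; rewrite csqJ.
split.
  move=> [_ [A [B [A0 [B0 h]]]]]; exists A, B; split; first exact: A0.
  split; first exact: B0.
  move=> f f2; have fJ2 : L2T (fun t => conjc (f t)) by exact: L2onJ.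
  have := h _ fJ2; rewrite E// -[normsq _]/(norm2 _) N.
  by rewrite (_ : (fun t => conjc (conjc (f t))) = f)//; apply/funext => t; rewrite conjcK.
move=> [A [B [A0 [B0 h]]]]; split; first by move=> mn; exact: L2_gabor.
exists A, B; split; first exact: A0.
split; first exact: B0.
move=> f f2; rewrite E// -[normsq _]/(norm2 _) -N.
by apply: h; exact: L2onJ.
Qed.

End MainChain.

Theorem theorem3 (R : realType) (alpha w : R) (a : nat -> R[i]) (b : nat -> R) :
  0 < alpha -> w < 0 ->
  (\esum_(k in [set: nat]) (cabs (a k))%:E < +oo)%E ->
  (forall k, 0 <= b k) ->
  is_frame (gabor (gfun a b w) alpha) <->
  exists c C : R, 0 < c /\ 0 < C /\
    forall G : R -> R[i], L2 G ->
      (c%:E * normsq G <= Aquad alpha w a b G)%E /\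
      (Aquad alpha w a b G <= C%:E * normsq G)%E.
Proof.
move=> alpha0 w0 asum _.
have {}asum : csummable a.
  by rewrite /csummable nneseries_esumT// => k; rewrite lee_fin cabs_ge0.
have := is_frame_fgabor alpha b w0 asum.
have := frame_fgabor_fatom alpha b w0 asum.
have := frame_Aquad_fatom b alpha0 w0 asum.
by move=> h1 h2 h3; rewrite h3 h2 h1.
Qed.
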